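(* Let $d\ge 1$ and $n\ge 1$ be integers, let $V$ be an $n$-dimensional complex vector space with basis $x_1,\dots,x_n$, and let $F\in \operatorname{Sym}^{d+1}V=\mathbb{C}[x_1,\dots,x_n]_{d+1}$ be a homogeneous polynomial of degree $d+1$. Then $F$ is semistable with respect to the $\operatorname{SL}(V)=\operatorname{SL}(n)$-action on $\mathbb{C}[x_1,\dots,x_n]_{d+1}$ if and only if \[ \nabla(F):=\operatorname{span}\langle \partial F/\partial x_1,\dots,\partial F/\partial x_n\rangle \] is a well-defined point of $\operatorname{Grass}\bigl(n,\mathbb{C}[x_1,\dots,x_n]_d\bigr)$ (that is, the span has dimension $n$) and is semistable with respect to the $\operatorname{SL}(n)$-action on this Grassmannian. Furthermore, if $F$ is stable, then $\nabla(F)$ is polystable; moreover, for $F$ stable, $\nabla(F)$ is stable if and only if $F\notin \operatorname{Sym}^{d+1}U+\operatorname{Sym}^{d+1}W$ for every non-trivial direct sum decomposition $V=U\oplus W$ (i.e., $F$ is not a non-trivial sum of two polynomials in disjoint sets of variables, in any system of linear coordinates).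
   Context: We work over $\mathbb{C}$. $\operatorname{Grass}(k,E)$ is the Grassmannian of $k$-dimensional subspaces of a vector space $E$. $\operatorname{SL}(V)$ acts on $\operatorname{Sym}^m V=\mathbb{C}[x_1,\dots,x_n]_m$ (the degree $m$ forms on $V^\vee$) by linear changes of variables, and hence acts on $\operatorname{Grass}(k,\operatorname{Sym}^m V)$. Stability notions are those of Geometric Invariant Theory. A form $F$ is semistable if the closure of its $\operatorname{SL}(V)$-orbit in $\operatorname{Sym}^{d+1}V$ does not contain $0$. It is polystable if it is nonzero with closed orbit, and stable if in addition its stabilizer in $\operatorname{SL}(V)$ is finite. For points of $\operatorname{Grass}(k,\operatorname{Sym}^m V)$, the same notions are taken with respect to the Plücker linearization: a point is semistable (polystable, stable) if a nonzero vector of $\wedge^k\operatorname{Sym}^m V$ on the line representing it is semistable (has closed orbit; has closed orbit and finite stabilizer). Equivalently, a semistable point is polystable if its orbit is closed in the semistable locus, and stable if moreover its stabilizer is finite. A decomposition $V=U\oplus W$ is non-trivial if $U\neq 0$ and $W\ne 0$. *)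

(* Defs.v *)
From HB Require Import structures.
From mathcomp Require Import all_boot all_order all_algebra.
From mathcomp Require Import mpoly.

Set Implicit Arguments.
Unset Strict Implicit.
Unset Printing Implicit Defensive.

Import GRing.Theory passmx.
Local Open Scope ring_scope.

(** * Stability of vectors in a representation of SL(n) *)

Section Stability.
Variables (C : fieldType) (n : nat) (W : vectType C).
Implicit Types (act : 'M[C]_n -> W -> W) (S : W -> Prop) (w y : W).

(* The closure is the Zariski closure in the affine space W. *)
Definition zariski_closure S w : Prop :=
  forall P : {mpoly C[\dim {:W}]},
    (forall y, S y -> P.@[fun i => coord (vbasis {:W}) i y] = 0) ->
    P.@[fun i => coord (vbasis {:W}) i w] = 0.

Definition SL_orbit act w y : Prop :=
  exists2 g : 'M[C]_n, \det g = 1 & y = act g w.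

Definition semistable act w : Prop :=
  ~ zariski_closure (SL_orbit act w) 0.

Definition closed_orbit act w : Prop :=
  forall y, zariski_closure (SL_orbit act w) y -> SL_orbit act w y.

Definition finite_stabilizer act w : Prop :=
  exists s : seq 'M[C]_n, forall g, \det g = 1 -> act g w = w -> g \in s.

Definition polystable act w : Prop := w <> 0 /\ closed_orbit act w.

Definition stable act w : Prop := polystable act w /\ finite_stabilizer act w.

End Stability.

(** * Exterior powers and Grassmannians *)

Section Exterior.
Variables (C : fieldType) (k : nat) (E : vectType C).

Definition increasing N (s : {ffun 'I_k -> 'I_N}) : bool :=
  [forall i : 'I_k, forall j : 'I_k, (i < j)%N ==> (s i < s j)%N].

(* The exterior power /\^k E, in the coordinates given by its basis
   e_(s 0) /\ ... /\ e_(s (k-1)), for s increasing and e = vbasis {:E}. *)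
Definition ext_index := {s : {ffun 'I_k -> 'I_(\dim {:E})} | increasing s}.
Definition ext := {ffun ext_index -> C^o}.

Definition wedge (v : 'I_k -> E) : ext :=
  [ffun s : ext_index =>
     \det (\matrix_(i, j) coord (vbasis {:E}) (val s j) (v i))].

(* /\^k f is the linear map sending e_(s 0) /\ ... /\ e_(s (k-1)) to
   f e_(s 0) /\ ... /\ f e_(s (k-1)). *)
Definition ext_map (f : E -> E) (w : ext) : ext :=
  \sum_(s : ext_index) w s *: wedge (fun i => f (vbasis {:E})`_(val s i)).

Definition Grass := {U : {vspace E} | \dim U == k}.

Definition plucker_line (P : Grass) : {vspace ext} :=
  <[wedge (fun i => (vbasis (val P))`_i)]>%VS.

End Exterior.

Section GrassStability.
Variables (C : fieldType) (n k : nat) (E : vectType C).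
Variable act : 'M[C]_n -> E -> E.

Definition ext_act (g : 'M[C]_n) : ext k E -> ext k E := ext_map (act g).

Definition Grass_semistable (P : Grass k E) : Prop :=
  exists w, [/\ w \in plucker_line P, w <> 0 & semistable ext_act w].

Definition Grass_polystable (P : Grass k E) : Prop :=
  exists w, [/\ w \in plucker_line P, w <> 0 & polystable ext_act w].

Definition Grass_stable (P : Grass k E) : Prop :=
  exists w, [/\ w \in plucker_line P, w <> 0 & stable ext_act w].

End GrassStability.

(** * Forms *)

Section Substitution.
Variable C : fieldType.

(* g : 'M_n acts on linear forms by x_j |-> \sum_i g i j x_i. *)
Definition linear_subst n (g : 'M[C]_n) (p : {mpoly C[n]}) : {mpoly C[n]} :=
  p \mPo [tuple \sum_(i < n) g i j *: 'X_i | j < n].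

Lemma linear_subst_homog n d (g : 'M[C]_n) (p : {mpoly C[n]}) :
  p \is d.-homog -> linear_subst g p \is d.-homog.
Proof.
move=> /dhomogP hp; rewrite /linear_subst comp_mpolyE big_seq rpred_sum // => m.
move=> /hp /= <-; apply: rpredZ; rewrite mdegE.
apply: (big_ind2 (fun q e => q \is e.-homog)) => [|p1 e1 p2 e2|i _].
- exact: dhomog1.
- exact: dhomogM.
- rewrite tnth_mktuple -[X in X.-homog]mul1n; apply: dhomogMn.
  by apply: rpred_sum => j _; apply: rpredZ; rewrite dhomogX /= mdeg1.
Qed.

Lemma mderiv_homog n d (i : 'I_n) (p : {mpoly C[n]}) :
  p \is d.+1.-homog -> p^`M(i) \is d.-homog.
Proof.
move=> hp; apply/dhomogP => m; apply: contraTeq => nd.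
rewrite mcoeff_msupp negbK mcoeff_mderiv (dhomog_nemf_coeff hp) ?mul0rn //.
by rewrite /= mdegD mdeg1 addn1 eqSS.
Qed.

End Substitution.

Section Forms.
Variables (C : fieldType) (n d : nat).

Definition form_act (g : 'M[C]_n) (F : dhomog n C d) : dhomog n C d :=
  DHomog (linear_subst_homog g (dhomog_is_dhomog F)).

Lemma form_act_is_linear g : linear (form_act g).
Proof. by move=> c F G; apply: val_inj; rewrite /= /linear_subst linearP. Qed.

HB.instance Definition _ g :=
  GRing.isLinear.Build C (dhomog n C d) (dhomog n C d) _ (form_act g)
    (form_act_is_linear g).

Definition partial (i : 'I_n) (F : dhomog n C d.+1) : dhomog n C d :=
  DHomog (mderiv_homog i (dhomog_is_dhomog F)).

End Forms.

(* n.+1 variables, not n: forms of degree d in zero variables have no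
   vectType instance. *)
Definition nabla (C : fieldType) (n d : nat) (F : dhomog n.+1 C d.+1) :
    {vspace dhomog n.+1 C d} :=
  <<[seq partial i F | i : 'I_n.+1]>>%VS.

(* The image of Sym^m U in Sym^m V, for U a subspace of V = Sym^1 V: the forms
   of degree m in a basis of U. *)
Definition in_Sym (C : fieldType) (n m : nat)
    (U : {vspace dhomog n.+1 C 1}) (F : {mpoly C[n.+1]}) : Prop :=
  exists2 q : {mpoly C[\dim U]}, q \is m.-homog &
    F = q \mPo [tuple of [seq val u | u <- vbasis U]].

Definition nontrivial_decomposition (C : fieldType) (V : vectType C)
    (U W : {vspace V}) : Prop :=
  [/\ (U + W = fullv)%VS, (U :&: W = 0)%VS, U <> 0%VS & W <> 0%VS].

(* Main.v *)
From HB Require Import structures.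
Require Import Defs.
From mathcomp Require Import all_boot all_order all_algebra.
From mathcomp Require Import fingroup perm ring_quotient generic_quotient.
From mathcomp Require Import boolp classical_sets functions filter.
From mathcomp Require Import reals complex mpoly.
From mathcomp Require Import ring zify.

(** Both implications compare F with the vector
      w = dF/dx_0 /\ ... /\ dF/dx_n   (wedge_gradient F)
    on the Plucker line of nabla F. One of them is formal: F |-> w is a polynomial map,
    equivariant under SL(n + 1), and sends 0 to 0, so that w is unstable when F is
    (semistable_of_gradient).

    For the others, the closure of the orbit of w is explored with valuations. A point y
    of the closure is the residue, at a place of some field K over C, of g w for a matrix
    g in SL(n + 1) over K (closure_generic_point): K is an ultrapower of C, g is a generic
    matrix of the orbit near y, and the place comes from Chevalley's extension theorem
    (place_extension). Over the valuation ring, g = k1 t k2 with k1 and k2 integral of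
    determinant 1 and t diagonal (cartan). The value group is arbitrary, but by Farkas'
    lemma some integers l have the signs of the valuations of the finitely many monomials
    in t that matter (sign_pattern); thus t behaves like a one-parameter subgroup of
    weights l, and the minors of the gradient of F, in the coordinates given by the
    residue of k2, have nonnegative weights, and positive ones when y = 0.

    These weights must be carried from the gradient to F. After a unipotent change of
    coordinates the partial derivatives of F have orders k_i, with respect to l, whose sum
    is the weight of a nonzero minor (adapted_coordinates). A monomial m of F containing
    x_i thus satisfies l(m) >= k_i + l_i; averaging over the variables of m, the weights
    (n + 1) (d l_i - k_i) + sum k, whose sum is 0, are at least (d + 1) sum k on F
    (corrected_weight_ge). If w is unstable these weights destabilize F
    (gradient_unstable_place). If F is stable they vanish, and then F is a sum of forms in
    disjoint sets of variables, one for each value of l (gradient_split_place).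

    In the stable case with d > 1, replacing t by a matrix s constant on the blocks changes
    g by an integral factor, and s only rescales the derivatives of F. What remains of g is
    a unipotent matrix, whose entries are seen in the minors of its action on the gradient
    and are therefore integral (unipotent_integral). The residue of the corrected g is a
    matrix over C taking w to y, and the orbit of w is closed (gradient_residue). For d = 1
    every wedge product of n + 1 linear forms is fixed by SL(n + 1).

    Finally, the splitting of F is what stability of w excludes. An infinite stabilizer
    contains a generic element which is not integral at some place
    (stabilizer_generic_point); then l is not constant and F splits. Conversely a torus
    acting by scalars on the two summands of V multiplies each derivative of a split F by
    a scalar, and it fixes w when its determinant is 1 (block_infinite_stabilizer). *)

Set Implicit Arguments.
Unset Strict Implicit.
Unset Printing Implicit Defensive.

Import Order.TTheory GRing.Theory Num.Theory.
Local Open Scope ring_scope.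

(** * Places *)

(** A place of K over C, presented as its valuation ring together with the
    inclusion into K and the residue map to C, so that integrality and reduction
    of matrices and polynomials are handled by ring morphisms. *)
Record place (C K : fieldType) (i : {rmorphism C -> K}) := Place {
  vring : comNzRingType;
  vval : {rmorphism vring -> K};
  vres : {rmorphism vring -> C};
  vcst : {rmorphism C -> vring};
  vval_inj : injective vval;
  vvalC : forall c, vval (vcst c) = i c;
  vresC : forall c, vres (vcst c) = c;
  vtotal : forall x,
    (exists y, x = vval y) \/ (exists2 y, x^-1 = vval y & vres y = 0) }.

Section PlaceExtension.
Variables (C : closedFieldType) (K : fieldType) (i : {rmorphism C -> K}).
Implicit Types S : set (K * C).

(** The graph of a residue map defined on a subalgebra of K: the exclusion of (0, 1)
    makes the second coordinate a function of the first. *)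
Definition partial_place S : Prop :=
  [/\ forall c, S (i c, c),
      forall z z', S z -> S z' -> S (z.1 - z'.1, z.2 - z'.2),
      forall z z', S z -> S z' -> S (z.1 * z'.1, z.2 * z'.2)
    & ~ S (0, 1)].

Section Maximal.
Variable S : set (K * C).
Hypothesis S_partial : partial_place S.
Hypothesis S_max : forall S', partial_place S' -> (S `<=` S' -> S' `<=` S)%classic.

Let Sc c : S (i c, c). Proof. by have [] := S_partial. Qed.
Let SB x a y b : S (x, a) -> S (y, b) -> S (x - y, a - b).
Proof. by have [_ h _ _] := S_partial => h1 h2; apply: (h _ _ h1 h2). Qed.
Let SM x a y b : S (x, a) -> S (y, b) -> S (x * y, a * b).
Proof. by have [_ _ h _] := S_partial => h1 h2; apply: (h _ _ h1 h2). Qed.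
Let S01 : ~ S (0, 1). Proof. by have [] := S_partial. Qed.
Let S0 : S (0, 0). Proof. by have := Sc 0; rewrite rmorph0. Qed.
Let S1 : S (1, 1). Proof. by have := Sc 1; rewrite rmorph1. Qed.
Let SD x a y b : S (x, a) -> S (y, b) -> S (x + y, a + b).
Proof.
by move=> h1 h2; have := SB h1 (SB S0 h2); rewrite !sub0r !opprK.
Qed.
Let SX x a n : S (x, a) -> S (x ^+ n, a ^+ n).
Proof. by move=> h; elim: n => [|n IH]; rewrite ?expr0 // !exprS; apply: SM. Qed.
Let S0D x y : S (x, 0) -> S (y, 0) -> S (x + y, 0).
Proof. by move=> h h'; have := SD h h'; rewrite addr0. Qed.
Let S0M x y b : S (x, 0) -> S (y, b) -> S (x * y, 0).
Proof. by move=> h h'; have := SM h h'; rewrite mul0r. Qed.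
Let Ssum (I : Type) (r : seq I) (F : I -> K) (G : I -> C) :
  (forall k, S (F k, G k)) -> S (\sum_(k <- r) F k, \sum_(k <- r) G k).
Proof.
by move=> h; elim: r => [|k r IH]; rewrite ?big_nil // !big_cons; apply: SD.
Qed.
Let Sfun x a b : S (x, a) -> S (x, b) -> a = b.
Proof.
move=> h1 h2; have h := SB h1 h2; apply/eqP; rewrite -subr_eq0; apply/eqP.
apply: contrapT => /eqP ne; apply: S01.
have := SM h (Sc (a - b)^-1); rewrite subrr mul0r mulfV //.
Qed.

Let PS (p : {poly K}) (q : {poly C}) := forall k, S (p`_k, q`_k).

Let PSB p q p' q' : PS p q -> PS p' q' -> PS (p - p') (q - q').
Proof. by move=> h h' k; rewrite !coefB; apply: SB. Qed.
Let PSM p q p' q' : PS p q -> PS p' q' -> PS (p * p') (q * q').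
Proof. by move=> h h' k; rewrite !coefM; apply: Ssum => j; apply: SM. Qed.
Let PSC x a : S (x, a) -> PS x%:P a%:P.
Proof. by move=> h k; rewrite !coefC; case: eqP. Qed.
Let PSX : PS 'X 'X.
Proof. by move=> k; rewrite !coefX; case: eqP. Qed.
Let PSi q : PS (map_poly i q) q.
Proof. by move=> k; rewrite coef_map; apply: Sc. Qed.

(** Adjoining (x, c) to S for every c must fail; the residues of the relations
    satisfied by x then form an ideal of C[X] without a common root, and such an
    ideal contains 1. *)
Let relation x : (forall c, ~ S (x, c)) ->
  exists p, PS p 1 /\ p.[x] = 0.
Proof.
move=> Sx.
have step c : exists p q, [/\ PS p q, p.[x] = 0 & q.[c] = 1].
  apply: contrapT => no; apply: (Sx c).
  pose S' : set (K * C) := fun z => exists p q, [/\ PS p q, p.[x] = z.1 & q.[c] = z.2].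
  have SS' : (S `<=` S')%classic.
    by case=> y b yb; exists y%:P, b%:P; rewrite !hornerC; split => //; apply: PSC.
  apply: (S_max (S' := S')) => //; last first.
    by exists 'X, 'X; rewrite !hornerX; split.
  split; first by move=> b; apply: SS'.
  - move=> [y b] [y' b'] [p [q [/= h <- <-]]] [p' [q' [/= h' <- <-]]].
    by exists (p - p'), (q - q'); rewrite !hornerE; split => //; apply: PSB.
  - move=> [y b] [y' b'] [p [q [/= h <- <-]]] [p' [q' [/= h' <- <-]]].
    by exists (p * p'), (q * q'); rewrite !hornerE; split => //; apply: PSM.
  - by case=> p [q [h1 /= h2 h3]]; apply: no; exists p, q.
pose J q := exists2 p, PS p q & p.[x] = 0.
have exJ : exists n, `[< exists q, [/\ J q, q != 0 & size q = n] >].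
  have [p [q [h1 h2 h3]]] := step 0; exists (size q); apply/asboolP; exists q.
  split=> //; first by exists p.
  by apply/eqP => q0; move: h3; rewrite q0 horner0 => /esym/eqP; rewrite oner_eq0.
have [n /asboolP[q [[p pq px] q0 sq]] qmin] := ex_minnP exJ.
have [sq1|sq1] := leqP (size q) 1.
  have /size_poly1P[a a0 qa] : size q == 1%N.
    by rewrite eqn_leq sq1 lt0n size_poly_eq0.
  exists ((i a^-1)%:P * p); rewrite !hornerE px mulr0; split => //.
  have -> : 1 = (a^-1)%:P * q by rewrite qa -polyCM mulVf.
  by apply: PSM => //; apply: PSC.
have /closed_rootP[c /rootP qc] : size q != 1%N by rewrite neq_ltn sq1 orbT.
have [p' [q' [h1 h2 h3]]] := step c.
have [r0|r0] := eqVneq (q' %% q) 0.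
  move/eqP: r0 => /dvdpP[r rq]; move: h3; rewrite rq hornerM qc mulr0.
  by move=> /esym/eqP; rewrite oner_eq0.
suff : (size q <= size (q' %% q)%R)%N by rewrite leqNgt ltn_modp q0.
rewrite sq; apply/qmin/asboolP; exists (q' %% q); split => //.
exists (p' - map_poly i (q' %/ q) * p); last by rewrite !hornerE h2 px mulr0 subr0.
have -> : q' %% q = q' - (q' %/ q) * q by rewrite {2}(divp_eq q' q) addrC addKr.
by apply: PSB => //; apply: PSM.
Qed.

Let inv a b : S (a, b) -> b != 0 -> S (a^-1, b^-1).
Proof.
move=> ab b0.
have a0 : a != 0.
  by apply/eqP => a0; move: ab; rewrite a0 => /Sfun/(_ S0)/eqP; rewrite (negPf b0).
have [[c ac]|no] := pselect (exists c, S (a^-1, c)).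
  have := SM ab ac; rewrite mulfV // => /Sfun/(_ S1)/(congr1 ( *%R b^-1)).
  by rewrite mulKf // mulr1 => <-.
have [//|p [pq px]] := @relation a^-1; first by move=> c h; apply: no; exists c.
pose m := (size p).
have : S (\sum_(k < m.+1) p`_k * a ^+ (m - k), \sum_(k < m.+1) (1 : {poly C})`_k * b ^+ (m - k)).
  by apply: Ssum => k; apply: SM => //; apply: SX.
have -> : \sum_(k < m.+1) p`_k * a ^+ (m - k) = 0.
  transitivity (a ^+ m * p.[a^-1]); last by rewrite px mulr0.
  rewrite (@horner_coef_wide _ m.+1) // mulr_sumr; apply: eq_bigr => k _.
  rewrite mulrCA exprVn -[in a ^+ m](subnK (_ : k <= m)%N) ?exprD ?mulfK //.
    by rewrite expf_neq0.
  by rewrite -ltnS.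
rewrite big_ord_recl big1 => [|k _]; last by rewrite coef1 mul0r.
rewrite coef1 /= mul1r addr0 subn0 => /Sfun/(_ S0)/eqP.
by rewrite expf_eq0 (negPf b0) andbF.
Qed.

Let comb x m := exists2 w : nat -> K, (forall k, S (w k, 0)) &
  1 = \sum_(k < m) w k * x ^+ k.

Let relation_comb x : (forall c, ~ S (x, c)) -> exists m, comb x m.
Proof.
move=> /relation[p [h px]]; exists (size p).+1.
exists (fun k => (k == 0)%:R - p`_k).
  move=> k; have := SB (Sc (k == 0)%:R) (h k).
  by rewrite coef1 rmorph_nat subrr.
under eq_bigr do rewrite mulrBl.
rewrite sumrB -horner_coef_wide // px subr0 big_ord_recl big1 ?addr0 ?expr0 ?mulr1 //.
by move=> k _; rewrite mul0r.
Qed.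

(** The relation of least degree, among those satisfied by x and those
    satisfied by its inverse, could be shortened by means of the other one. *)
Let no_comb m l x y : x * y = 1 -> comb x m -> comb y l -> False.
Proof.
have [N] := ubnP (m + l); elim: N m l x y => // N IH m l x y.
wlog lm : m l x y / (l <= m)%N => [W|].
  have [lm|/ltnW lm] := leqP l m; first exact: W.
  by rewrite addnC mulrC => h1 h2 h3 h4; apply: (W l m y x).
case: m lm => [|m] lm ltN xy [w w0 wE] [v v0 vE].
  by move: wE (oner_neq0 K); rewrite big_ord0 => ->; rewrite eqxx.
case: l lm ltN vE => [|l] lm ltN vE.
  by move: vE (oner_neq0 K); rewrite big_ord0 => ->; rewrite eqxx.
have {}vE : 1 - v 0 = \sum_(j < l) v j.+1 * y ^+ j.+1.
  by rewrite vE big_ord_recl expr0 mulr1 addrC addKr.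
have uS := inv (SB S1 (v0 0)) _; rewrite subr0 invr1 oner_neq0 in uS.
have {uS} : S ((1 - v 0)^-1, 1) by apply: uS.
set u := (1 - v 0)^-1 => uS.
have ne : 1 - v 0 != 0.
  apply/eqP => e; apply: S01.
  by have := SB S1 (v0 0); rewrite e subr0.
have xm : x ^+ m = \sum_(j < l) u * v j.+1 * x ^+ (m - j.+1).
  transitivity (u * x ^+ m * (1 - v 0)); first by rewrite /u mulrAC mulVf ?mul1r.
  rewrite vE mulr_sumr; apply: eq_bigr => j _.
  have jm : (j.+1 <= m)%N by apply: leq_trans (ltn_ord j) lm.
  have e : x ^+ j.+1 * y ^+ j.+1 = 1 by rewrite -exprMn xy expr1n.
  rewrite -[in LHS](subnK jm) exprD.
  by transitivity (u * v j.+1 * x ^+ (m - j.+1) * (x ^+ j.+1 * y ^+ j.+1));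
    [ring | rewrite e mulr1].
apply: (IH m l.+1 x y _ xy); [by move: ltN; rewrite addSn | | by exists v => //; rewrite big_ord_recl expr0 mulr1 /= -vE addrC subrK].
exists (fun k => w k + w m * (\sum_(j < l | (m - j.+1 == k)%N) u * v j.+1)).
  move=> k; apply/S0D/(S0M (b := 0)) => //; elim/big_ind: _ => // j _.
  by rewrite mulrC; apply: S0M uS.
rewrite [LHS]wE big_ord_recr /= xm; under [in RHS]eq_bigr do rewrite mulrDl.
rewrite big_split /=; congr (_ + _).
rewrite mulr_sumr; under [RHS]eq_bigr do rewrite -mulrA mulr_suml mulr_sumr.
rewrite (exchange_big_dep xpredT) //=; apply: eq_bigr => j _.
have jm : (m - j.+1 < m)%N.
  by have := ltn_ord j; lia.
by rewrite (big_pred1 (Ordinal jm)) //= => k; rewrite -val_eqE eq_sym.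
Qed.

Lemma partial_place_total x : (exists c, S (x, c)) \/ S (x^-1, 0).
Proof.
have [Sx|nSx] := pselect (exists c, S (x, c)); [by left | right].
have x0 : x != 0 by apply/eqP => x0; apply: nSx; exists 0; rewrite x0.
have [m cx] : exists m, comb x m by apply: relation_comb => c h; apply: nSx; exists c.
have [[c xc]|nSy] := pselect (exists c, S (x^-1, c)); last first.
  have [l cy] : exists m, comb x^-1 m.
    by apply: relation_comb => c h; apply: nSy; exists c.
  by case: (no_comb _ cx cy); rewrite mulfV.
have [c0|c0] := eqVneq c 0; first by rewrite -c0.
by case: nSx; exists c^-1; rewrite -[x]invrK; apply: inv.
Qed.

Definition graph_pred : {pred K * C} := fun z => `[< S z >].

Lemma graph_predP z : S z -> graph_pred z.
Proof. by move=> Sz; apply/asboolP. Qed.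

Lemma graph_subring_closed : subring_closed graph_pred.
Proof.
split; first exact/asboolP.
- by move=> [x a] [y b] /asboolP h /asboolP h'; apply/asboolP/SB.
- by move=> [x a] [y b] /asboolP h /asboolP h'; apply/asboolP/SM.
Qed.

HB.instance Definition _ :=
  GRing.isSubringClosed.Build (K * C)%type graph_pred graph_subring_closed.

(** The graph of a place is itself a ring, isomorphic to the valuation ring: the
    two projections are the inclusion into K and the residue map. *)
Definition graph_ring := {z | graph_pred z}.
HB.instance Definition _ := SubType.on graph_ring.
HB.instance Definition _ := [Choice of graph_ring by <:].
HB.instance Definition _ := [SubChoice_isSubComNzRing of graph_ring by <:].

Definition graph_val (z : graph_ring) : K := (val z).1.
Definition graph_res (z : graph_ring) : C := (val z).2.
Definition graph_cst (c : C) : graph_ring := exist graph_pred (i c, c) (graph_predP (Sc c)).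

Fact graph_val_zmod : zmod_morphism graph_val.
Proof. by move=> x y; rewrite /graph_val rmorphB. Qed.
Fact graph_val_monoid : monoid_morphism graph_val.
Proof. by split=> [|x y]; rewrite /graph_val ?rmorph1 ?rmorphM. Qed.
HB.instance Definition _ := GRing.isZmodMorphism.Build _ _ graph_val graph_val_zmod.
HB.instance Definition _ := GRing.isMonoidMorphism.Build _ _ graph_val graph_val_monoid.

Fact graph_res_zmod : zmod_morphism graph_res.
Proof. by move=> x y; rewrite /graph_res rmorphB. Qed.
Fact graph_res_monoid : monoid_morphism graph_res.
Proof. by split=> [|x y]; rewrite /graph_res ?rmorph1 ?rmorphM. Qed.
HB.instance Definition _ := GRing.isZmodMorphism.Build _ _ graph_res graph_res_zmod.
HB.instance Definition _ := GRing.isMonoidMorphism.Build _ _ graph_res graph_res_monoid.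

Fact graph_cst_zmod : zmod_morphism graph_cst.
Proof. by move=> x y; apply: val_inj; rewrite /= rmorphB. Qed.
Fact graph_cst_monoid : monoid_morphism graph_cst.
Proof.
by split=> [|x y]; apply: val_inj; rewrite /= ?rmorph1 // rmorphM.
Qed.
HB.instance Definition _ := GRing.isZmodMorphism.Build _ _ graph_cst graph_cst_zmod.
HB.instance Definition _ := GRing.isMonoidMorphism.Build _ _ graph_cst graph_cst_monoid.

Lemma place_of_maximal :
  exists p : place i, forall z, S z -> exists y, vval p y = z.1 /\ vres p y = z.2.
Proof.
have gP z : S z -> exists2 y : graph_ring, graph_val y = z.1 & graph_res y = z.2.
  by move=> Sz; exists (exist graph_pred z (graph_predP Sz)).
unshelve eexists; first apply: (@Place C K i graph_ring graph_val graph_res graph_cst).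
- move=> [[x a] /= xa] [[y b] /= yb]; rewrite /graph_val /= => xy; apply: val_inj => /=.
  move: xa yb; rewrite -xy => /asboolP xa /asboolP xb.
  by rewrite (Sfun xa xb).
- by [].
- by [].
- move=> x; have [[c /gP[y /= y1 _]]|/gP[y /= y1 y2]] := partial_place_total x.
    by left; exists y.
  by right; exists y.
- by move=> z /gP[y y1 y2]; exists y.
Qed.

End Maximal.

(** Chevalley's extension theorem: a maximal residue map extending the given one is
    a place. *)
Theorem place_extension (S : set (K * C)) : partial_place S ->
  exists p : place i, forall x c, S (x, c) -> exists y, vval p y = x /\ vres p y = c.
Proof.
move=> S_partial.
pose P (A : set (K * C)) := A = set0 \/ (partial_place A /\ (S `<=` A)%classic).
have [A [PA Amax]] : exists A, P A /\ forall B, (A `<` B)%classic -> ~ P B.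
  apply: Zorn_bigcup => F FP Ftot.
  have [[X0 FX0 X0n]|none] := pselect (exists2 X, F X & X <> set0); last first.
    left; apply/seteqP; split=> // z [X FX Xz]; apply: none; exists X => //.
    by move=> X0; move: Xz; rewrite X0.
  have good X z : F X -> X z -> partial_place X /\ (S `<=` X)%classic.
    by move=> FX Xz; have [X0'|//] := FP _ FX; move: Xz; rewrite X0'.
  have [[z0 X0z0] _] : (exists z, X0 z) /\ True.
    split=> //; apply: contrapT => no; apply: X0n; apply/seteqP; split=> // z Xz.
    by apply: no; exists z.
  have [[c0 _ _ _] SX0] := good _ _ FX0 X0z0.
  right; split; last by move=> z Sz; exists X0 => //; apply: SX0.
  have two z z' : (\bigcup_(X in F) X)%classic z -> (\bigcup_(X in F) X)%classic z' ->
      exists X, [/\ F X, X z & X z'].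
    move=> [X FX Xz] [X' FX' Xz'].
    by have [h|h] := Ftot _ _ FX FX'; [exists X' | exists X]; split=> //; apply: h.
  split.
  - by move=> c; exists X0.
  - move=> z z' /two h /h[X [FX Xz Xz']]; exists X => //.
    by have [[_ hB _ _] _] := good _ _ FX Xz; apply: hB.
  - move=> z z' /two h /h[X [FX Xz Xz']]; exists X => //.
    by have [[_ _ hM _] _] := good _ _ FX Xz; apply: hM.
  - by move=> [X FX X01]; have [[_ _ _]] := good _ _ FX X01.
have [c0 _ _ _] := S_partial.
have [A0|[A_partial SA]] := PA.
  case: (Amax S); last by right; split.
  rewrite A0; split=> // h; have := h _ (c0 0); exact.
have [S' pS' AS' z S'z|p hp] := place_of_maximal A_partial.
  apply: contrapT => nAz; case: (Amax S'); last first.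
    by right; split=> // y /SA /AS'.
  by split=> // /(_ _ S'z).
by exists p => x c /SA/hp.
Qed.

End PlaceExtension.

(** * Ultrapowers *)

(** Functions T -> C become elements of an ultrapower of C, so that a generic point
    of a variety can be obtained as the class of a function into it. *)
Section Ultrapower.
Variables (C : fieldType) (T : pointedType) (U : set_system T).
Hypothesis U_ultra : UltraFilter U.

Definition ultra_null : {pred T -> C} := fun f => `[< U (fun t => f t = 0) >].

Let U_filter : ProperFilter U. Proof. by case: U_ultra. Qed.

Lemma ultra_null_ideal : idealr_closed ultra_null.
Proof.
split.
- by apply/asboolP; apply: filterE.
- apply/asboolP => h; have [t /eqP] := filter_ex h.
  by rewrite (oner_eq0 C).
- move=> a u v /asboolP hu /asboolP hv; apply/asboolP.
  apply: filterS2 hu hv => t /= ut vt.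
  by rewrite -[LHS]/(a t * u t + v t) ut vt mulr0 addr0.
Qed.

HB.instance Definition _ := isIdealr.Build (T -> C)%type ultra_null ultra_null_ideal.

Definition ultrapower := {ideal_quot ultra_null}.
HB.instance Definition _ := GRing.ComNzRing.on ultrapower.

Local Open Scope quotient_scope.

Lemma ultra_eq0 (f : T -> C) : \pi_ultrapower f = 0 <-> U (fun t => f t = 0).
Proof.
have -> : \pi_ultrapower f = 0 <-> f - 0 \in ultra_null.
  by rewrite Quotient.idealrBE -[0 in X in X <-> _](rmorph0 \pi_ultrapower); split=> /eqP.
by rewrite subr0; split => [/asboolP|h]; [|apply/asboolP].
Qed.

Definition ultra_inv (x : ultrapower) : ultrapower := \pi_ultrapower (fun t => (repr x t)^-1).

Lemma ultra_mulVf x : x != 0 -> ultra_inv x * x = 1.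
Proof.
rewrite -{1 3}[x]reprK => /eqP/ultra_eq0 xU.
have xU' : U (fun t => repr x t != 0).
  have [//|h] := in_ultra_setVsetC (fun t => repr x t = 0) U_ultra.
  by apply: filterS h => t /eqP.
apply/eqP; rewrite -subr_eq0; apply/eqP.
rewrite -(rmorph1 \pi_ultrapower) /ultra_inv -rmorphM -rmorphB; apply/ultra_eq0.
apply: filterS xU' => t xt; rewrite -[LHS]/((repr x t)^-1 * repr x t - 1).
by rewrite mulVf // subrr.
Qed.

Lemma ultra_inv0 : ultra_inv 0 = 0.
Proof.
apply/ultra_eq0; have /ultra_eq0 : \pi_ultrapower (repr (0 : ultrapower)) = 0 by rewrite reprK.
by apply: filterS => t ->; rewrite invr0.
Qed.

HB.instance Definition _ := GRing.ComNzRing_isField.Build ultrapower ultra_mulVf ultra_inv0.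

End Ultrapower.

Lemma ultrapower_exists (C : fieldType) (T : pointedType) (F : set_system T) :
  ProperFilter F ->
  exists (K : fieldType) (p : {rmorphism (T -> C) -> K}),
    forall f, F (fun t => f t = 0) -> p f = 0.
Proof.
move=> /ultraFilterLemma[U [UU FU]]; exists (ultrapower C UU).
exists (\pi_(ultrapower C UU))%qT => f /FU h.
by apply/ultra_eq0.
Qed.

(** * Farkas' lemma *)

Section Farkas.
Variables (F : realFieldType) (n : nat).
Implicit Types (a b u v : 'rV[F]_n) (s : seq 'rV[F]_n) (x : 'cV[F]_n).

Fixpoint cone s b : Prop :=
  if s is a :: s' then exists2 c, 0 <= c & cone s' (b - c *: a) else b = 0.

Lemma cone_map (L : {linear 'rV[F]_n -> 'rV[F]_n}) s v :
  cone (map L s) v -> exists2 u, cone s u & L u = v.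
Proof.
elim: s v => [|a s IH] v /=; first by move=> ->; exists 0; rewrite ?linear0.
move=> [c c0 /IH[u su uv]]; exists (u + c *: a); last by rewrite linearD linearZ /= uv subrK.
by exists c; rewrite ?addrK.
Qed.

Lemma cone_ge0 s u x : cone s u -> (forall a, a \in s -> 0 <= (a *m x) 0 0) ->
  0 <= (u *m x) 0 0.
Proof.
elim: s u => [|a s IH] u /=; first by move=> -> _; rewrite mul0mx mxE.
move=> [c c0 su] h; rewrite -[u](subrK (c *: a)) mulmxDl -scalemxAl mxE.
rewrite addr_ge0 ?IH // => [b bs|]; first by rewrite h // inE bs orbT.
by rewrite mxE mulr_ge0 // h // mem_head.
Qed.

(** Bartl's induction: a vector x violating the conclusion for the tail s has
    a x < 0; projecting along x onto the kernel of a reduces to the tail. *)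
Lemma farkas s b :
  (forall x, (forall a, a \in s -> 0 <= (a *m x) 0 0) -> 0 <= (b *m x) 0 0) ->
  cone s b.
Proof.
move: {2}(size s) (erefl (size s)) => m; elim: m s b => [|m IH] [|a s] // b.
  move=> _ h /=; have := h (- b^T); rewrite mulmxN mxE oppr_ge0 => /(_ _) bb.
  apply/rowP => j; rewrite mxE; apply/eqP; rewrite -sqrf_eq0.
  have {}bb : \sum_k b 0 k ^+ 2 <= 0.
    by under eq_bigr do rewrite expr2 -[in X in _ * X](trmxK b) mxE; move: (bb (fun _ => ltac:(done))); rewrite mxE.
  rewrite eq_le sqr_ge0 andbT; apply: le_trans bb.
  by rewrite (bigD1 j) //= lerDl sumr_ge0 // => k _; apply: sqr_ge0.
move=> /= [sm] h; have [h'|] := pselect (forall x, (forall a, a \in s -> 0 <= (a *m x) 0 0) -> 0 <= (b *m x) 0 0).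
  by exists 0 => //; rewrite scale0r subr0; apply: IH.
move=> /existsNP[x0 /not_implyP[sx0 /negP]]; rewrite -ltNge => bx0.
have ax0 : (a *m x0) 0 0 < 0.
  rewrite ltNge; apply/negP => ax0; move: bx0; rewrite ltNge => /negP; apply.
  by apply: h => c; rewrite inE => /predU1P[->|/sx0].
pose x1 := (- (a *m x0) 0 0)^-1 *: x0.
have r0 : 0 < (- (a *m x0) 0 0)^-1 by rewrite invr_gt0 oppr_gt0.
have ax1 : a *m x1 = - 1%:M.
  apply/matrixP => i j; rewrite !ord1 -scalemxAr mxE.
  by rewrite invrN mulNr mulVf ?lt_eqF // !mxE.
have sx1 c : c \in s -> 0 <= (c *m x1) 0 0.
  by move=> cs; rewrite -scalemxAr mxE mulr_ge0 ?sx0 // ltW.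
have bx1 : (b *m x1) 0 0 < 0 by rewrite -scalemxAr mxE pmulr_rlt0.
pose L v := v + v *m x1 *m a.
have L_lin : linear L.
  move=> k u v; rewrite /L !mulmxDl scalerDr -!scalemxAl !addrA; congr (_ + _).
  by rewrite addrAC.
pose LL : {linear 'rV[F]_n -> 'rV[F]_n} :=
  HB.pack L (GRing.isLinear.Build F _ _ _ L L_lin).
have LE u x : L u *m x = u *m (x + x1 *m (a *m x)).
  by rewrite mulmxDl mulmxDr !mulmxA.
have [u su Lu] : exists2 u, cone s u & L u = L b.
  apply: (cone_map (L := LL)); apply: IH => [|x sx]; rewrite ?size_map //; rewrite LE; apply: h => c.
  rewrite inE => /predU1P[->|cs]; last by rewrite -LE; apply: sx; apply: map_f.
  by rewrite mulmxDr mulmxA ax1 mulNmx mul1mx subrr mxE.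
exists (- ((b - u) *m x1) 0 0).
  rewrite oppr_ge0 mulmxBl mxE [X in _ + X]mxE subr_le0.
  by apply: le_trans (ltW bx1) _; apply: cone_ge0 su sx1.
have : L (b - u) = 0 by rewrite -[L]/(LL : _ -> _) linearB /= Lu subrr.
rewrite /L => /eqP; rewrite addr_eq0 => /eqP bu.
suff -> : b - - ((b - u) *m x1) 0 0 *: a = u by [].
apply/eqP; rewrite subr_eq addrC -subr_eq scaleNr; apply/eqP.
by rewrite [LHS]bu [in LHS](mx11_scalar ((b - u) *m x1)) mul_scalar_mx.
Qed.

End Farkas.

(** * Valuations of monomials *)

Section PlaceTheory.
Variables (C K : fieldType) (i : {rmorphism C -> K}) (p : place i).
Local Notation V := (vring p).

Definition integral (x : K) : Prop := exists y : V, x = vval p y.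
Definition small (x : K) : Prop := exists2 y : V, x = vval p y & vres p y = 0.

Lemma integral0 : integral 0. Proof. by exists 0; rewrite rmorph0. Qed.
Lemma integral1 : integral 1. Proof. by exists 1; rewrite rmorph1. Qed.
Lemma integralD x y : integral x -> integral y -> integral (x + y).
Proof. by move=> [a ->] [b ->]; exists (a + b); rewrite rmorphD. Qed.
Lemma integralM x y : integral x -> integral y -> integral (x * y).
Proof. by move=> [a ->] [b ->]; exists (a * b); rewrite rmorphM. Qed.
Lemma integralX x n : integral x -> integral (x ^+ n).
Proof. by move=> [a ->]; exists (a ^+ n); rewrite rmorphXn. Qed.
Lemma integral_val y : integral (vval p y). Proof. by exists y. Qed.
Lemma integral_cst c : integral (i c). Proof. by exists (vcst p c); rewrite vvalC. Qed.
Lemma integral_sum (I : Type) (r : seq I) (P : pred I) (G : I -> K) :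
  (forall k, P k -> integral (G k)) -> integral (\sum_(k <- r | P k) G k).
Proof.
by move=> h; elim/big_ind: _ => //; [apply: integral0 | apply: integralD].
Qed.
Lemma integral_prod (I : Type) (r : seq I) (P : pred I) (G : I -> K) :
  (forall k, P k -> integral (G k)) -> integral (\prod_(k <- r | P k) G k).
Proof.
by move=> h; elim/big_ind: _ => //; [apply: integral1 | apply: integralM].
Qed.

Lemma small_integral x : small x -> integral x. Proof. by case=> y ->; exists y. Qed.
Lemma smallM x y : small x -> integral y -> small (x * y).
Proof.
by move=> [a -> a0] [b ->]; exists (a * b); rewrite ?rmorphM //= a0 mul0r.
Qed.

Lemma small_inv_integral x : x != 0 -> small x -> ~ integral x^-1.
Proof.
move=> x0 [y xy y0] [z xz].
have : y * z = 1 by apply: (@vval_inj _ _ _ p); rewrite rmorphM rmorph1 -xy -xz mulfV.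
by move=> /(congr1 (vres p))/eqP; rewrite rmorphM rmorph1 /= y0 mul0r eq_sym oner_eq0.
Qed.

Lemma integral_or_small x : integral x \/ small x^-1.
Proof.
by case: (vtotal p x) => [[y ->]|[y e y0]]; [left; exists y | right; exists y].
Qed.

Lemma integral_root x k : x != 0 -> (0 < k)%N -> integral (x ^+ k) -> integral x.
Proof.
move=> x0 k0 xk; have [//|sm] := integral_or_small x.
case: (@small_inv_integral (x^-1 ^+ k)); first by rewrite expf_neq0 ?invr_eq0.
  by rewrite -(prednK k0) exprS; apply: smallM => //; apply/integralX/small_integral.
by rewrite exprVn invrK.
Qed.

Lemma vres_unit y : vres p y != 0 -> exists z, y * z = 1.
Proof.
move=> y0; have v0 : vval p y != 0.
  by apply: contra y0 => /eqP; rewrite -(rmorph0 (vval p)) => /vval_inj ->; rewrite rmorph0.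
case: (vtotal p (vval p y)^-1) => [[z e]|[z]].
  by exists z; apply: (@vval_inj _ _ _ p); rewrite rmorphM rmorph1 -e mulfV.
by rewrite invrK => /vval_inj <- /eqP; rewrite (negPf y0).
Qed.

Section SignPattern.
Variables (n : nat) (t : 'I_n -> K).
Hypothesis t0 : forall j, t j != 0.
Implicit Types c : 'rV[int]_n.

Definition laurent_monomial c : K := \prod_j t j ^ c 0 j.

Lemma laurent_monomial_neq0 c : laurent_monomial c != 0.
Proof. by apply/prodf_neq0 => j _; rewrite expfz_neq0. Qed.

Lemma laurent_monomialD c c' : laurent_monomial (c + c') = laurent_monomial c * laurent_monomial c'.
Proof.
by rewrite -big_split; apply: eq_bigr => j _; rewrite mxE expfzDr.
Qed.

Lemma laurent_monomialN c : laurent_monomial (- c) = (laurent_monomial c)^-1.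
Proof. by rewrite -prodfV; apply: eq_bigr => j _; rewrite mxE invr_expz. Qed.

Lemma laurent_monomialMn c k : laurent_monomial (c *+ k) = laurent_monomial c ^+ k.
Proof.
elim: k => [|k IH]; last by rewrite mulrS laurent_monomialD IH exprS.
by rewrite mulr0n /laurent_monomial big1 // => j _; rewrite mxE.
Qed.

(** Clearing denominators turns a nonnegative rational combination of exponents
    into a product of powers of monomials. *)
Lemma rat_cone_integral (s : seq 'rV[int]_n) (b : 'rV[int]_n) :
  (forall c, c \in s -> integral (laurent_monomial c)) ->
  cone [seq map_mx (intr : int -> rat) c | c <- s] (map_mx intr b) ->
  exists2 k, (0 < k)%N & integral (laurent_monomial (b *+ k)).
Proof.
move=> hs h.
suff gen (u : 'rV[rat]_n) : cone [seq map_mx (intr : int -> rat) c | c <- s] u ->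
    exists k (w : 'rV[int]_n), [/\ (0 < k)%N, map_mx intr w = u *+ k & integral (laurent_monomial w)].
  have [k [w [k0 wE wi]]] := gen _ h; exists k => //; suff -> : b *+ k = w by [].
  apply/rowP => j; move: wE; rewrite -raddfMn => /rowP/(_ j).
  by rewrite [LHS]mxE [RHS]mxE => /intr_inj.
elim: s hs u {h} => [|c s IH] hs u /=.
  move=> ->; exists 1%N, 0; rewrite map_mx0 mulr1n; split=> //.
  by rewrite /laurent_monomial big1 => [|j _]; [apply: integral1 | rewrite mxE].
case=> q q0 /(IH (fun c' cs => hs c' (mem_behead (s := c :: s) cs)))[k [w [k0 wE wi]]].
exists (k * absz (denq q))%N, (w *+ absz (denq q) + c *+ (k * absz (numq q))).
have cq : ((absz (numq q))%:R = q * (absz (denq q))%:R :> rat).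
  by rewrite !natr_absz [`|denq q|]gtr0_norm ?denq_gt0 // ger0_norm ?numq_ge0 // numqE.
split.
- by rewrite muln_gt0 k0 absz_gt0 denq_eq0.
- apply/rowP => j; move/rowP/(_ j): wE; rewrite [LHS]mxE mulmxnE !mxE => wE.
  rewrite !mulmxnE rmorphD !rmorphMn /= wE -mulrnA mulrnBl.
  suff -> : (c 0 j)%:~R *+ (k * absz (numq q)) = (q * (c 0 j)%:~R) *+ (k * absz (denq q)).
    by rewrite subrK.
  by rewrite mulnC mulrnA -[_ *+ absz _]mulr_natr cq mulrA mulr_natr -mulrnA mulrC mulnC.
- rewrite laurent_monomialD !laurent_monomialMn; apply: integralM; apply: integralX => //.
  by apply: hs; rewrite mem_head.
Qed.

(** Integers cannot in general be chosen proportional to the valuations of the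
    t j, but Farkas' lemma yields integers with the same signs on a finite set of
    monomials. *)
Lemma sign_pattern (S : seq 'rV[int]_n) : exists l : 'I_n -> int, forall c, c \in S ->
  (integral (laurent_monomial c) -> 0 <= \sum_j c 0 j * l j) /\
  (small (laurent_monomial c) -> 0 < \sum_j c 0 j * l j).
Proof.
pose S' := [seq c <- S | `[< integral (laurent_monomial c) >]].
pose dot (c : 'rV[int]_n) (x : 'cV[rat]_n) : rat := (map_mx intr c *m x) 0 0.
suff [x xP] : exists x : 'cV[rat]_n, forall c, c \in S' ->
    0 <= dot c x /\ (small (laurent_monomial c) -> 0 < dot c x).
  pose D := \prod_j denq (x j 0).
  have D0 : 0 < D by rewrite prodr_gt0 // => j _; rewrite denq_gt0.
  pose l j := numq (x j 0) * \prod_(k | k != j) denq (x k 0).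
  have lE j : (l j)%:~R = D%:~R * x j 0 :> rat.
    rewrite /l /D [in RHS](bigD1 j) //= !rmorphM /= numqE; ring.
  have dE c : (\sum_j c 0 j * l j)%:~R = D%:~R * dot c x :> rat.
    rewrite /dot mxE mulr_sumr rmorph_sum; apply: eq_bigr => j _.
    by rewrite rmorphM /= lE mxE mulrCA.
  exists l => c cS; split=> h.
    rewrite -(ler0z rat) dE mulr_ge0 ?ler0z ?(ltW D0) //.
    by apply: (xP c _).1; rewrite mem_filter cS andbT; apply/asboolP.
  rewrite -(ltr0z rat) dE mulr_gt0 ?ltr0z //; apply: (xP c _).2 => //.
  by rewrite mem_filter cS andbT; apply/asboolP/small_integral.
have step c0 : c0 \in S' -> exists x : 'cV[rat]_n, (forall c, c \in S' -> 0 <= dot c x) /\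
    (small (laurent_monomial c0) -> 0 < dot c0 x).
  move=> c0S; have [sm|nsm] := pselect (small (laurent_monomial c0)); last first.
    by exists 0; split=> // c _; rewrite /dot mulmx0 mxE.
  apply: contrapT => no.
  have [||k k0] := @rat_cone_integral S' (- c0).
  - by move=> c; rewrite mem_filter => /andP[/asboolP].
  - apply: farkas => x h; rewrite leNgt; apply/negP => neg; apply: no; exists x.
    split=> [c cS|_]; first by apply: h; apply: map_f.
    by move: neg; rewrite map_mxN mulNmx mxE oppr_lt0.
  - rewrite mulNrn laurent_monomialN laurent_monomialMn; apply: small_inv_integral.
      by rewrite expf_neq0 // laurent_monomial_neq0.
    by rewrite -(prednK k0) exprS; apply: smallM => //; apply/integralX/small_integral.
suff gen (s : seq 'rV[int]_n) : {subset s <= S'} -> exists x : 'cV[rat]_n,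
    (forall c, c \in S' -> 0 <= dot c x) /\ (forall c, c \in s -> small (laurent_monomial c) -> 0 < dot c x).
  have [x [x1 x2]] := gen S' (fun c h => h); exists x => c cS.
  by split; [apply: x1 | apply: x2].
elim: s => [|c0 s IH] sS; first by exists 0; split=> // c _; rewrite /dot mulmx0 mxE.
have [x [x1 x2]] := IH (fun c cs => sS c (mem_behead (s := c0 :: s) cs)).
have c0S : c0 \in S' by apply: sS; rewrite mem_head.
have [y [y1 y2]] := step c0 c0S; exists (x + y).
have dD c : dot c (x + y) = dot c x + dot c y by rewrite /dot mulmxDr mxE.
split=> c cS; rewrite dD; first by rewrite addr_ge0 ?x1 ?y1.
move=> sm; move: cS; rewrite inE => /predU1P[e|cs].
  by rewrite e ltr_wpDl ?x1 //; apply: y2; rewrite -e.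
by rewrite ltr_wpDr ?x2 // y1 // sS // inE cs orbT.
Qed.

End SignPattern.
End PlaceTheory.

(** * Cartan decomposition over a valuation ring *)

Section Cartan.
Variables (C K : fieldType) (i : {rmorphism C -> K}) (p : place i).
Local Notation V := (vring p).
Local Notation vmx := (map_mx (vval p)).

Definition unitdet n (k : 'M[V]_n) := vres p (\det k) != 0.

Lemma unitdetM n (k k' : 'M[V]_n) : unitdet k -> unitdet k' -> unitdet (k *m k').
Proof. by rewrite /unitdet det_mulmx rmorphM; apply: mulf_neq0. Qed.

Lemma unitdet1 n (k : 'M[V]_n) : \det k = 1 -> unitdet k.
Proof. by rewrite /unitdet => ->; rewrite rmorph1 oner_neq0. Qed.

Lemma unitdet_tperm n (a b : 'I_n) : unitdet (tperm_mx a b).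
Proof.
by rewrite /unitdet det_perm rmorph_sign signr_eq0.
Qed.

Lemma unitdet_inv n (k : 'M[V]_n) : unitdet k -> exists k' : 'M[V]_n, k' *m k = 1%:M /\ k *m k' = 1%:M.
Proof.
move=> /vres_unit[z zk]; exists (z *: \adj k).
by rewrite -scalemxAl -scalemxAr mul_adj_mx mul_mx_adj scale_scalar_mx mulrC zk.
Qed.

Lemma minimal_valuation (T : finType) (f : T -> K) : (exists a, f a != 0) ->
  exists a, f a != 0 /\ forall b, integral p (f b / f a).
Proof.
move=> [a0 fa0].
suff [a [fa h]] : exists a, f a != 0 /\ forall b, b \in enum T -> integral p (f b / f a).
  by exists a; split=> // b; apply: h; rewrite mem_enum.
elim: (enum T) => [|b s [a [fa h]]]; first by exists a0.
have [ba|ab] := integral_or_small p (f b / f a).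
  by exists a; split=> // c; rewrite inE => /predU1P[->|/h].
have [fb|fb] := eqVneq (f b) 0.
  exists a; split=> // c; rewrite inE => /predU1P[->|/h] //.
  by rewrite fb mul0r; apply: integral0.
exists b; split=> // c; rewrite inE => /predU1P[->|/h ca].
  by rewrite divff //; apply: integral1.
have -> : f c / f b = (f c / f a) * (f b / f a)^-1.
  by rewrite invf_div mulrA divfK.
by apply: integralM => //; apply: small_integral.
Qed.

Lemma integral_mx m n (g : 'M[K]_(m, n)) :
  (forall a b, integral p (g a b)) -> exists M, g = vmx M.
Proof.
move=> h; pose f a b := sval (cid (h a b)).
exists (\matrix_(a, b) f a b); apply/matrixP => a b; rewrite !mxE.
exact: svalP (cid (h a b)).
Qed.

Lemma pivot_elimination n (M : 'M[V]_(1 + n)) : M 0 0 = 1 ->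
  exists (L U : 'M[V]_(1 + n)) (M' : 'M[V]_n),
    [/\ \det L = 1, \det U = 1 & M = L *m block_mx (1%:M : 'M_1) 0 0 M' *m U].
Proof.
move=> M00.
exists (block_mx 1%:M 0 (dlsubmx M) 1%:M), (block_mx 1%:M (ursubmx M) 0 1%:M).
exists (drsubmx M - dlsubmx M *m ursubmx M).
split; rewrite ?det_lblock ?det_ublock ?det1 ?mulr1 //.
rewrite !mulmx_block !(mulmx0, mul0mx, mulmx1, mul1mx, addr0, add0r).
rewrite addrCA subrr addr0 -[LHS]submxK; congr block_mx.
by apply/matrixP => a b; rewrite !ord1 !mxE -M00; congr (M _ _); apply: val_inj.
Qed.

(** Smith's algorithm, with an entry of least valuation as pivot: dividing by it
    makes the whole matrix integral. *)
Lemma cartan_unit n (g : 'M[K]_n) : \det g != 0 ->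
  exists (k1 k2 : 'M[V]_n) (t : 'rV[K]_n),
    [/\ unitdet k1, unitdet k2, forall a, t 0 a != 0,
        forall a b : 'I_n, (a <= b)%N -> integral p (t 0 b / t 0 a)
      & g = vmx k1 *m diag_mx t *m vmx k2].
Proof.
elim: n g => [|n IH] g g0.
  exists 1%:M, 1%:M, 0; split; try by case.
  - by apply: unitdet1; rewrite det1.
  - by apply: unitdet1; rewrite det1.
  - by apply/matrixP; case.
have [[a0 b0] /= [c0 cmin]] : exists ab : 'I_n.+1 * 'I_n.+1,
    g ab.1 ab.2 != 0 /\ forall ab', integral p (g ab'.1 ab'.2 / g ab.1 ab.2).
  apply: (@minimal_valuation _ (fun ab => g ab.1 ab.2)); apply: contrapT => no.
  move: g0; suff -> : g = 0 by rewrite det0 eqxx.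
  apply/matrixP => a b; rewrite [RHS]mxE; apply/eqP; apply: contrapT => /negP ab.
  by apply: no; exists (a, b).
set c := g a0 b0 in c0 cmin.
have [M gM] : exists M, c^-1 *: g = vmx M.
  by apply: integral_mx => a b; rewrite mxE mulrC; apply: (cmin (a, b)).
have Mab : M a0 b0 = 1.
  apply: (@vval_inj _ _ _ p); rewrite rmorph1.
  by have /matrixP/(_ a0 b0) := gM; rewrite !mxE mulVf.
pose P1 : 'M[V]_n.+1 := tperm_mx a0 0; pose P2 : 'M[V]_n.+1 := tperm_mx b0 0.
have PP (a b : 'I_n.+1) : tperm_mx a b *m tperm_mx a b = 1%:M :> 'M[V]_n.+1.
  by rewrite -perm_mxM tperm2 perm_mx1.
pose M1 := P1 *m M *m P2.
have M1E : M1 0 0 = 1.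
  by rewrite /M1 /P1 /P2 -xrowE -xcolE !mxE !tpermR.
have [L [U [M' [L1 U1 M1L]]]] := pivot_elimination M1E.
have gE : g = c *: vmx (P1 *m (L *m block_mx (1%:M : 'M_1) 0 0 M' *m U) *m P2).
  rewrite -M1L /M1 !mulmxA PP mul1mx -!mulmxA PP mulmx1 -gM scalerA.
  by rewrite divff // scale1r.
have M'0 : \det (vmx M') != 0.
  apply: contra g0 => /eqP M'0; rewrite gE detZ det_map_mx !det_mulmx.
  by rewrite (@det_ublock _ 1 n) det1 mul1r !rmorphM /= -[vval p (\det M')]det_map_mx M'0 !(mulr0, mul0r).
have [k1 [k2 [t [k1u k2u t0 tsort ME]]]] := IH _ M'0.
have tint a : integral p (t 0 a).
  have [k1' [k1'K _]] := unitdet_inv k1u; have [k2' [_ k2'K]] := unitdet_inv k2u.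
  have : diag_mx t = vmx (k1' *m M' *m k2').
    rewrite !map_mxM ME !mulmxA -map_mxM k1'K map_mx1 mul1mx -mulmxA -map_mxM.
    by rewrite k2'K map_mx1 mulmx1.
  by move=> /matrixP/(_ a a); rewrite !mxE eqxx mulr1n => ->; apply: integral_val.
have blockE : vmx (block_mx (1%:M : 'M_1) 0 0 M') =
    vmx (block_mx (1%:M : 'M_1) 0 0 k1) *m
    (diag_mx (row_mx (1%:M : 'M_1) t) *m vmx (block_mx (1%:M : 'M_1) 0 0 k2)).
  rewrite !map_block_mx !map_mx0 !map_mx1 diag_mx_row !mulmx_block.
  rewrite !(mulmx0, mul0mx, mulmx1, mul1mx, addr0, add0r) ME mulmxA; congr block_mx.
  by apply/matrixP => a b; rewrite !ord1 !mxE eqxx mulr1n.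
exists (P1 *m (L *m block_mx (1%:M : 'M_1) 0 0 k1)).
exists (block_mx (1%:M : 'M_1) 0 0 k2 *m U *m P2).
exists (c *: row_mx (1%:M : 'M_1) t); split.
- apply: unitdetM; first exact: unitdet_tperm.
  apply: unitdetM; first exact: unitdet1.
  by rewrite /unitdet (@det_ublock _ 1 n) det1 mul1r.
- apply: unitdetM; last exact: unitdet_tperm.
  apply: unitdetM; last exact: unitdet1.
  by rewrite /unitdet (@det_ublock _ 1 n) det1 mul1r.
- move=> a; rewrite mxE mulf_neq0 // mxE; case: splitP => b _ //.
  by rewrite !ord1 mxE oner_neq0.
- move=> a b ab; rewrite mxE [X in _ / X]mxE -mulf_div divff // mul1r.
  rewrite !mxE; case: splitP => b' bE; case: splitP => a' aE.
  + by rewrite !ord1 mxE divr1; apply: integral1.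
  + by move: ab; rewrite bE aE !ord1.
  + by rewrite !ord1 mxE divr1.
  + by apply: tsort; move: ab; rewrite bE aE leq_add2l.
- rewrite gE !map_mxM; rewrite [diag_mx _](_ : _ = c *: diag_mx (row_mx (1%:M : 'M_1) t)); last first.
    by apply/matrixP => a b; rewrite !mxE mulrnAr.
  rewrite -scalemxAr -scalemxAl; congr (_ *: _); rewrite !mulmxA; do 2 congr (_ *m _).
  rewrite -!mulmxA; do 2 congr (_ *m _).
  exact: blockE.
Qed.

(** The unit determinants of the two integral factors are absorbed into t. *)
Lemma cartan n (g : 'M[K]_n.+1) : \det g != 0 ->
  exists (k1 k2 : 'M[V]_n.+1) (t : 'rV[K]_n.+1),
    [/\ \det k1 = 1, \det k2 = 1, forall a, t 0 a != 0,
        forall a b : 'I_n.+1, (a <= b)%N -> integral p (t 0 b / t 0 a)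
      & g = vmx k1 *m diag_mx t *m vmx k2].
Proof.
move=> /cartan_unit[k1 [k2 [t [/vres_unit[z1 z1E] /vres_unit[z2 z2E] t0 ts gE]]]].
pose e (z : V) : 'M[V]_n.+1 := diag_mx (\row_a (if a == 0 then z else 1)).
have eE z : \det (e z) = z.
  rewrite det_diag (bigD1 ord0) //= mxE eqxx big1 ?mulr1 // => a /negPf a0.
  by rewrite mxE a0.
have eM z z' : z * z' = 1 -> e z *m e z' = 1%:M.
  move=> zz; rewrite mulmx_diag; apply/matrixP => a b; rewrite !mxE.
  by case: (a == 0); rewrite ?zz ?mulr1.
set d1 := \det k1 in z1E *; set d2 := \det k2 in z2E *.
pose t' : 'rV[K]_n.+1 := \row_a ((if a == 0 then vval p d1 * vval p d2 else 1) * t 0 a).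
have d0 : vval p d1 * vval p d2 != 0.
  apply/negP; rewrite -rmorphM -(rmorph0 (vval p)) => /eqP/vval_inj d0.
  have /(congr1 (vres p))/eqP : d1 * d2 * (z1 * z2) = 1 by rewrite mulrACA z1E z2E mulr1.
  by rewrite d0 mul0r rmorph0 rmorph1 eq_sym oner_eq0.
exists (k1 *m e z1), (e z2 *m k2), t'; split.
- by rewrite det_mulmx eE.
- by rewrite det_mulmx eE mulrC.
- by move=> a; rewrite mxE mulf_neq0 //; case: ifP; rewrite ?oner_neq0.
- move=> a b ab; rewrite !mxE -mulf_div; apply: integralM; last exact: ts.
  have [b0|_] := ifP; last first.
    case: ifP => _; last by rewrite divr1; apply: integral1.
    exists (z1 * z2); rewrite mul1r; apply/(mulfI d0).
    by rewrite divff // -!rmorphM mulrACA z1E z2E mulr1 rmorph1.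
  have -> : a == 0 by move: ab; rewrite (eqP b0) leqn0 => /eqP a0; apply/eqP/val_inj.
  by rewrite divff //; apply: integral1.
- rewrite gE !map_mxM !mulmxA; congr (_ *m _); rewrite -!mulmxA; congr (_ *m _).
  rewrite !map_diag_mx !mulmx_diag; congr diag_mx; apply/rowP => a; rewrite !mxE.
  case: ifP => _; last by rewrite !rmorph1 !mul1r mulr1.
  have -> : vval p z1 * (vval p d1 * vval p d2 * t 0 a * vval p z2) =
     vval p (d1 * z1) * vval p (d2 * z2) * t 0 a by rewrite !rmorphM /=; ring.
  by rewrite z1E z2E !rmorph1 !mul1r.
Qed.

End Cartan.

(** * Substitutions and coefficient minors *)

Section Composition.
Variables (R : comNzRingType) (n k : nat).

Lemma comp_homog e (r : {mpoly R[n]}) (lq : n.-tuple {mpoly R[k]}) :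
  r \is e.-homog -> (forall j, tnth lq j \is 1.-homog) -> r \mPo lq \is e.-homog.
Proof.
move=> /dhomogP hr hq; rewrite comp_mpolyE big_seq rpred_sum // => m.
move=> /hr /= <-; apply: rpredZ; rewrite mdegE.
apply: (big_ind2 (fun q e => q \is e.-homog)) => [|p1 e1 p2 e2|j _].
- exact: dhomog1.
- exact: dhomogM.
- by rewrite -[X in X.-homog]mul1n; apply/dhomogMn/hq.
Qed.

Lemma eq_comp (r : {mpoly R[n]}) (lq lq' : n.-tuple {mpoly R[k]}) :
  (forall m j, m \in msupp r -> m j != 0%N -> tnth lq j = tnth lq' j) ->
  r \mPo lq = r \mPo lq'.
Proof.
move=> h; rewrite !comp_mpolyE !big_seq; apply: eq_bigr => m mr.
congr (_ *: _); apply: eq_bigr => j _.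
have [->|mj] := eqVneq (m j) 0%N; first by rewrite !expr0.
by rewrite (h m).
Qed.

Lemma comp_comp k' (r : {mpoly R[n]}) (lq : n.-tuple {mpoly R[k]}) (lp : k.-tuple {mpoly R[k']}) :
  (r \mPo lq) \mPo lp = r \mPo [tuple tnth lq j \mPo lp | j < n].
Proof.
rewrite [r \mPo lq]comp_mpolyE [RHS]comp_mpolyE raddf_sum /=; apply: eq_bigr => m _.
rewrite comp_mpolyZ rmorph_prod; congr (_ *: _); apply: eq_bigr => j _.
by rewrite rmorphXn tnth_mktuple.
Qed.

End Composition.

Section Substitution.
Variable n : nat.

(** The action of matrices on polynomials is needed over every commutative ring,
    to be transported along the morphisms attached to a place. *)
Definition lsubst (R : comNzRingType) (g : 'M[R]_n) (q : {mpoly R[n]}) : {mpoly R[n]} :=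
  q \mPo [tuple \sum_(i < n) g i j *: 'X_i | j < n].

Arguments lsubst : simpl never.

Section Ring.
Variable R : comNzRingType.
Implicit Types (g h : 'M[R]_n) (q : {mpoly R[n]}).

Lemma lsubstX g j : lsubst g 'X_j = \sum_i g i j *: 'X_i.
Proof. by rewrite /lsubst comp_mpolyXU -tnth_nth tnth_mktuple. Qed.

Lemma lsubst_is_linear g : linear (lsubst g).
Proof. by move=> c q r; rewrite /lsubst linearP. Qed.
HB.instance Definition _ g :=
  GRing.isLinear.Build R {mpoly R[n]} {mpoly R[n]} _ (lsubst g) (lsubst_is_linear g).

Lemma lsubst_is_monoid g : monoid_morphism (lsubst g).
Proof. by split=> [|q r]; rewrite /lsubst ?rmorph1 ?rmorphM. Qed.
HB.instance Definition _ g := GRing.isMonoidMorphism.Build _ _ (lsubst g) (lsubst_is_monoid g).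

(** Identities between algebra morphisms, or between derivations along one, need
    only be checked on the variables. *)
Lemma mpoly_variables_ind (P : {mpoly R[n]} -> Prop) :
  (forall c q r, P q -> P r -> P (c *: q + r)) ->
  P 1 -> (forall q r, P q -> P r -> P (q * r)) -> (forall j, P 'X_j) ->
  forall q, P q.
Proof.
move=> Plin P1 PM PX; have P0 : P 0 by rewrite -(addNr 1) -scaleN1r; apply: Plin.
elim/mpolyind => // c m q _ _ Pq; apply: Plin => //.
rewrite mpolyXE_id; apply: big_ind => // j _.
by elim: (m j) => [|k IH]; rewrite ?expr0 ?exprS //; apply: PM.
Qed.

Lemma lsubst_comp g h q : lsubst g (lsubst h q) = lsubst (g *m h) q.
Proof.
elim/mpoly_variables_ind: q => [c q r IHq IHr||q r IHq IHr|j].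
- by rewrite !linearP /= IHq IHr.
- by rewrite !rmorph1.
- by rewrite !rmorphM /= IHq IHr.
rewrite !lsubstX linear_sum /=.
under eq_bigr do rewrite linearZ /= lsubstX scaler_sumr.
rewrite exchange_big /=; apply: eq_bigr => k _; rewrite mxE scaler_suml.
by apply: eq_bigr => l _; rewrite scalerA mulrC.
Qed.

Lemma lsubst1 q : lsubst 1%:M q = q.
Proof.
elim/mpoly_variables_ind: q => [c q r IHq IHr||q r IHq IHr|j].
- by rewrite linearP /= IHq IHr.
- by rewrite rmorph1.
- by rewrite rmorphM /= IHq IHr.
rewrite lsubstX (bigD1 j) //= mxE eqxx scale1r big1 ?addr0 // => k /negPf kj.
by rewrite mxE kj scale0r.
Qed.

Lemma lsubst_homog d g q : q \is d.-homog -> lsubst g q \is d.-homog.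
Proof.
move=> hq; apply: comp_homog => // j; rewrite tnth_mktuple.
by apply: rpred_sum => k _; apply: rpredZ; rewrite dhomogX /= mdeg1.
Qed.

Lemma mderiv_lsubst g q k :
  (lsubst g q)^`M(k) = \sum_j g k j *: lsubst g (q^`M(j)).
Proof.
elim/mpoly_variables_ind: q => [c q r IHq IHr||q r IHq IHr|j].
- rewrite linearP /= linearP /= IHq IHr scaler_sumr -big_split /=; apply: eq_bigr => j _.
  by rewrite !linearP /= !scalerA mulrC.
- rewrite rmorph1 -mpolyC1 mderivC big1 // => j _.
  by rewrite mderivC raddf0 scaler0.
- rewrite rmorphM mderivM IHq IHr mulr_suml mulr_sumr -big_split /=.
  apply: eq_bigr => j _; rewrite mderivM rmorphD !rmorphM scalerDr /=.
  by rewrite scalerAl scalerAr.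
have dX (a b : 'I_n) : ('X_b : {mpoly R[n]})^`M(a) = (a == b)%:R.
  rewrite mderivX mnm1E eq_sym; case: eqP => [->|_]; last by rewrite scale0r.
  by rewrite scale1r; have -> : (U_(b) - U_(b))%MM = 0%MM;
    [apply/mnmP => x; rewrite !mnmE subnn | rewrite mpolyX0].
rewrite lsubstX linear_sum /=.
have -> : \sum_i (g i j *: 'X_i)^`M(k) = (g k j)%:MP.
  rewrite (bigD1 k) //= linearZ /= dX eqxx -mul_mpolyC mulr1 big1 ?addr0 // => a ak.
  by rewrite linearZ /= dX eq_sym (negPf ak) scaler0.
rewrite (bigD1 j) //= dX eqxx rmorph1 -mul_mpolyC mulr1 big1 ?addr0 // => a aj.
by rewrite dX (negPf aj) raddf0 scaler0.
Qed.

Lemma mcoeff_lsubst_diag (t : 'rV[R]_n) q m :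
  (lsubst (diag_mx t) q)@_m = (\prod_j t 0 j ^+ m j) * q@_m.
Proof.
rewrite [in LHS](mpolyE q) [in RHS](mpolyE q) (linear_sum (lsubst (diag_mx t))) /= !raddf_sum /= mulr_sumr.
apply: eq_bigr => m' _; rewrite linearZ /= !mcoeffZ mcoeffX mulrCA; congr (_ * _).
rewrite /lsubst comp_mpolyX.
have -> : \prod_(j < n) tnth [tuple \sum_(k < n) diag_mx t k j0 *: 'X_k | j0 < n] j ^+ m' j =
    (\prod_j t 0 j ^+ m' j) *: 'X_[m'] :> {mpoly R[n]}.
  rewrite mpolyXE_id -mul_mpolyC rmorph_prod -big_split /=; apply: eq_bigr => j _.
  rewrite tnth_mktuple (bigD1 j) //= big1 ?addr0 => [|k /negPf kj].
    by rewrite mxE eqxx mulr1n -mul_mpolyC exprMn rmorphXn.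
  by rewrite mxE kj mulr0n scale0r.
by rewrite mcoeffZ mcoeffX; case: eqP => [->|]; rewrite ?mulr0.
Qed.

End Ring.

Lemma map_lsubst (R S : comNzRingType) (f : {rmorphism R -> S}) (g : 'M[R]_n) q :
  map_mpoly f (lsubst g q) = lsubst (map_mx f g) (map_mpoly f q).
Proof.
elim/mpoly_variables_ind: q => [c q r IHq IHr||q r IHq IHr|j].
- by rewrite linearP !rmorphD /= !map_mpolyZ IHq IHr linearZ.
- by rewrite !rmorph1.
- by rewrite !rmorphM /= IHq IHr.
rewrite lsubstX map_mpolyX lsubstX rmorph_sum /=; apply: eq_bigr => k _.
by rewrite map_mpolyZ map_mpolyX mxE.
Qed.

End Substitution.

Definition independent_partials (R : comNzRingType) n (F : {mpoly R[n]}) : Prop :=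
  forall c : 'I_n -> R, \sum_j c j *: F^`M(j) = 0 -> forall j, c j = 0.

Lemma homog_msize_le n (R : comNzRingType) d (q : {mpoly R[n]}) :
  q \is d.-homog -> (msize q <= d.+1)%N.
Proof.
by move=> /dhomogP h; rewrite msizeE; apply/bigmax_leqP_seq => m /h /= ->.
Qed.

Section Minors.

Lemma det_sum_expand (R : comNzRingType) k (T : finType) (A : 'I_k -> T -> R) (B : T -> 'I_k -> R) :
  \det (\matrix_(a, b) \sum_c A a c * B c b) =
  \sum_(f : {ffun 'I_k -> T}) (\prod_b B (f b) b) * \det (\matrix_(a, b) A a (f b)).
Proof.
rewrite -[LHS]det_tr [LHS]/determinant.
under eq_bigr => s _.
  under eq_bigr do rewrite !mxE.
  rewrite bigA_distr_bigA /= mulr_sumr; over.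
rewrite exchange_big /=; apply: eq_bigr => f _.
rewrite -det_tr /determinant mulr_sumr.
apply: eq_bigr => s _; rewrite mulrCA; congr (_ * _); rewrite -big_split /=.
by apply: eq_bigr => a _; rewrite !mxE mulrC.
Qed.

(** Plucker coordinates with respect to the monomials. *)
Definition minor (R : comNzRingType) k n (v : 'I_k -> {mpoly R[n]}) (a : 'I_k -> 'X_{1..n}) : R :=
  \det (\matrix_(b, c) (v b)@_(a c)).

Variables (k n : nat).

Lemma eq_minor (R : comNzRingType) (v w : 'I_k -> {mpoly R[n]}) a :
  v =1 w -> minor v a = minor w a.
Proof. by move=> vw; congr (\det _); apply/matrixP => b c; rewrite !mxE vw. Qed.

Lemma map_minor (R S : comNzRingType) (f : {rmorphism R -> S}) (v : 'I_k -> {mpoly R[n]}) a :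
  f (minor v a) = minor (fun b => map_mpoly f (v b)) a.
Proof.
rewrite -det_map_mx; congr (\det _); apply/matrixP => b c.
by rewrite !mxE mcoeff_map_mpoly.
Qed.

Lemma minor_lincomb (R : comNzRingType) (P : 'M[R]_k) (v : 'I_k -> {mpoly R[n]}) a :
  minor (fun b => \sum_c P b c *: v c) a = \det P * minor v a.
Proof.
rewrite -det_mulmx; congr (\det _); apply/matrixP => b c; rewrite !mxE raddf_sum /=.
by apply: eq_bigr => l _; rewrite mcoeffZ mxE.
Qed.

Lemma minor_scale (R : comNzRingType) (s : 'I_k -> R) (v : 'I_k -> {mpoly R[n]}) a :
  minor (fun b => s b *: v b) a = (\prod_b s b) * minor v a.
Proof.
have -> : \prod_b s b = \det (diag_mx (\row_c s c)).
  by rewrite det_diag; apply: eq_bigr => b _; rewrite mxE.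
rewrite -minor_lincomb; apply: eq_minor => b.
rewrite (bigD1 b) //= big1 ?addr0 => [|c /negPf cb]; first by rewrite !mxE eqxx mulr1n.
by rewrite !mxE eq_sym cb mulr0n scale0r.
Qed.

Lemma minor_diag (R : comNzRingType) (t : 'rV[R]_n) (v : 'I_k -> {mpoly R[n]}) a :
  minor (fun b => lsubst (diag_mx t) (v b)) a =
  (\prod_c \prod_j t 0 j ^+ a c j) * minor v a.
Proof.
transitivity (\det ((\matrix_(b, c) (v b)@_(a c)) *m diag_mx (\row_c \prod_j t 0 j ^+ a c j))).
  congr (\det _); apply/matrixP => b c; rewrite mul_mx_diag !mxE mcoeff_lsubst_diag.
  by rewrite mulrC.
rewrite det_mulmx det_diag mulrC; congr (_ * _); apply: eq_bigr => c _; by rewrite mxE.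
Qed.

(** The Cauchy-Binet expansion over all tuples of monomials, instead of the
    increasing ones, spares the choice of an order on monomials. *)
Lemma minor_lsubst (R : comNzRingType) d (g : 'M[R]_n) (v : 'I_k -> {mpoly R[n]}) a :
  (forall b, v b \is d.-homog) ->
  minor (fun b => lsubst g (v b)) a =
  \sum_(f : {ffun 'I_k -> 'X_{1..n < d.+1}})
    (\prod_c (lsubst g 'X_[R, f c])@_(a c)) * minor v (fun c => f c).
Proof.
move=> hv; rewrite -(det_sum_expand (fun b (m : 'X_{1..n < d.+1}) => (v b)@_m)
  (fun m c => (lsubst g 'X_[R, m])@_(a c))); congr (\det _); apply/matrixP => b c; rewrite !mxE.
rewrite [in LHS](mpolywE (homog_msize_le (hv b))) (linear_sum (lsubst g)) /= raddf_sum /=; apply: eq_bigr => m _.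
by rewrite linearZ /= mcoeffZ.
Qed.

End Minors.

(** * Exterior powers *)

Section CauchyBinet.
Variables (R : comNzRingType) (k N : nat).
Local Notation idx := {s : {ffun 'I_k -> 'I_N} | increasing s}.

Let incr_lt (s : idx) (a b : 'I_k) : (a < b)%N -> (val s a < val s b)%N.
Proof. by move: (valP s) => /forallP/(_ a)/forallP/(_ b)/implyP; apply. Qed.

Let incr_inj (s : idx) : injective (val s).
Proof.
move=> a b e; apply: val_inj; case: (ltngtP a b) => // ab;
by have := incr_lt s ab; rewrite e ltnn.
Qed.

Let incr_sorted (s : idx) : sorted ltn [seq val (val s a) | a <- enum 'I_k].
Proof.
rewrite sorted_map; have := iota_ltn_sorted 0 k; rewrite -val_enum_ord sorted_map.
by apply: sub_sorted => a b; apply: incr_lt.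
Qed.

Let shuffle (u : idx * 'S_k) : {ffun 'I_k -> 'I_N} := [ffun a => val u.1 (u.2 a)].

Let shuffle_inj : injective shuffle.
Proof.
move=> [s p] [s' p'] /ffunP e.
have ss : s = s'.
  have : [seq val (val s a) | a <- enum 'I_k] = [seq val (val s' a) | a <- enum 'I_k].
    apply: (irr_sorted_eq ltn_trans ltnn) => // x.
    apply/mapP/mapP => -[a _ ->].
      by exists (p' ((p^-1)%g a)); rewrite ?mem_enum //; have := e ((p^-1)%g a); rewrite !ffunE /= permKV => ->.
    by exists (p ((p'^-1)%g a)); rewrite ?mem_enum //; have := e ((p'^-1)%g a); rewrite !ffunE /= permKV => ->.
  move=> /eq_in_map h; apply: val_inj; apply/ffunP => a; apply: val_inj.
  by apply: h; rewrite mem_enum.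
rewrite -ss in e *; congr (_, _); apply/permP => a; apply: (@incr_inj s).
by have := e a; rewrite !ffunE.
Qed.

Let shuffle_onto (f : {ffun 'I_k -> 'I_N}) : injectiveb f -> exists u, f = shuffle u.
Proof.
move=> /injectiveP finj.
pose t := [tuple f a | a < k].
have tu : uniq t by rewrite map_inj_uniq ?enum_uniq.
pose t' := sort_tuple (fun a b : 'I_N => (a <= b)%N) t.
have /tuple_permP[p tE] : perm_eq t t' by rewrite perm_sym; apply/permEl/perm_sort.
have t'lt : sorted ltn [seq val x | x <- t'].
  rewrite ltn_sorted_uniq_leq map_inj_uniq; last exact: val_inj.
  rewrite sort_uniq tu /= sorted_map; apply: sort_sorted => a b; exact: leq_total.
have incr : increasing [ffun a => tnth t' a].
  apply/forallP => a; apply/forallP => b; apply/implyP => ab; rewrite !ffunE.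
  have sz : size [seq val x | x <- t'] = k by rewrite size_map size_tuple.
  have := sorted_ltn_nth ltn_trans 0%N t'lt (val a) (val b).
  rewrite !inE sz !ltn_ord => /(_ isT isT ab).
  by rewrite !(nth_map (f a)) ?size_tuple ?ltn_ord // -!tnth_nth.
exists (exist _ [ffun a => tnth t' a] incr, p); apply/ffunP => a; rewrite !ffunE /=.
have : tnth t a = tnth [tuple tnth t' (p a0) | a0 < k] a.
  by rewrite !(tnth_nth (f a)) tE.
by rewrite !tnth_mktuple.
Qed.

(** The tuples of indices with a repetition contribute 0 to the full expansion, and
    the other ones are grouped by their increasing rearrangement. *)
Lemma cauchy_binet (A : 'I_k -> 'I_N -> R) (B : 'I_N -> 'I_k -> R) :
  \det (\matrix_(a, b) \sum_c A a c * B c b) =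
  \sum_(s : idx) \det (\matrix_(a, b) A a (val s b)) * \det (\matrix_(a, b) B (val s a) b).
Proof.
pose G (f : {ffun 'I_k -> 'I_N}) := (\prod_b B (f b) b) * \det (\matrix_(a, b) A a (f b)).
rewrite det_sum_expand (bigID (fun f : {ffun 'I_k -> 'I_N} => injectiveb f)) /=.
rewrite [X in _ + X]big1 ?addr0 => [|f /injectivePn[a [b ab e]]]; last first.
  rewrite -det_tr (@determinant_alternate _ _ _ a b) ?mulr0 // => c.
  by rewrite !mxE e.
transitivity (\sum_(f in [set shuffle u | u in [set: idx * 'S_k]]) G f).
  apply: eq_bigl => f; apply/idP/imsetP => [/shuffle_onto[u ->]|[[s p] _ ->]].
    by exists u.
  by apply/injectiveP => a b; rewrite !ffunE /= => /incr_inj/perm_inj.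
rewrite big_imset /=; last by move=> u u' _ _; apply: shuffle_inj.
rewrite (eq_bigl xpredT) => [|u]; last by rewrite inE.
rewrite -(pair_bigA _ (fun s p => G (shuffle (s, p)))) /=; apply: eq_bigr => s _.
rewrite -[X in _ * X]det_tr [X in _ * X]/determinant mulr_sumr.
apply: eq_bigr => p _; rewrite /G.
have -> : \det (\matrix_(a, b) A a (shuffle (s, p) b)) =
    (-1) ^+ p * \det (\matrix_(a, b) A a (val s b)).
  rewrite -[in (-1) ^+ p]odd_permV -det_perm mulrC -det_mulmx -col_permE.
  by congr (\det _); apply/matrixP => a b; rewrite !mxE ffunE.
rewrite mulrCA mulrA mulrC; congr (_ * _); congr (_ * _).
by apply: eq_bigr => a _; rewrite !mxE ffunE.
Qed.
End CauchyBinet.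

Section Wedge.
Variables (C : fieldType) (k : nat) (E : vectType C).
Implicit Types v : 'I_k -> E.
Local Notation e := (fun c => (vbasis {:E})`_c).

Let coordE (x : E) : x = \sum_c coord (vbasis {:E}) c x *: (vbasis {:E})`_c.
Proof. exact/coord_vbasis/memvf. Qed.

(** The Cauchy-Binet formula, in coordinates. *)
Lemma det_wedge (phi : 'I_k -> E -> C) v : (forall j, scalar (phi j)) ->
  \det (\matrix_(a, b) phi b (v a)) =
  \sum_(s : ext_index k E) \det (\matrix_(a, b) phi b (e (val s a))) * wedge v s.
Proof.
move=> philin; under eq_bigr do rewrite /wedge ffunE mulrC.
rewrite -(cauchy_binet (fun a c => coord (vbasis {:E}) c (v a)) (fun c b => phi b (e c))).
congr (\det _); apply/matrixP => a b; rewrite !mxE {1}[v a]coordE.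
pose f : {linear E -> C^o} := HB.pack (phi b) (GRing.isLinear.Build C E C^o _ (phi b) (philin b)).
rewrite -[phi b]/(f : _ -> _) linear_sum; apply: eq_bigr => c _.
by rewrite linearZ.
Qed.

Lemma eq_wedge v w : v =1 w -> wedge v = wedge w.
Proof.
by move=> vw; apply/ffunP => s; rewrite !ffunE; congr (\det _); apply/matrixP => a b; rewrite !mxE vw.
Qed.

Lemma wedge_lincomb (P : 'M[C]_k) v :
  wedge (fun a => \sum_b P a b *: v b) = \det P *: wedge v.
Proof.
apply/ffunP => s; rewrite !ffunE -[RHS]det_mulmx; congr (\det _).
apply/matrixP => a b; rewrite !mxE linear_sum; apply: eq_bigr => c _.
by rewrite linearZ !mxE.
Qed.

Lemma wedge_free (X : k.-tuple E) : free X -> wedge (fun a : 'I_k => X`_a) != 0.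
Proof.
move=> freeX; apply/eqP => w0.
have := @det_wedge (fun b => coord X b) (fun a : 'I_k => X`_a) (fun b => linearP _).
rewrite w0 big1 => [|s _]; last by rewrite ffunE mulr0.
rewrite (_ : \matrix_(a, b) _ = 1%:M) ?det1; first by move/eqP; rewrite oner_eq0.
by apply/matrixP => a b; rewrite !mxE coord_free.
Qed.

(** The factor is the determinant of the change of basis. *)
Lemma wedge_basis (X Y : k.-tuple E) : free X -> (<<X>> = <<Y>>)%VS ->
  exists2 c : C, c != 0 & wedge (fun a : 'I_k => X`_a) = c *: wedge (fun a : 'I_k => Y`_a).
Proof.
move=> freeX XY; pose P : 'M[C]_k := \matrix_(a, b) coord Y b (X`_a).
exists (\det P).
  apply: contraNneq (wedge_free freeX) => P0.
  suff -> : wedge (fun a : 'I_k => X`_a) = \det P *: wedge (fun a : 'I_k => Y`_a) by rewrite P0 scale0r.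
  rewrite -wedge_lincomb; apply: eq_wedge => a.
  rewrite {1}(@coord_span _ _ _ Y X`_a); first by apply: eq_bigr => b _; rewrite mxE.
  by rewrite -XY memv_span // mem_nth // size_tuple.
rewrite -wedge_lincomb; apply: eq_wedge => a.
rewrite {1}(@coord_span _ _ _ Y X`_a); first by apply: eq_bigr => b _; rewrite mxE.
by rewrite -XY memv_span // mem_nth // size_tuple.
Qed.

Lemma ext_map_wedge (f : {linear E -> E}) v : ext_map f (wedge v) = wedge (f \o v).
Proof.
apply/ffunP => s; rewrite sum_ffunE [RHS]ffunE.
pose phi b x := coord (vbasis {:E}) (val s b) (f x).
have philin b : scalar (phi b) by move=> c x y; rewrite /phi !linearP.
rewrite -[RHS]/(\det (\matrix_(a, b) phi b (v a))) (det_wedge v philin).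
by apply: eq_bigr => u _; rewrite !ffunE mulrC.
Qed.

End Wedge.

(** * Zariski closures and one-parameter subgroups *)

Section Closure.
Variables (C : numClosedFieldType) (W : vectType C).
Implicit Types (S : W -> Prop) (w y : W).

Definition polynomial_function (f : W -> C) : Prop :=
  exists P : {mpoly C[\dim {:W}]}, forall w, f w = P.@[fun i => coord (vbasis {:W}) i w].

Lemma polyfun_linear (f : {linear W -> C^o}) : polynomial_function f.
Proof.
exists (\sum_(i < \dim {:W}) (f (vbasis {:W})`_i : C) *: 'X_i) => w.
rewrite {1}(coord_vbasis (memvf w)) linear_sum raddf_sum /=; apply: eq_bigr => i _.
by rewrite linearZ /= mevalZ mevalXU mulrC.
Qed.

Lemma polyfun_const c : polynomial_function (fun=> c).
Proof. by exists c%:MP => w; rewrite mevalC. Qed.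

Lemma polyfunM f g : polynomial_function f -> polynomial_function g ->
  polynomial_function (fun w => f w * g w).
Proof. by move=> [P fP] [Q gQ]; exists (P * Q) => w; rewrite mevalM fP gQ. Qed.

Lemma polyfun_sum (I : Type) (r : seq I) (f : I -> W -> C) :
  (forall i, polynomial_function (f i)) -> polynomial_function (fun w => \sum_(i <- r) f i w).
Proof.
move=> h; elim: r => [|i r [P rP]].
  by have [P hP] := polyfun_const 0; exists P => w; rewrite big_nil -hP.
by have [Q iQ] := h i; exists (Q + P) => w; rewrite big_cons mevalD iQ rP.
Qed.

Lemma polyfun_prod (I : Type) (r : seq I) (f : I -> W -> C) :
  (forall i, polynomial_function (f i)) -> polynomial_function (fun w => \prod_(i <- r) f i w).
Proof.
move=> h; elim: r => [|i r [P rP]].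
  by have [P hP] := polyfun_const 1; exists P => w; rewrite big_nil -hP.
by have [Q iQ] := h i; exists (Q * P) => w; rewrite big_cons mevalM iQ rP.
Qed.

Lemma polyfun_det k (f : 'I_k -> 'I_k -> W -> C) :
  (forall a b, polynomial_function (f a b)) ->
  polynomial_function (fun w => \det (\matrix_(a, b) f a b w)).
Proof.
move=> h; have [P hP] : polynomial_function
    (fun w => \sum_(s : 'S_k) (-1) ^+ s * \prod_a f a (s a) w).
  apply: polyfun_sum => s; apply: polyfunM; first exact: polyfun_const.
  by apply: polyfun_prod => a.
exists P => w; rewrite -hP; apply: eq_bigr => s _; congr (_ * _).
by apply: eq_bigr => a _; rewrite mxE.
Qed.

Lemma zariski_closure_image (W' : vectType C) (psi : W -> W') S (S' : W' -> Prop) w :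
  (forall i, polynomial_function (fun x => coord (vbasis {:W'}) i (psi x))) ->
  (forall x, S x -> S' (psi x)) ->
  zariski_closure S w -> zariski_closure S' (psi w).
Proof.
move=> psiP SS' Sw P hP.
pose Q i := sval (cid (psiP i)).
have QE i x : coord (vbasis {:W'}) i (psi x) = (Q i).@[fun i => coord (vbasis {:W}) i x].
  by rewrite /Q; case: cid.
have PQ x : P.@[fun i => coord (vbasis {:W'}) i (psi x)] =
    (P \mPo [tuple Q i | i < \dim {:W'}]).@[fun i => coord (vbasis {:W}) i x].
  rewrite comp_mpoly_meval; apply: meval_eq => i; by rewrite tnth_mktuple QE.
by rewrite PQ; apply: Sw => x /SS'/hP; rewrite PQ.
Qed.

Lemma poly_vanishing (q : {poly C}) : (forall z, z != 0 -> q.[z] = 0) -> q = 0.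
Proof.
move=> h; apply/eqP/negPn/negP => q0.
have := @max_poly_roots _ q [seq k.+1%:R | k <- iota 0 (size q)] q0.
rewrite size_map size_iota ltnn => /(_ _ _)/notF; apply.
  by apply/allP => x /mapP[k _ ->]; apply/rootP/h; rewrite pnatr_eq0.
rewrite map_inj_uniq ?iota_uniq // => a b /eqP; rewrite eqr_nat => /eqP.
by case.
Qed.

(** A polynomial vanishing on S becomes, along the curve, a polynomial in z with
    infinitely many zeros. *)
Lemma zariski_closure_curve S D (Y : nat -> W) :
  (forall z : C, z != 0 -> S (\sum_(e < D.+1) z ^+ e *: Y e)) -> zariski_closure S (Y 0%N).
Proof.
move=> SY P hP.
pose c i : {poly C} := \sum_(e < D.+1) coord (vbasis {:W}) i (Y e) *: 'X^e.
pose q := mmap (@polyC C) c P.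
have qE z : q.[z] = P.@[fun i => (c i).[z]].
  rewrite /q /mmap horner_sum mevalE; apply: eq_bigr => m _.
  rewrite hornerM hornerC /mmap1; congr (_ * _).
  by rewrite horner_prod; apply: eq_bigr => i _; rewrite horner_exp.
have cE i z : (c i).[z] = coord (vbasis {:W}) i (\sum_(e < D.+1) z ^+ e *: Y e).
  rewrite horner_sum linear_sum; apply: eq_bigr => e _.
  by rewrite linearZ hornerZ hornerXn mulrC.
have q0 : q = 0.
  apply: poly_vanishing => z z0; rewrite qE (meval_eq _ (fun i => cE i z)).
  exact/hP/SY.
have : q.[0] = 0 by rewrite q0 horner0.
rewrite qE => <-; apply: meval_eq => i; rewrite cE big_ord_recl expr0 scale1r.
by rewrite big1 ?addr0 // => e _; rewrite expr0n scale0r.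
Qed.

End Closure.

Section OneParameter.
Variables (C : numClosedFieldType) (n : nat).
Implicit Types (l : 'I_n -> int) (z : C) (m : 'X_{1..n}).

Definition weight l m : int := \sum_j (m j)%:Z * l j.

Definition block_form l (q : {mpoly C[n]}) : Prop :=
  forall m a b, m \in msupp q -> m a != 0%N -> m b != 0%N -> l a = l b.

(** The numerical form of stability: no nontrivial one-parameter subgroup, diagonal
    in some coordinates, has a limit on q. *)
Definition weight_stable (q : {mpoly C[n]}) : Prop :=
  forall (g : 'M[C]_n) l, \det g = 1 -> \sum_j l j = 0 ->
    (forall m, m \in msupp (lsubst g q) -> 0 <= weight l m) -> forall j, l j = 0.

Definition torus l z : 'M[C]_n := diag_mx (\row_j z ^ l j).

Lemma prodr_exprz (z : C) l : z != 0 -> \prod_j z ^ l j = z ^ (\sum_j l j).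
Proof.
by move=> z0; apply/esym; apply: (big_morph (fun k : int => z ^ k)) => // a b; rewrite expfzDr.
Qed.

Lemma det_torus l z : z != 0 -> \sum_j l j = 0 -> \det (torus l z) = 1.
Proof.
move=> z0 l0; rewrite det_diag (eq_bigr (fun j => z ^ l j)) => [|j _]; last by rewrite mxE.
by rewrite prodr_exprz // l0 expr0z.
Qed.

Lemma mcoeff_torus l z (q : {mpoly C[n]}) m : z != 0 ->
  (lsubst (torus l z) q)@_m = z ^ weight l m * q@_m.
Proof.
move=> z0; rewrite mcoeff_lsubst_diag; congr (_ * _).
rewrite /weight -prodr_exprz //; apply: eq_bigr => j _; rewrite mxE.
by rewrite exprnP exprz_exp mulrC.
Qed.

(** The powers of 2 provide infinitely many elements of the one-parameter subgroup. *)
Lemma infinite_stabilizer (W : vectType C) (act : 'M[C]_n -> W -> W) (w : W) l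
    (g h : 'M[C]_n) :
  h *m g = 1%:M -> \sum_j l j = 0 -> (exists j, l j != 0) ->
  (forall z, z != 0 -> act (g *m torus l z *m h) w = w) -> ~ finite_stabilizer act w.
Proof.
move=> hg l0 [j lj] fixw [s hs].
pose G k := g *m torus l (2%:R ^+ k) *m h.
have z0 k : (2%:R : C) ^+ k != 0 by rewrite expf_neq0 // pnatr_eq0.
have Ginj : injective G.
  move=> a b Gab.
  have : torus l (2%:R ^+ a) = torus l (2%:R ^+ b).
    have := congr1 (fun M => h *m M *m g) Gab.
    by rewrite /G !mulmxA hg !mul1mx -!mulmxA hg !mulmx1.
  move=> /matrixP/(_ j j); rewrite !mxE eqxx !mulr1n => /eqP.
  have inj2 : injective (exprz (2%:R : C)).
    have two0 : (2%:R : C) != 0 by rewrite pnatr_eq0.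
    move=> x y xy; apply/eqP; rewrite -subr_eq0; apply/eqP.
    have : (2%:R : C) ^ (x - y) = 1 by rewrite expfzDr // xy -expfzDr // subrr expr0z.
    have one k : (2%:R : C) ^+ k = 1 -> k = 0%N.
      by move/eqP; rewrite ieexprn_weq1 ?ler0n // pnatr_eq1 orbF => /eqP.
    case: (x - y) => k; first by rewrite -exprnP => /one ->.
    by rewrite NegzE -exprnN => /eqP; rewrite invr_eq1 => /eqP/one.
  rewrite !exprnP !exprz_exp => /eqP/inj2/(mulIf lj) [].
  exact: id.
have := @uniq_leq_size _ [seq G k | k <- iota 0 (size s).+1] s.
rewrite map_inj_uniq // iota_uniq size_map size_iota ltnn => /(_ isT) h'.
suff : false by []; apply: h' => M /mapP[k _ ->]; apply: hs.
  by rewrite !det_mulmx det_torus // mulr1 mulrC -det_mulmx hg det1.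
exact: fixw.
Qed.

Definition weight_part l (e : int) (q : {mpoly C[n]}) : {mpoly C[n]} :=
  \sum_(m <- msupp q | weight l m == e) q@_m *: 'X_[m].

Lemma mcoeff_weight_part l e q m :
  (weight_part l e q)@_m = if weight l m == e then q@_m else 0.
Proof.
rewrite /weight_part raddf_sum /=; have [mq|mq] := boolP (m \in msupp q); last first.
  rewrite (memN_msupp_eq0 mq) if_same big_seq_cond big1 // => m' /andP[m'q _].
  rewrite mcoeffZ mcoeffX; case: eqP => [e'|_]; last by rewrite mulr0.
  by rewrite -e' m'q in mq.
rewrite big_mkcond /= (bigD1_seq m) //= big1 ?addr0.
  by case: ifP; rewrite // mcoeffZ mcoeffX eqxx mulr1.
by move=> m' /negPf m'm; case: ifP; rewrite // mcoeffZ mcoeffX m'm mulr0.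
Qed.

Lemma weight_part_homog d l e q : q \is d.-homog -> weight_part l e q \is d.-homog.
Proof.
move=> /dhomogP hq; rewrite /weight_part big_seq_cond; apply: rpred_sum => m /andP[mq _].
by apply: rpredZ; rewrite dhomogX; apply/eqP/hq.
Qed.

Lemma torus_curve l (q : {mpoly C[n]}) : (forall m, m \in msupp q -> 0 <= weight l m) ->
  exists D, forall z, z != 0 ->
    lsubst (torus l z) q = \sum_(e < D.+1) z ^+ e *: weight_part l e%:Z q.
Proof.
move=> pos; pose D := (\max_(m <- msupp q) absz (weight l m))%N; exists D => z z0.
apply/mpolyP => m; rewrite mcoeff_torus // raddf_sum /=.
under eq_bigr do rewrite mcoeffZ mcoeff_weight_part.
have [mq|mq] := boolP (m \in msupp q); last first.
  by rewrite (memN_msupp_eq0 mq) mulr0 big1 // => e _; rewrite if_same mulr0.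
have wE : weight l m = (absz (weight l m))%:Z by rewrite gez0_abs // pos.
have wD : (absz (weight l m) < D.+1)%N by rewrite ltnS /D; apply: leq_bigmax_seq.
rewrite (bigD1 (Ordinal wD)) //= -wE eqxx big1 ?addr0 => [|e ne].
  by rewrite {1}wE -exprnP.
case: eqP => [e'|]; rewrite ?mulr0 //; case/eqP: ne; apply: val_inj => /=.
by rewrite e'.
Qed.

End OneParameter.

(** * Orbits of forms and of their gradients *)

Section Forms.
Variables (C : numClosedFieldType) (n d : nat).
Local Notation form := (dhomog n.+1 C).
Implicit Types (F : form d.+1) (g h : 'M[C]_n.+1) (l : 'I_n.+1 -> int).

Lemma form_act_comp e g h (F : form e) : form_act g (form_act h F) = form_act (g *m h) F.
Proof. by apply: val_inj; apply: lsubst_comp. Qed.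

Lemma form_act1 e (F : form e) : form_act 1%:M F = F.
Proof. by apply: val_inj; apply: lsubst1. Qed.

(** If the monomials of g F have nonnegative weights, letting z tend to 0 in the
    one-parameter subgroup leaves their part of weight 0. *)
Lemma orbit_limit e (F : form e) g l : \det g = 1 -> \sum_j l j = 0 ->
  (forall m, m \in msupp (lsubst g (val F)) -> 0 <= weight l m) ->
  exists2 F0 : form e, zariski_closure (SL_orbit (@form_act C n.+1 e) F) F0 &
    val F0 = weight_part l 0 (lsubst g (val F)).
Proof.
move=> g1 l0 /torus_curve[D curve].
have hF : lsubst g (val F) \is e.-homog := lsubst_homog g (dhomog_is_dhomog F).
pose Y k : form e := DHomog (weight_part_homog l (Posz k) hF).
exists (Y 0%N) => //; apply: (@zariski_closure_curve _ _ _ D) => z z0.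
exists (torus l z *m g); first by rewrite det_mulmx det_torus // mul1r.
apply: val_inj; rewrite -form_act_comp raddf_sum.
by rewrite [RHS]curve //; apply: eq_bigr => k _; rewrite linearZ.
Qed.

(** The elementary half of the Hilbert-Mumford criterion. *)
Lemma semistable_weights e (F : form e) g l : semistable (@form_act C n.+1 e) F ->
  \det g = 1 -> \sum_j l j = 0 ->
  ~ forall m, m \in msupp (lsubst g (val F)) -> 0 < weight l m.
Proof.
move=> ssF g1 l0 pos; have [m /pos/ltW//|F0 clF0 F0E] := @orbit_limit _ F _ _ g1 l0.
apply: ssF; suff <- : F0 = 0 by [].
apply: val_inj; rewrite F0E; apply/mpolyP => m; rewrite mcoeff_weight_part mcoeff0.
case: eqP => // wm; apply/eqP; rewrite mcoeff_eq0; apply/negP => /pos.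
by rewrite wm ltxx.
Qed.

Lemma mulmx_inv_SL k (g : 'M[C]_k) : \det g = 1 -> invmx g *m g = 1%:M /\ g *m invmx g = 1%:M.
Proof. by move=> g1; rewrite mulVmx ?mulmxV // unitmxE g1 unitr1. Qed.

(** The limit of F under a one-parameter subgroup lies in the orbit of F, which is
    closed, and is fixed by the subgroup; so a nontrivial subgroup would make the
    stabilizer of F infinite. *)
Lemma stable_weights e (F : form e) : stable (@form_act C n.+1 e) F -> weight_stable (val F).
Proof.
move=> [[_ closedF] finF] g l g1 l0 pos j; apply/eqP/negPn/negP => lj.
have [F0 /closedF[g0 g01 F0F] F0E] := @orbit_limit _ F _ _ g1 l0 pos.
have [Vg gV] := mulmx_inv_SL g01.
apply: (infinite_stabilizer (act := @form_act C n.+1 e) (w := F) (l := l) (g := invmx g0)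
  (h := g0)) finF => //; first by exists j.
move=> z z0; rewrite -!form_act_comp -F0F.
have -> : form_act (torus l z) F0 = F0.
  apply: val_inj; apply/mpolyP => m; rewrite [LHS]mcoeff_torus // F0E mcoeff_weight_part.
  by case: eqP => [->|_]; rewrite ?mulr0 // expr0z mul1r.
by rewrite F0F form_act_comp Vg form_act1.
Qed.

Lemma stable_semistable e (F : form e) : stable (@form_act C n.+1 e) F ->
  semistable (@form_act C n.+1 e) F.
Proof.
move=> [[F0 closedF] _] /closedF[g g1 F0E]; apply: F0.
have [Vg _] := mulmx_inv_SL g1.
by rewrite -[F]form_act1 -Vg -form_act_comp -F0E linear0.
Qed.

Lemma partial_act g F i :
  partial i (form_act g F) = \sum_j g i j *: form_act g (partial j F).
Proof.
apply: val_inj; rewrite raddf_sum [LHS](mderiv_lsubst g (val F)); apply: eq_bigr => j _.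
by rewrite [RHS]linearZ.
Qed.

Definition wedge_gradient F : ext n.+1 (form d) := wedge (fun i => partial i F).

Lemma ext_act_wedge k g (v : 'I_k -> form d) :
  ext_act (@form_act C n.+1 d) g (wedge v) = wedge (fun i => form_act g (v i)).
Proof. exact: ext_map_wedge. Qed.

Lemma ext_act_scale k g c (x : ext k (form d)) :
  ext_act (@form_act C n.+1 d) g (c *: x) = c *: ext_act (@form_act C n.+1 d) g x.
Proof.
rewrite /ext_act /ext_map scaler_sumr; apply: eq_bigr => s _.
by rewrite ffunE scalerA.
Qed.

Lemma wedge_gradient_act g F : wedge_gradient (form_act g F) =
  \det g *: ext_act (@form_act C n.+1 d) g (wedge_gradient F).
Proof.
rewrite ext_act_wedge -wedge_lincomb; apply: eq_wedge => i; exact: partial_act.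
Qed.

Lemma partial_is_linear i : linear (@partial C n.+1 d i).
Proof. by move=> c F G; apply: val_inj; rewrite /= linearP. Qed.
HB.instance Definition _ i := GRing.isLinear.Build C (form d.+1) (form d) _
  (@partial C n.+1 d i) (partial_is_linear i).

(** Taking gradients is an SL(n + 1)-equivariant polynomial map sending 0 to 0. *)
Lemma semistable_of_gradient F :
  semistable (ext_act (@form_act C n.+1 d)) (wedge_gradient F) ->
  semistable (@form_act C n.+1 d.+1) F.
Proof.
move=> ss cl; apply: ss.
have <- : wedge_gradient (0 : form d.+1) = 0.
  apply/ffunP => s; rewrite !ffunE (expand_det_row _ ord0) big1 // => j _.
  by rewrite mxE !linear0 mul0r.
apply: zariski_closure_image cl => [c|_ [g g1 ->]]; last first.
  by exists g; rewrite // wedge_gradient_act g1 scale1r.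
pose f (s : ext_index n.+1 (form d)) F := \det (\matrix_(a, b)
  coord (vbasis {:form d}) (val s b) (partial a F)).
have [P hP] : polynomial_function (fun F => \sum_s
    (coord (vbasis {:ext n.+1 (form d)}) c [ffun s' => (s' == s)%:R : C^o]) * f s F).
  apply: polyfun_sum => s; apply: polyfunM; first exact: polyfun_const.
  by apply: polyfun_det => a b; apply: (polyfun_linear (coord (vbasis {:form d}) (val s b) \o partial a)).
exists P => G; rewrite -hP.
have -> : wedge_gradient G = \sum_s f s G *: [ffun s' => (s' == s)%:R : C^o].
  apply/ffunP => s; rewrite sum_ffunE (bigD1 s) //= big1 ?addr0 => [|s' /negPf ss'].
    by rewrite !ffunE eqxx /GRing.scale /= mulr1.
  by rewrite !ffunE eq_sym ss' scaler0.
rewrite linear_sum; apply: eq_bigr => s _; by rewrite linearZ mulrC.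
Qed.

End Forms.

(** * Adapted coordinates *)

Section Filtration.
Variables (C : numClosedFieldType) (n : nat) (l : 'I_n -> int).
Implicit Types (q r : {mpoly C[n]}) (k : int).

Definition weight_ge k q : Prop := forall m, m \in msupp q -> k <= weight l m.

Lemma weightD m m' : weight l (m + m') = weight l m + weight l m'.
Proof.
by rewrite -big_split; apply: eq_bigr => j _; rewrite mnmDE PoszD mulrDl.
Qed.

Lemma weightU j : weight l U_(j) = l j.
Proof.
rewrite /weight (bigD1 j) //= mnm1E eqxx mul1r big1 ?addr0 // => k /negPf kj.
by rewrite mnm1E eq_sym kj mul0r.
Qed.

Lemma weight0 : weight l 0%MM = 0.
Proof. by rewrite /weight big1 // => j _; rewrite mnm0E mul0r. Qed.

Lemma weight_geD k q r : weight_ge k q -> weight_ge k r -> weight_ge k (q + r).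
Proof. by move=> hq hr m /msuppD_le; rewrite mem_cat => /orP[/hq|/hr]. Qed.

Lemma weight_ge0 k : weight_ge k 0.
Proof. by move=> m; rewrite msupp0. Qed.

Lemma weight_geZ k c q : weight_ge k q -> weight_ge k (c *: q).
Proof. by move=> hq m /msuppZ_le/hq. Qed.

Lemma weight_ge_sum k (I : Type) (s : seq I) (P : pred I) (G : I -> {mpoly C[n]}) :
  (forall i, P i -> weight_ge k (G i)) -> weight_ge k (\sum_(i <- s | P i) G i).
Proof.
by move=> h; elim/big_ind: _ => //; [apply: weight_ge0 | apply: weight_geD].
Qed.

Lemma weight_geM k k' q r : weight_ge k q -> weight_ge k' r -> weight_ge (k + k') (q * r).
Proof.
move=> hq hr m /msuppM_le/allpairsP[[m1 m2] /= [/hq h1 /hr h2 ->]].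
by rewrite weightD lerD.
Qed.

Lemma weight_ge_lsubst (g : 'M[C]_n) k q : (forall i j, g i j != 0 -> l j <= l i) ->
  weight_ge k q -> weight_ge k (lsubst g q).
Proof.
move=> gl hq; rewrite [q]mpolyE (linear_sum (lsubst g)) big_seq.
apply: weight_ge_sum => m /hq km; rewrite linearZ; apply: weight_geZ.
suff h : weight_ge (weight l m) (lsubst g 'X_[m]) by move=> m' /h; apply: le_trans.
rewrite mpolyXE_id rmorph_prod /weight.
elim/big_ind2: _ => [m'|*|j _]; last 2 first.
- exact: weight_geM.
- rewrite rmorphXn /= lsubstX; elim: (m j) => [|e IH].
    by rewrite expr0 mul0r => m'; rewrite msupp1 inE => /eqP ->; rewrite weight0.
  rewrite exprS intS mulrDl mul1r; apply: weight_geM => //.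
  apply: weight_ge_sum => i _; have [->|/gl h] := eqVneq (g i j) 0.
    by rewrite scale0r; apply: weight_ge0.
  by apply: weight_geZ => m' /mem_msuppXP <-; rewrite weightU.
by rewrite msupp1 inE => /eqP ->; rewrite weight0.
Qed.

End Filtration.

Lemma exists_minor (C : fieldType) k (T : finType) (A : 'I_k -> T -> C) :
  (forall c : 'I_k -> C, (forall b, \sum_i c i * A i b = 0) -> forall i, c i = 0) ->
  exists f : 'I_k -> T, \det (\matrix_(i, j) A i (f j)) != 0.
Proof.
move=> indep; pose M := \matrix_(i < k, b < #|T|) A i (enum_val b).
have Mfree : row_free M.
  apply: inj_row_free => v vM; apply/rowP => i; rewrite mxE.
  apply: (indep (v 0)) => b.
  transitivity ((v *m M) 0 (enum_rank b)); last by rewrite vM mxE.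
  by rewrite [RHS]mxE; apply: eq_bigr => j _; rewrite mxE enum_rankK.
have Mfull : row_full M^T by rewrite /row_full mxrank_tr.
exists (fun j => enum_val (fullrankfun Mfull j)).
have := fullrowsub_unit Mfull; rewrite unitmxE unitfE -det_tr.
by congr (\det _ != 0); apply/matrixP => i j; rewrite !mxE.
Qed.

Section Adapted.
Variables (C : numClosedFieldType) (n d : nat) (l : 'I_n -> int) (F : {mpoly C[n]}).
Hypothesis l_mono : forall i j : 'I_n, (i <= j)%N -> l i <= l j.
Hypothesis F_homog : F \is d.+1.-homog.
Hypothesis F_indep : independent_partials F.

Let D (v : 'rV[C]_n) := \sum_j v 0 j *: F^`M(j).

Let D_homog v : D v \is d.-homog.
Proof. by apply: rpred_sum => j _; apply/rpredZ/mderiv_homog. Qed.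

Let good (i : 'I_n) (k : int) (v : 'rV[C]_n) :=
  [/\ v 0 i = 1, forall j : 'I_n, (i < j)%N -> v 0 j = 0 & weight_ge l k (D v)].

Let bound : nat := (\sum_(a : 'X_{1..n < d.+1}) absz (weight l a))%N.

Let boundP v m : m \in msupp (D v) -> (absz (weight l m) <= bound)%N.
Proof.
move=> /(dhomog_mf (D_homog v)) /= md; have mlt : (mdeg m < d.+1)%N by rewrite md.
by rewrite /bound (bigD1 (BMultinom mlt)) //= leq_addr.
Qed.

(** Row i of the adapted basis of derivations is chosen in the i-th coordinate
    derivation plus the span of the previous ones, with the largest possible order. *)
Let best i : exists kv : int * 'rV[C]_n, good i kv.1 kv.2 /\ forall v, ~ good i (kv.1 + 1) v.
Proof.
pose P k := `[< exists v, good i (k%:Z - bound%:Z) v >].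
have P0 : exists k, P k.
  exists 0%N; apply/asboolP; exists (delta_mx 0 i); split.
  - by rewrite mxE !eqxx.
  - by move=> j ij; rewrite mxE eqxx -val_eqE /= gtn_eqF.
  - by move=> m /boundP; lia.
have Pmax k : P k -> (k <= bound + bound)%N.
  move=> /asboolP[v [vi _ vk]].
  have : D v != 0 by apply/eqP => /F_indep/(_ i)/eqP; rewrite vi oner_eq0.
  rewrite -msupp_eq0; case e : (msupp _) => [//|m s] _.
  have mD : m \in msupp (D v) by rewrite e mem_head.
  by have := vk _ mD; have := boundP mD; lia.
have [k /asboolP[v vk] kmax] := ex_maxnP P0 Pmax.
exists (k%:Z - bound%:Z, v); split=> //= v' v'k.
have : P k.+1 by apply/asboolP; exists v'; rewrite -addn1 PoszD addrAC.
by move=> /kmax; rewrite ltnn.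
Qed.

(** Row i of p is a derivation of largest possible order k i. The parts of lowest
    weight of these derivatives of F are linearly independent: otherwise one of the
    derivations could be corrected by previous ones to raise its order. Hence some
    nonzero minor of the gradient has the total weight of the orders k. *)
Lemma adapted_coordinates : exists (p : 'M[C]_n) (k : 'I_n -> int),
  [/\ forall i j : 'I_n, (i < j)%N -> p i j = 0, forall i, p i i = 1,
      forall m i, m \in msupp (lsubst p F) -> m i != 0%N -> k i + l i <= weight l m
    & exists2 a : 'I_n -> 'X_{1..n}, minor (fun i => F^`M(i)) a != 0 &
        \sum_j weight l (a j) = \sum_i k i].
Proof.
have [kv kvP] := choice best; pose k i := (kv i).1; pose v i := (kv i).2.
pose p := \matrix_(i, j) v i 0 j.
have vi i : v i 0 i = 1 by have [[]] := kvP i.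
have vj (i j : 'I_n) : (i < j)%N -> v i 0 j = 0 by have [[_ h _] _] := kvP i; apply: h.
have vk i : weight_ge l (k i) (D (v i)) by have [[]] := kvP i.
exists p, k; split.
- by move=> i j ij; rewrite mxE vj.
- by move=> i; rewrite mxE vi.
- move=> m i mF mi.
  have pl a b : p a b != 0 -> l b <= l a.
    rewrite mxE => ab; apply: l_mono; rewrite leqNgt; apply: contraNN ab => ab.
    by rewrite vj.
  have e : (lsubst p F)^`M(i) = lsubst p (D (v i)).
    rewrite mderiv_lsubst (linear_sum (lsubst p)); apply: eq_bigr => j _.
    by rewrite linearZ mxE.
  have Um : (U_(i) <= m)%MM by rewrite lep1mP.
  have : (m - U_(i))%MM \in msupp (lsubst p (D (v i))).
    rewrite -e mcoeff_msupp mcoeff_mderiv submK // mulrn_eq0 negb_or /=.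
    by rewrite -mcoeff_msupp.
  move=> /(weight_ge_lsubst pl (vk i)).
  by rewrite -[m in X in _ -> X](submK Um) weightD weightU lerD2r.
pose A i (b : 'X_{1..n < d.+1}) := (D (v i))@_b.
(* A' i collects the coefficients of the part of D (v i) of lowest weight. *)
pose A' i (b : 'X_{1..n < d.+1}) := if weight l b == k i then A i b else 0.
have [f f0] : exists f : 'I_n -> 'X_{1..n < d.+1}, \det (\matrix_(i, j) A' i (f j)) != 0.
  apply: exists_minor => c hc i0; apply/eqP/negPn/negP => ci0.
  have [i ci imax] : exists2 i, c i != 0 & forall j : 'I_n, (i < j)%N -> c j = 0.
    case: (@arg_maxnP _ i0 (fun i => c i != 0) (fun i => val i) ci0) => i ci imax.
    exists i => // j ij; apply/eqP/negPn/negP => /imax /=.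
    by rewrite leqNgt ij.
  pose w := \sum_(j | k j == k i) (c j / c i) *: v j.
  have [_ /(_ w)[]] := kvP i; split.
  - rewrite summxE (bigD1 i) //= !mxE vi divff // mul1r big1 ?addr0 // => j /andP[_ ji].
    rewrite mxE; case: (ltngtP i j) => ij; first by rewrite imax // !mul0r.
      by rewrite vj // mulr0.
    by rewrite (val_inj ij) eqxx in ji.
  - move=> j ij; rewrite summxE big1 // => j' _; rewrite mxE.
    have [h|h] := leqP j' i; first by rewrite vj ?mulr0 // (leq_ltn_trans h).
    by rewrite imax // !mul0r.
  - move=> m mw.
    have Dw : D w = \sum_(j | k j == k i) (c j / c i) *: D (v j).
      rewrite /D; under [RHS]eq_bigr do rewrite scaler_sumr.
      rewrite exchange_big; apply: eq_bigr => a _; rewrite summxE scaler_suml.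
      by apply: eq_bigr => b _; rewrite mxE scalerA.
    have km : k i <= weight l m.
      have : weight_ge l (k i) (D w); last exact.
      by rewrite Dw; apply: weight_ge_sum => j /eqP <-; apply/weight_geZ/vk.
    rewrite -/(k i) lezD1 lt_neqAle km andbT; apply/negP => /eqP kim.
    have md : (mdeg m < d.+1)%N by rewrite (dhomog_mf (D_homog w) mw).
    move: mw; rewrite mcoeff_msupp => /eqP; apply.
    have := hc (BMultinom md); rewrite Dw raddf_sum /= => e.
    transitivity ((c i)^-1 * \sum_j c j * A' j (BMultinom md)); last by rewrite e mulr0.
    rewrite mulr_sumr big_mkcond; apply: eq_bigr => j _ /=.
    rewrite mcoeffZ /A' /= -kim [k i == _]eq_sym; case: ifP => _; last by rewrite !mulr0.
    by rewrite /A /= mulrA [_^-1 * _]mulrC.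
have eqk (w : 'I_n -> int) : (forall i, k i <= w i) -> \sum_i w i = \sum_i k i ->
    forall i, w i = k i.
  move=> kw e i; apply/eqP; rewrite -subr_eq0.
  have : \sum_i (w i - k i) == 0 by rewrite sumrB e subrr.
  rewrite psumr_eq0 => [/allP/(_ i)|j _]; last by rewrite subr_ge0.
  by rewrite mem_index_enum; apply.
have sumE : \sum_j weight l (f j) = \sum_i k i.
  have /existsP[s hs] : [exists s : 'S_n, \prod_i A' i (f (s i)) != 0].
    rewrite -negb_forall; apply: contraNN f0 => /forallP h; apply/eqP/big1 => s _.
    by under eq_bigr do rewrite mxE; rewrite (eqP (h s)) mulr0.
  rewrite (reindex_inj (@perm_inj _ s)); apply: eq_bigr => i _; apply/eqP.
  by move/prodf_neq0/(_ i isT): hs; rewrite /A'; case: ifP; rewrite // eqxx.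
exists (fun j => f j) => //.
have -> : minor (fun i => F^`M(i)) (fun j => f j) = minor (fun i => D (v i)) (fun j => f j).
  transitivity (minor (fun i => \sum_j p i j *: F^`M(j)) (fun j => f j)).
    rewrite minor_lincomb det_trig ?big1 ?mul1r //; first by move=> i _; rewrite mxE vi.
    by apply/is_trig_mxP => i j ij; rewrite mxE vj.
  by apply: eq_minor => i; apply: eq_bigr => j _; rewrite mxE.
suff -> : minor (fun i => D (v i)) (fun j => f j) = \det (\matrix_(i, j) A' i (f j)) by [].
apply: eq_bigr => s _; congr (_ * _).
under eq_bigr do rewrite mxE; under [RHS]eq_bigr do rewrite mxE.
have [/forallP all|] := boolP [forall i, weight l (f (s i)) == k i].
  by apply: eq_bigr => i _; rewrite /A' all.
rewrite negb_forall => /existsP[i0 ne].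
rewrite [RHS](bigD1 i0) //= /A' (negPf ne) mul0r.
apply/eqP/negPn/negP => /prodf_neq0 nz; case/eqP: ne; apply: (eqk (fun i => weight l (f (s i)))).
  by move=> i; apply: vk; rewrite mcoeff_msupp; apply: nz.
by rewrite -sumE [RHS](reindex_inj (@perm_inj _ s)).
Qed.

End Adapted.

Section Destabilizing.
Variables (C : numClosedFieldType) (n d : nat).
Implicit Types (F : {mpoly C[n]}) (l k : 'I_n -> int).

Lemma sum_mnm_homog F m : F \is d.+1.-homog -> m \in msupp F -> \sum_j (m j)%:Z = d.+1%:Z.
Proof.
move=> hF /(dhomog_mf hF) /=; rewrite mdegE => <-.
by apply/esym; apply: (big_morph Posz) => // a b; rewrite PoszD.
Qed.

(** The weights d l - k, shifted by the average of k to have sum 0 when l has, and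
    multiplied by n to clear the denominator. *)
Definition corrected_weight l k (i : 'I_n) : int :=
  n%:Z * (d%:Z * l i - k i) + \sum_j k j.

Lemma sum_corrected_weight l k : \sum_j l j = 0 -> \sum_i corrected_weight l k i = 0.
Proof.
move=> l0; rewrite big_split /= -mulr_sumr sumrB -mulr_sumr l0 mulr0 sub0r.
by rewrite sumr_const card_ord -mulr_natl natz; ring.
Qed.

(** Averaging the inequalities l(m) >= k i + l i over the variables of the
    monomial m turns the weight of the gradient into a weight of the form itself. *)
Lemma corrected_weight_ge F l k : F \is d.+1.-homog ->
  (forall m i, m \in msupp F -> m i != 0%N -> k i + l i <= weight l m) ->
  forall m, m \in msupp F -> d.+1%:Z * \sum_j k j <= weight (corrected_weight l k) m.
Proof.
move=> hF hk m mF; have sm := sum_mnm_homog hF mF.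
have h : \sum_i (m i)%:Z * (k i + l i) <= \sum_i (m i)%:Z * weight l m.
  apply: ler_sum => i _; have [->|mi] := eqVneq (m i) 0%N; first by rewrite !mul0r.
  by rewrite ler_wpM2l // hk.
rewrite -mulr_suml sm in h.
have e : weight (corrected_weight l k) m =
    n%:Z * (d.+1%:Z * weight l m - \sum_i (m i)%:Z * (k i + l i)) + d.+1%:Z * \sum_j k j.
  rewrite -{2}sm mulr_suml /weight mulr_sumr -sumrB mulr_sumr -big_split /=.
  by apply: eq_bigr => i _; rewrite /corrected_weight -addn1 PoszD; ring.
by rewrite e lerDr mulr_ge0 // subr_ge0.
Qed.

Lemma det_lower_unipotent (p : 'M[C]_n) : (forall i j : 'I_n, (i < j)%N -> p i j = 0) ->
  (forall i, p i i = 1) -> \det p = 1.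
Proof.
move=> p0 p1; rewrite det_trig; first by rewrite big1.
by apply/is_trig_mxP => i j ij; apply: p0.
Qed.

(** The sum of the orders k is the weight of a nonzero minor of the gradient, so
    that it is positive, and it bounds the corrected weights on F from below. *)
Lemma destabilize_form F l :
  (forall i j : 'I_n, (i <= j)%N -> l i <= l j) -> F \is d.+1.-homog ->
  independent_partials F ->
  \sum_j l j = 0 ->
  (forall a, minor (fun i => F^`M(i)) a != 0 -> 0 < \sum_j weight l (a j)) ->
  exists (p : 'M[C]_n) (l' : 'I_n -> int), [/\ \det p = 1, \sum_j l' j = 0 &
    forall m, m \in msupp (lsubst p F) -> 0 < weight l' m].
Proof.
move=> lm hF indep l0 pos.
have [p [k [p0 p1 pk [a /pos apos ak]]]] := adapted_coordinates lm hF indep.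
exists p, (corrected_weight l k); split; first exact: det_lower_unipotent.
  exact: sum_corrected_weight.
move=> m mF; apply: lt_le_trans (corrected_weight_ge (lsubst_homog _ hF) pk mF).
by rewrite mulr_gt0 // -ak.
Qed.

(** Stability forces the corrected weights to vanish, so that k = d l. Every variable
    x_j of a monomial m of F then satisfies (d + 1) l_j <= l(m); as the average of
    these inequalities over m is an equality, the l_j are all equal. *)
Lemma split_form F l :
  (forall i j : 'I_n, (i <= j)%N -> l i <= l j) -> F \is d.+1.-homog ->
  independent_partials F ->
  \sum_j l j = 0 -> (0 < n)%N -> F != 0 ->
  (forall a, minor (fun i => F^`M(i)) a != 0 -> 0 <= \sum_j weight l (a j)) ->
  weight_stable F ->
  exists p : 'M[C]_n, [/\ forall i j : 'I_n, (i < j)%N -> p i j = 0, forall i, p i i = 1 &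
    block_form l (lsubst p F)].
Proof.
move=> lm hF indep l0 n0 F0 pos stab.
have [p [k [p0 p1 pk [a /pos apos ak]]]] := adapted_coordinates lm hF indep.
have detp := det_lower_unipotent p0 p1.
exists p; split=> // m i j mF.
have k0 : 0 <= \sum_j k j by rewrite -ak.
have hpF := lsubst_homog p hF.
have nu0 : forall j, corrected_weight l k j = 0.
  apply: (stab p) => //; first exact: sum_corrected_weight.
  move=> m' m'F; apply: le_trans (corrected_weight_ge hpF pk m'F).
  by rewrite mulr_ge0.
have sk : \sum_j k j = 0.
  apply/eqP; rewrite eq_le k0 andbT.
  have := corrected_weight_ge hpF pk mF.
  by rewrite /weight [leRHS]big1 => [|x _]; rewrite ?nu0 ?mulr0 // pmulr_rle0.
have kE x : k x + l x = d.+1%:Z * l x.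
  have /eqP := nu0 x; rewrite /corrected_weight sk addr0 mulf_eq0 gt_eqF //= subr_eq0.
  by move=> /eqP <-; rewrite -addn1 PoszD; ring.
have lw x : m x != 0%N -> d.+1%:Z * l x = weight l m.
  move=> mx; have := sum_mnm_homog hpF mF => sm.
  have : \sum_x (m x)%:Z * (weight l m - d.+1%:Z * l x) == 0.
    under eq_bigr do rewrite mulrBr; rewrite sumrB -mulr_suml sm.
    under [X in _ - X]eq_bigr do rewrite mulrCA; by rewrite -mulr_sumr subrr.
  rewrite psumr_eq0 => [/allP/(_ x)|y _].
    rewrite mem_index_enum => /(_ isT); rewrite mulf_eq0 eqz_nat (negPf mx) /= subr_eq0.
    by move=> /eqP.
  have [->|my] := eqVneq (m y) 0%N; first by rewrite mul0r.
  by rewrite mulr_ge0 // subr_ge0 -kE pk.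
by move=> /lw iE /lw jE; apply: (@mulfI _ d.+1%:Z) => //; rewrite iE jE.
Qed.

End Destabilizing.

(** * Generic points of orbit closures and of stabilizers *)

Section GenericMatrix.
Variables (C : numClosedFieldType) (n : nat).
Local Notation M := 'M[C]_n.

(** The index set of the ultrapower, kept apart from the matrices and their own
    canonical structures. *)
Definition pointed_mx : Type := M.
HB.instance Definition _ := gen_eqMixin pointed_mx.
HB.instance Definition _ := gen_choiceMixin pointed_mx.
HB.instance Definition _ := isPointed.Build pointed_mx (0 : M).
Local Notation B := (pointed_mx -> C)%type.

Let ev (h : pointed_mx) (u : B) : C := u h.
Let ev_zmod h : zmod_morphism (ev h). Proof. by []. Qed.
Let ev_monoid h : monoid_morphism (ev h). Proof. by []. Qed.
Let evr h : {rmorphism B -> C} :=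
  HB.pack (ev h) (GRing.isZmodMorphism.Build B C (ev h) (ev_zmod h))
    (GRing.isMonoidMorphism.Build B C (ev h) (ev_monoid h)).

Let cstB (c : C) : B := fun=> c.
Let cstB_zmod : zmod_morphism cstB. Proof. by []. Qed.
Let cstB_monoid : monoid_morphism cstB. Proof. by []. Qed.
Let cstr : {rmorphism C -> B} :=
  HB.pack cstB (GRing.isZmodMorphism.Build C B cstB cstB_zmod)
    (GRing.isMonoidMorphism.Build C B cstB cstB_monoid).

(** The class of the identity function is a matrix over the ultrapower, with all the
    polynomial properties that hold on a set of the filter. *)
Lemma generic_matrix (F : set_system pointed_mx) : ProperFilter F ->
  F (fun h => \det (h : M) = 1) ->
  exists (K : fieldType) (p : {rmorphism B -> K}) (i : {rmorphism C -> K}) (g : 'M[K]_n),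
    [/\ \det g = 1, forall c, i c = p (fun=> c), forall a b, g a b = p (fun h => (h : M) a b),
        forall k (v : 'I_k -> {mpoly C[n]}) a,
          minor (fun b => lsubst g (map_mpoly i (v b))) a =
          p (fun h => minor (fun b => lsubst (h : M) (v b)) a) &
        (forall u, F (fun h => u h = 0) -> p u = 0) /\
        (forall u, F (fun h => u h != 0) -> p u != 0)].
Proof.
move=> FF F1; have [K [p pF]] := ultrapower_exists C FF.
pose gB : 'M[B]_n := \matrix_(a, b) (fun h => (h : M) a b).
have evg h : map_mx (evr h) gB = h by apply/matrixP => a b; rewrite !mxE.
have evE (u v : B) : (forall h, evr h u = evr h v) -> u = v.
  by move=> uv; apply/funext => h; apply: uv.
exists K, p, (p \o cstr : {rmorphism C -> K}), (map_mx p gB); split.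
- apply/eqP; rewrite -subr_eq0 det_map_mx -(rmorph1 p) -rmorphB; apply/eqP/pF.
  apply: filterS F1 => h /= h1.
  by rewrite -[LHS]/(evr h (\det gB - 1)) rmorphB rmorph1 -det_map_mx evg h1 subrr.
- by [].
- by move=> a b; rewrite !mxE.
- move=> k v a; transitivity (p (minor (fun b => lsubst gB (map_mpoly cstr (v b))) a)).
    rewrite map_minor; apply: eq_minor => b; rewrite map_lsubst; congr lsubst.
    by apply/mpolyP => m; rewrite !mcoeff_map_mpoly.
  congr (p _); apply: evE => h; rewrite map_minor; apply: eq_minor => b.
  rewrite map_lsubst evg; congr lsubst.
  by apply/mpolyP => m; rewrite !mcoeff_map_mpoly.
split=> // u uF; apply/negP => /eqP pu.
have : p (u * (fun h => (u h)^-1) - 1) = 0.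
  apply: pF; apply: filterS uF => h uh.
  by rewrite -[LHS]/(u h * (u h)^-1 - 1) mulfV // subrr.
by rewrite rmorphB rmorphM rmorph1 pu mul0r sub0r => /eqP; rewrite oppr_eq0 oner_eq0.
Qed.

End GenericMatrix.

Section ExteriorMinors.
Variables (C : numClosedFieldType) (n d k : nat).
Local Notation form := (dhomog n.+1 C d).
Implicit Types (y : ext k form) (a : 'I_k -> 'X_{1..n.+1}).

(** The linear function on the exterior power that takes a wedge product to its
    coefficient minor. *)
Definition ext_minor y a : C := \sum_(s : ext_index k form)
  \det (\matrix_(b, c) (val ((vbasis {:form})`_(val s b)))@_(a c)) * y s.

Lemma ext_minor_wedge (v : 'I_k -> form) a :
  ext_minor (wedge v) a = minor (fun b => val (v b)) a.
Proof.
have lin c : scalar (fun x : form => (val x)@_(a c)).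
  by move=> e x z; rewrite !linearP.
exact: esym (det_wedge v lin).
Qed.

Lemma ext_minor_is_linear a : linear (fun y => ext_minor y a : C^o).
Proof.
move=> c x z; rewrite /ext_minor scaler_sumr -big_split; apply: eq_bigr => s _ /=.
by rewrite !ffunE mulrDr; congr (_ + _); rewrite [LHS]mulrCA.
Qed.
Definition ext_minor_linear a : {linear ext k form -> C^o} :=
  HB.pack (fun y => ext_minor y a : C^o) (GRing.isLinear.Build C (ext k form) C^o _
    (fun y => ext_minor y a : C^o) (ext_minor_is_linear a)).

Let coordf (j : 'I_(\dim {:form})) (m : 'X_{1..n.+1 < d.+1}) : C :=
  coord (vbasis {:form}) j (indhomog d 'X_[m]).

Let coordfE (x : form) j :
  coord (vbasis {:form}) j x = \sum_(m : 'X_{1..n.+1 < d.+1}) (val x)@_m * coordf j m.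
Proof.
have hx := dhomog_is_dhomog x.
have {1}-> : x = \sum_(m : 'X_{1..n.+1 < d.+1}) (val x)@_m *: indhomog d 'X_[m].
  apply: val_inj; rewrite raddf_sum /= {1}(mpolywE (homog_msize_le hx)).
  apply: eq_bigr => m _.
  have [->|xm] := eqVneq (mpoly_of_dhomog x)@_m 0; first by rewrite !scale0r.
  rewrite -[mpoly_of_dhomog (indhomog _ _)]/(val (indhomog d 'X_[m])) insubdK //.
  by rewrite unfold_in dhomogX /= (dhomog_mf hx) // mcoeff_msupp.
by rewrite linear_sum; apply: eq_bigr => m _; rewrite linearZ.
Qed.

Lemma wedge_ext_minor (v : 'I_k -> form) s : wedge v s =
  \sum_(f : {ffun 'I_k -> 'X_{1..n.+1 < d.+1}})
    (\prod_b coordf (val s b) (f b)) * ext_minor (wedge v) (fun b => f b).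
Proof.
rewrite ffunE; under [RHS]eq_bigr do rewrite ext_minor_wedge.
rewrite -(det_sum_expand (fun b (m : 'X_{1..n.+1 < d.+1}) => (val (v b))@_m)
  (fun m b => coordf (val s b) m)).
by congr (\det _); apply/matrixP => b c; rewrite !mxE coordfE.
Qed.

(** On wedge products the coordinates are fixed linear combinations of the coefficient
    minors, and such a relation passes to the closure. *)
Lemma ext_minor_inj (S : ext k form -> Prop) y (v : 'I_k -> form) :
  (forall x, S x -> exists v, x = wedge v) -> zariski_closure S y ->
  (forall a, ext_minor y a = ext_minor (wedge v) a) -> y = wedge v.
Proof.
move=> SW Sy h; apply/ffunP => s; rewrite wedge_ext_minor.
under eq_bigr do rewrite -h.
pose L (x : ext k form) : C := x s - \sum_(f : {ffun 'I_k -> 'X_{1..n.+1 < d.+1}})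
    (\prod_b coordf (val s b) (f b)) * ext_minor x (fun b => f b).
have [P hP] : polynomial_function L.
  pose ev (x : ext k form) : C^o := x s.
  have evl : linear ev by move=> c x z; rewrite /ev !ffunE.
  pose evL : {linear ext k form -> C^o} :=
    HB.pack ev (GRing.isLinear.Build C (ext k form) C^o _ ev evl).
  have [P hP] := polyfun_linear evL.
  have [Q hQ] := polyfun_sum (index_enum {ffun 'I_k -> 'X_{1..n.+1 < d.+1}})
    (fun f => polyfunM (polyfun_const (ext k form) (\prod_b coordf (val s b) (f b)))
     (polyfun_linear (ext_minor_linear (fun b => f b)))).
  by exists (P - Q) => x; rewrite mevalB -hP -hQ.
have : L y = 0.
  rewrite hP; apply: Sy => x /SW[u ->]; rewrite -hP /L.
  by rewrite -wedge_ext_minor subrr.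
by move/eqP; rewrite subr_eq0 => /eqP.
Qed.

End ExteriorMinors.

Section GenericPoints.
Variables (C : numClosedFieldType) (n d k : nat).
Local Notation form := (dhomog n.+1 C d).
Local Notation act := (ext_act (k := k) (@form_act C n.+1 d)).
Implicit Types (f : 'I_k -> form).

(** The conditions P (g w) <> 0, for the polynomials P not vanishing at y, generate
    a filter on SL(n + 1). For a generic matrix g the assignment of P y to P (g w) is
    then well defined, and it extends to a place, at which the residue of g w is y. *)
Lemma closure_generic_point f y : zariski_closure (SL_orbit act (wedge f)) y ->
  exists (K : fieldType) (i : {rmorphism C -> K}) (p : place i) (g : 'M[K]_n.+1),
    \det g = 1 /\ forall a, exists2 z : vring p,
      minor (fun b => lsubst g (map_mpoly i (val (f b)))) a = vval p z &
      vres p z = ext_minor y a.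
Proof.
move=> cly; pose W := ext k form.
pose val_at (P : {mpoly C[\dim {:W}]}) (x : W) := P.@[fun j => coord (vbasis {:W}) j x].
pose F : set_system (pointed_mx C n.+1) := fun A => exists2 P, val_at P y != 0 &
  forall h : 'M[C]_n.+1, \det h = 1 -> val_at P (act h (wedge f)) != 0 -> A h.
have FF : ProperFilter F.
  apply: Build_ProperFilter => [[P Py hP]|].
    case/eqP: Py; apply: cly => _ [h h1 ->]; apply/eqP/negPn/negP => /(hP h h1).
    by [].
  split.
  - by exists 1; rewrite // /val_at meval1 oner_neq0.
  - move=> A A' [P Py hP] [P' Py' hP']; exists (P * P').
      by rewrite /val_at mevalM mulf_neq0.
    by move=> h h1; rewrite /val_at mevalM mulf_eq0 negb_or => /andP[/hP H /hP' H']; split; auto.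
  - by move=> A A' AA' [P Py hP]; exists P => // h h1 /(hP h h1)/AA'.
have F1 : F (fun h => \det (h : 'M[C]_n.+1) = 1).
  by exists 1; rewrite // /val_at meval1 oner_neq0.
have [K [pi [i [g [g1 iE gE minE [pi0 piN0]]]]]] := generic_matrix FF F1.
pose orb (P : {mpoly C[\dim {:W}]}) : pointed_mx C n.+1 -> C :=
  fun h => val_at P (act (h : 'M[C]_n.+1) (wedge f)).
pose S : set (K * C) := fun z => exists P, z = (pi (orb P), val_at P y).
have [|p pS] := @place_extension C K i S.
  split.
  - move=> c; exists c%:MP; rewrite /orb /val_at !mevalC iE; congr (pi _, _).
    by apply/funext => h; rewrite mevalC.
  - move=> _ _ [P ->] [P' ->]; exists (P - P'); rewrite /= -rmorphB; congr (pi _, _).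
      by apply/funext => h; rewrite /orb /val_at mevalB.
    by rewrite /val_at mevalB.
  - move=> _ _ [P ->] [P' ->]; exists (P * P'); rewrite /= -rmorphM; congr (pi _, _).
      by apply/funext => h; rewrite /orb /val_at mevalM.
    by rewrite /val_at mevalM.
  - move=> [P [P0 P1]]; have := piN0 (orb P); rewrite -P0 eqxx => /(_ _)/notF; apply.
    by exists P; rewrite // -P1 oner_neq0.
exists K, i, p, g; split=> // a.
have [P hP] := polyfun_linear (@ext_minor_linear C n d k a).
have [|z [zv zr]] := pS (pi (orb P)) (val_at P y); first by exists P.
exists z; last by rewrite zr [RHS]hP.
rewrite minE zv; congr (pi _); apply/funext => h.
rewrite -[RHS]hP /= ext_act_wedge ext_minor_wedge.
by apply: eq_minor.
Qed.

Lemma infinite_entry (S : 'M[C]_n.+1 -> Prop) :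
  ~ (exists s : seq 'M[C]_n.+1, forall h, S h -> h \in s) ->
  exists a b, forall s : seq C, exists2 h, S h & h a b \notin s.
Proof.
move=> inf; apply: contrapT => no; apply: inf.
have /choice[s hs] : forall ab : 'I_n.+1 * 'I_n.+1, exists s : seq C,
    forall h, S h -> h ab.1 ab.2 \in s.
  move=> [a b]; apply: contrapT => no'; apply: no; exists a, b => s.
  by apply: contrapT => no2; apply: no'; exists s => h Sh; apply: contrapT => /negP h';
    apply: no2; exists h.
pose L := flatten [seq s ab | ab <- enum [the finType of ('I_n.+1 * 'I_n.+1)%type]].
exists [seq \matrix_(a, b) L`_(phi (a, b)) | phi : {ffun 'I_n.+1 * 'I_n.+1 -> 'I_(size L)}].
move=> h Sh; have hL a b : h a b \in L.
  apply/flattenP; exists (s (a, b)); last exact: (hs (a, b)).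
  by apply: map_f; rewrite mem_enum.
have idx a b : (index (h a b) L < size L)%N by rewrite index_mem.
apply/mapP; exists [ffun ab => Ordinal (idx ab.1 ab.2)]; first by rewrite mem_enum.
by apply/matrixP => a b; rewrite mxE ffunE /= nth_index.
Qed.

(** Some entry of the matrices in an infinite stabilizer takes infinitely many values.
    In a generic element of the stabilizer this entry is transcendental over C, so
    that some place sends its inverse to 0. *)
Lemma stabilizer_generic_point f : ~ finite_stabilizer act (wedge f) ->
  exists (K : fieldType) (i : {rmorphism C -> K}) (p : place i) (g : 'M[K]_n.+1),
    [/\ \det g = 1,
      forall a, minor (fun b => lsubst g (map_mpoly i (val (f b)))) a =
        i (minor (fun b => val (f b)) a)
      & exists a b, ~ integral p (g a b)].
Proof.
move=> inf.
have [|a [b ab]] := @infinite_entry (fun h => \det h = 1 /\ act h (wedge f) = wedge f).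
  by move=> [s hs]; apply: inf; exists s => h h1 h2; apply: hs.
pose F : set_system (pointed_mx C n.+1) := fun A => exists s : seq C,
  forall h : 'M[C]_n.+1, \det h = 1 -> act h (wedge f) = wedge f -> h a b \notin s -> A h.
have FF : ProperFilter F.
  apply: Build_ProperFilter => [[s hs]|].
    by have [h [h1 h2] hab] := ab s; apply: (hs h).
  split.
  - by exists [::].
  - move=> A A' [s hs] [s' hs']; exists (s ++ s') => h h1 h2.
    by rewrite mem_cat negb_or => /andP[h3 h4]; split; auto.
  - by move=> A A' AA' [s hs]; exists s => h h1 h2 /(hs h h1 h2)/AA'.
have F1 : F (fun h => \det (h : 'M[C]_n.+1) = 1) by exists [::].
have [K [pi [i [g [g1 iE gE minE [pi0 piN0]]]]]] := generic_matrix FF F1.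
have gab c : g a b != i c.
  rewrite gE iE -subr_eq0 -rmorphB; apply: piN0; exists [:: c] => h _ _.
  by rewrite inE -subr_eq0.
have x0 : g a b != 0 by rewrite -(rmorph0 i).
have [|p pS] := @place_extension C K i (fun z => exists P : {poly C},
    z = ((map_poly i P).[(g a b)^-1], P.[0])).
  split.
  - by move=> c; exists c%:P; rewrite map_polyC !hornerC.
  - by move=> _ _ [P ->] [P' ->]; exists (P - P'); rewrite /= rmorphB !hornerE.
  - by move=> _ _ [P ->] [P' ->]; exists (P * P'); rewrite /= rmorphM !hornerE.
  - move=> [P [P0 P1]]; have [r Pr] := closed_field_poly_normal P.
    move: P0; rewrite Pr map_polyZ hornerZ rmorph_prod horner_prod /= => /esym/eqP.
    rewrite mulf_eq0 fmorph_eq0 lead_coef_eq0 => /orP[/eqP P0|].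
      by move/eqP: P1; rewrite P0 horner0 oner_eq0.
    rewrite prodf_seq_eq0 => /hasP[c _]; rewrite /= rmorphB /= map_polyX map_polyC.
    rewrite hornerXsubC subr_eq0 => /eqP xc.
    by case/eqP: (gab c^-1); rewrite fmorphV -xc invrK.
exists K, i, p, g; split=> //.
  move=> e; rewrite minE iE; apply/eqP; rewrite -subr_eq0 -rmorphB; apply/eqP/pi0.
  exists [::] => h _ hw _; apply/eqP; rewrite subr_eq0; apply/eqP.
  rewrite -(ext_minor_wedge f) -hw ext_act_wedge ext_minor_wedge.
  exact: eq_minor.
exists a, b; rewrite -[g a b]invrK; apply: small_inv_integral; first by rewrite invr_eq0.
have [|z [zv zr]] := pS (g a b)^-1 0; first by exists 'X; rewrite map_polyX !hornerX.
by exists z.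
Qed.

End GenericPoints.

(** * The gradient along a place *)

Section AlongPlace.
Variables (C : numClosedFieldType) (K : fieldType) (i : {rmorphism C -> K}) (p : place i).
Variables (n d : nat).
Local Notation V := (vring p).
Local Notation vmx := (map_mx (vval p)).
Local Notation rmx := (map_mx (vres p)).

Lemma map_vcst_val (q : {mpoly C[n.+1]}) : map_mpoly i q = map_mpoly (vval p) (map_mpoly (vcst p) q).
Proof. by apply/mpolyP => m; rewrite !mcoeff_map_mpoly /= vvalC. Qed.

Lemma map_vcst_res (q : {mpoly C[n.+1]}) : map_mpoly (vres p) (map_mpoly (vcst p) q) = q.
Proof. by apply/mpolyP => m; rewrite !mcoeff_map_mpoly /= vresC. Qed.

Lemma vmx_vcst (g : 'M[C]_n.+1) : vmx (map_mx (vcst p) g) = map_mx i g.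
Proof. by apply/matrixP => a b; rewrite !mxE vvalC. Qed.

Lemma rmx_vcst (g : 'M[C]_n.+1) : rmx (map_mx (vcst p) g) = g.
Proof. by apply/matrixP => a b; rewrite !mxE vresC. Qed.

Lemma map_mpoly_homog (R S : comNzRingType) (f : {rmorphism R -> S}) e (q : {mpoly R[n.+1]}) :
  q \is e.-homog -> map_mpoly f q \is e.-homog.
Proof.
move=> hq; apply/dhomogP => m; rewrite mcoeff_msupp mcoeff_map_mpoly => fm.
apply: (dhomog_mf hq); rewrite mcoeff_msupp; apply: contra fm => /eqP ->.
by rewrite raddf0.
Qed.

(** The predicate P stands for integrality or for smallness. *)
Lemma minor_lsubst_integral (P : K -> Prop) (k : 'M[V]_n.+1) (v : 'I_n.+1 -> {mpoly K[n.+1]}) :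
  P 0 -> (forall x y, P x -> P y -> P (x + y)) -> (forall x y, integral p x -> P y -> P (x * y)) ->
  (forall b, v b \is d.-homog) -> (forall a, P (minor v a)) ->
  forall a, P (minor (fun b => lsubst (vmx k) (v b)) a).
Proof.
move=> P0 PD PM hv vP a; rewrite (minor_lsubst _ _ hv).
elim/big_ind: _ => // f _; apply: PM => //; apply: integral_prod => c _.
by rewrite -(map_mpolyX (vval p)) -map_lsubst mcoeff_map_mpoly; apply: integral_val.
Qed.

Lemma minor_const_lsubst (k : 'M[V]_n.+1) (v : 'I_n.+1 -> {mpoly C[n.+1]}) a :
  exists2 z : V, minor (fun b => lsubst (vmx k) (map_mpoly i (v b))) a = vval p z &
    vres p z = minor (fun b => lsubst (rmx k) (v b)) a.
Proof.
exists (minor (fun b => lsubst k (map_mpoly (vcst p) (v b))) a); rewrite map_minor;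
  apply: eq_minor => b; rewrite map_lsubst ?map_vcst_res //.
by rewrite map_vcst_val.
Qed.

Definition exponent_sum (a : 'I_n.+1 -> 'X_{1..n.+1}) : 'rV[int]_n.+1 :=
  \row_j \sum_c (a c j)%:Z.

Lemma laurent_monomial_exponent_sum (t : 'rV[K]_n.+1) (a : 'I_n.+1 -> 'X_{1..n.+1}) : (forall j, t 0 j != 0) ->
  \prod_c \prod_j t 0 j ^+ a c j = laurent_monomial (t 0) (exponent_sum a).
Proof.
move=> t0; rewrite exchange_big; apply: eq_bigr => j _; rewrite mxE.
apply/esym; rewrite (big_morph (fun k : int => t 0 j ^ k) (id1 := 1) (op1 := *%R)) //.
by move=> x y; rewrite expfzDr.
Qed.

Lemma dot_exponent_sum (l : 'I_n.+1 -> int) a :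
  \sum_j exponent_sum a 0 j * l j = \sum_c weight l (a c).
Proof.
rewrite exchange_big; apply: eq_bigr => j _; rewrite mxE mulr_suml.
by apply: eq_bigr => c _.
Qed.

Lemma minor_neq0_mdeg (R : comNzRingType) (v : 'I_n.+1 -> {mpoly R[n.+1]}) a c :
  (forall b, v b \is d.-homog) -> minor v a != 0 -> mdeg (a c) = d.
Proof.
move=> hv; apply: contraNeq => ac; rewrite /minor (expand_det_col _ c) big1 // => b _.
by rewrite mxE (dhomog_nemf_coeff (hv b)) // mul0r.
Qed.

(** Finitely many monomials in t matter here: the quotients of two entries, and those
    by which t scales the minors of n + 1 forms of degree d. *)
Lemma place_weights (t : 'rV[K]_n.+1) : (forall j, t 0 j != 0) -> \prod_j t 0 j = 1 ->
  exists l : 'I_n.+1 -> int, [/\ \sum_j l j = 0,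
    forall a b, integral p (t 0 a / t 0 b) -> l b <= l a,
    forall a b, l b <= l a -> integral p (t 0 a / t 0 b),
    forall a : 'I_n.+1 -> 'X_{1..n.+1}, (forall c, mdeg (a c) = d) ->
      integral p (laurent_monomial (t 0) (exponent_sum a)) -> 0 <= \sum_c weight l (a c) &
    forall a : 'I_n.+1 -> 'X_{1..n.+1}, (forall c, mdeg (a c) = d) ->
      small p (laurent_monomial (t 0) (exponent_sum a)) -> 0 < \sum_c weight l (a c)].
Proof.
move=> t0 t1.
pose one : 'rV[int]_n.+1 := const_mx 1.
pose diff (a b : 'I_n.+1) : 'rV[int]_n.+1 := delta_mx 0 a - delta_mx 0 b.
pose mons := [seq exponent_sum (fun c => f c) |
  f : {ffun 'I_n.+1 -> 'X_{1..n.+1 < d.+1}}].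
pose diffs := [seq diff ab.1 ab.2 | ab : 'I_n.+1 * 'I_n.+1].
have [l lP] := sign_pattern p t0 (one :: - one :: diffs ++ mons).
have tone : laurent_monomial (t 0) one = 1.
  by rewrite -[RHS]t1; apply: eq_bigr => j _; rewrite mxE expr1z.
have tdelta a : laurent_monomial (t 0) (delta_mx 0 a) = t 0 a.
  rewrite /laurent_monomial (bigD1 a) //= mxE !eqxx big1 ?mulr1 ?expr1z // => j /negPf ja.
  by rewrite mxE ja.
have tdiff a b : laurent_monomial (t 0) (diff a b) = t 0 a / t 0 b.
  by rewrite /diff laurent_monomialD // laurent_monomialN // !tdelta.
have ldelta a : \sum_j (delta_mx 0 a : 'rV[int]_n.+1) 0 j * l j = l a.
  rewrite (bigD1 a) //= mxE !eqxx mul1r big1 ?addr0 // => j /negPf ja.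
  by rewrite mxE ja mul0r.
have ldiff a b : \sum_j diff a b 0 j * l j = l a - l b.
  rewrite -[in RHS]ldelta -[X in _ = _ - X]ldelta -sumrB; apply: eq_bigr => j _.
  by rewrite -mulrBl [diff a b]lock !mxE -lock !mxE.
have indiffs a b : diff a b \in one :: - one :: diffs ++ mons.
  rewrite !inE mem_cat; apply/orP; right; apply/orP; right; apply/orP; left.
  by apply/mapP; exists (a, b); rewrite ?mem_enum.
have inmons (a : 'I_n.+1 -> 'X_{1..n.+1}) : (forall c, mdeg (a c) = d) ->
    exponent_sum a \in one :: - one :: diffs ++ mons.
  move=> ad; have ad' c : (mdeg (a c) < d.+1)%N by rewrite ad.
  rewrite !inE mem_cat; apply/orP; right; apply/orP; right; apply/orP; right.
  apply/mapP; exists [ffun c => BMultinom (ad' c)]; rewrite ?mem_enum //.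
  by apply/rowP => j; rewrite !mxE; apply: eq_bigr => c _; rewrite ffunE.
exists l; split.
- have s1 : \sum_j one 0 j * l j = \sum_j l j.
    by apply: eq_bigr => j _; rewrite mxE mul1r.
  apply/eqP; rewrite eq_le; apply/andP; split.
    have [|h _] := lP (- one); first by rewrite !inE eqxx orbT.
    have := h; rewrite laurent_monomialN // tone invr1 => /(_ (integral1 p)).
    by rewrite -s1 -oppr_le0 -sumrN; under eq_bigr do rewrite mxE mulNr opprK.
  have [|h _] := lP one; first by rewrite inE eqxx.
  by have := h; rewrite tone s1 => /(_ (integral1 p)).
- by move=> a b; rewrite -tdiff => /(lP _ (indiffs a b)).1; rewrite ldiff subr_ge0.
- move=> a b lba; have [//|sm] := integral_or_small p (t 0 a / t 0 b).
  move: sm; rewrite invf_div -tdiff => /(lP _ (indiffs b a)).2.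
  by rewrite ldiff subr_gt0 ltNge lba.
- by move=> a ad /(lP _ (inmons a ad)).1; rewrite dot_exponent_sum.
- by move=> a ad /(lP _ (inmons a ad)).2; rewrite dot_exponent_sum.
Qed.

Lemma diag_inv (t : 'rV[K]_n.+1) : (forall j, t 0 j != 0) ->
  diag_mx t *m diag_mx (\row_j (t 0 j)^-1) = 1%:M.
Proof.
move=> t0; rewrite mulmx_diag; apply/matrixP => a b; rewrite !mxE mulfV //.
Qed.

Lemma minor_gradient (R : comNzRingType) (h : 'M[R]_n.+1) (F : {mpoly R[n.+1]}) a :
  minor (fun b => (lsubst h F)^`M(b)) a = \det h * minor (fun b => lsubst h (F^`M(b))) a.
Proof.
by rewrite -minor_lincomb; apply: eq_minor => b; rewrite mderiv_lsubst.
Qed.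

Lemma gradient_indep (h : 'M[C]_n.+1) (F : {mpoly C[n.+1]}) : \det h = 1 ->
  independent_partials F ->
  independent_partials (lsubst h F).
Proof.
move=> h1 indep c c0.
have [Vh hV] := mulmx_inv_SL h1.
pose r := \row_j c j *m h.
have r0 j : r 0 j = 0.
  apply: indep; rewrite -[LHS]lsubst1 -Vh -lsubst_comp.
  suff -> : lsubst h (\sum_j r 0 j *: F^`M(j)) = 0 by rewrite linear0.
  rewrite -[RHS]c0 (linear_sum (lsubst h)).
  under [RHS]eq_bigr do rewrite mderiv_lsubst scaler_sumr.
  rewrite exchange_big; apply: eq_bigr => k _; rewrite linearZ /r mxE /= scaler_suml.
  by apply: eq_bigr => m _; rewrite mxE scalerA.
move=> j; have : (\row_j c j) 0 j = 0; last by rewrite mxE.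
have -> : \row_j c j = r *m invmx h by rewrite /r -mulmxA hV mulmx1.
by rewrite mxE big1 // => k _; rewrite r0 mul0r.
Qed.

Section Gradient.
Variables (F : {mpoly C[n.+1]}) (g : 'M[K]_n.+1).
Hypothesis F_homog : F \is d.+1.-homog.
Hypothesis F_indep : independent_partials F.
Hypothesis g1 : \det g = 1.
Local Notation gminor := (minor (fun b => lsubst g (map_mpoly i F^`M(b)))).

Let grad_homog b : F^`M(b) \is d.-homog. Proof. exact: mderiv_homog. Qed.

(** A Cartan decomposition g = k1 t k2 bounds the weights, with respect to the
    valuations of t, of the gradient of F in the coordinates given by the residue
    of k2: undoing k1 preserves P, and a minor of nonzero residue is a unit. *)
Lemma cartan_gradient (P : K -> Prop) :
  P 0 -> (forall x y, P x -> P y -> P (x + y)) -> (forall x y, integral p x -> P y -> P (x * y)) ->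
  (forall a, P (gminor a)) ->
  exists (k1 k2 : 'M[V]_n.+1) (t : 'rV[K]_n.+1),
    [/\ [/\ \det k1 = 1, \det k2 = 1, forall a, t 0 a != 0 & \prod_j t 0 j = 1],
        forall a b : 'I_n.+1, (a <= b)%N -> integral p (t 0 b / t 0 a),
        g = vmx k1 *m diag_mx t *m vmx k2 &
        forall a, minor (fun b => (lsubst (rmx k2) F)^`M(b)) a != 0 ->
          P (laurent_monomial (t 0) (exponent_sum a))].
Proof.
move=> P0 PD PM gP.
have [k1 [k2 [t [d1 d2 t0 ts gE]]]] : exists (k1 k2 : 'M[V]_n.+1) (t : 'rV[K]_n.+1),
    [/\ \det k1 = 1, \det k2 = 1, forall a, t 0 a != 0,
        forall a b : 'I_n.+1, (a <= b)%N -> integral p (t 0 b / t 0 a)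
      & g = vmx k1 *m diag_mx t *m vmx k2].
  by apply: cartan; rewrite g1 oner_neq0.
exists k1, k2, t; split=> //.
  split=> //; move: g1; rewrite gE !det_mulmx !det_map_mx d1 d2 !rmorph1 mul1r mulr1.
  by rewrite det_diag.
move=> a; rewrite minor_gradient det_map_mx d2 rmorph1 mul1r.
have [z zE <-] := minor_const_lsubst k2 (fun b => F^`M(b)) a => /vres_unit[z' zz'].
have : P (minor (fun b => lsubst (vmx (\adj k1)) (lsubst g (map_mpoly i F^`M(b)))) a).
  apply: minor_lsubst_integral => // b; apply/lsubst_homog/map_mpoly_homog.
  exact: grad_homog.
rewrite (_ : minor _ _ = minor (fun b => lsubst (diag_mx t) (lsubst (vmx k2) (map_mpoly i F^`M(b)))) a).
  rewrite minor_diag laurent_monomial_exponent_sum // zE => /(PM _ _ (integral_val z')).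
  by rewrite mulrCA -rmorphM [z' * z]mulrC zz' rmorph1 mulr1.
apply: eq_minor => b; rewrite !lsubst_comp gE !mulmxA -map_mxM mul_adj_mx d1.
by rewrite map_scalar_mx rmorph1 mul1mx.
Qed.

(** The valuations of the torus part t of g destabilize the gradient of F, hence F. *)
Lemma gradient_unstable_place : (forall a, small p (gminor a)) ->
  exists (h : 'M[C]_n.+1) (l : 'I_n.+1 -> int), [/\ \det h = 1, \sum_j l j = 0 &
    forall m, m \in msupp (lsubst h F) -> 0 < weight l m].
Proof.
move=> gsmall.
have [|||k1 [k2 [t [[d1 d2 t0 t1] ts _ pos]]]] := cartan_gradient (P := small p) _ _ _ gsmall.
- by exists 0; rewrite rmorph0.
- by move=> x y [a -> a0] [b -> b0]; exists (a + b); rewrite rmorphD // a0 b0 addr0.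
- by move=> x y xi ys; rewrite mulrC; apply: smallM.
have [l [l0 lm _ _ lpos]] := place_weights t0 t1.
have h1 : \det (rmx k2) = 1 by rewrite det_map_mx d2 rmorph1.
have [|||a am|q [l' [q1 l'0 l'pos]]] :=
    @destabilize_form _ _ d (lsubst (rmx k2) F) l _ _ _ l0.
- by move=> a b /ts/lm.
- exact: lsubst_homog.
- exact: gradient_indep.
- apply: lpos; last exact: pos.
  by move=> c; apply: minor_neq0_mdeg am => b; apply/mderiv_homog/lsubst_homog.
exists (q *m rmx k2), l'; split; [by rewrite det_mulmx q1 h1 mulr1 | exact: l'0 |].
by move=> m; rewrite -lsubst_comp; apply: l'pos.
Qed.

(** Stability makes F split along the weights (split_form). The unipotent change of
    coordinates exhibiting the splitting is absorbed into k2, and its inverse passes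
    through t into k1. *)
Lemma gradient_split_place :
  weight_stable F ->
  F != 0 -> (forall a, integral p (gminor a)) ->
  exists (k1 k2 : 'M[V]_n.+1) (t : 'rV[K]_n.+1) (l : 'I_n.+1 -> int),
    [/\ [/\ \det k1 = 1, \det k2 = 1, forall a, t 0 a != 0 & \prod_j t 0 j = 1],
        g = vmx k1 *m diag_mx t *m vmx k2,
        \sum_j l j = 0 /\ forall a b : 'I_n.+1, (a <= b)%N -> l a <= l b,
        forall a b, l b <= l a -> integral p (t 0 a / t 0 b) &
        block_form l (lsubst (rmx k2) F)].
Proof.
move=> stab F0 gint.
have [||k1 [k2 [t [[d1 d2 t0 t1] ts gE pos]]]] :=
    cartan_gradient (P := integral p) (integral0 p) _ _ gint.
- by move=> x y; apply: integralD.
- by move=> x y; apply: integralM.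
have [l [l0 lm lint lpos _]] := place_weights t0 t1.
have h1 : \det (rmx k2) = 1 by rewrite det_map_mx d2 rmorph1.
have [Vh hV] := mulmx_inv_SL h1.
have lmono (a b : 'I_n.+1) : (a <= b)%N -> l a <= l b by move=> /ts/lm.
have [||||a am|h l' hh1 l'0 l'pos|q [q0 q1 qF]] :=
    @split_form _ _ d (lsubst (rmx k2) F) l lmono _ _ l0.
- exact: lsubst_homog.
- exact: gradient_indep.
- by [].
- by apply: contra F0 => /eqP e; rewrite -[F]lsubst1 -Vh -lsubst_comp e linear0.
- apply: lpos; last exact: pos.
  by move=> c; apply: minor_neq0_mdeg am => b; apply/mderiv_homog/lsubst_homog.
- apply: (stab (h *m rmx k2) l'); [by rewrite det_mulmx hh1 h1 mulr1 | exact: l'0 |].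
  by move=> m; rewrite -lsubst_comp; apply: l'pos.
have qdet := det_lower_unipotent q0 q1.
have [Q QE] : exists Q : 'M[V]_n.+1,
    diag_mx t *m map_mx i q *m diag_mx (\row_j (t 0 j)^-1) = vmx Q.
  apply: integral_mx => a b; rewrite mul_mx_diag mul_diag_mx !mxE mulrAC.
  have [ab|ab] := ltnP a b; first by rewrite q0 // rmorph0 mulr0; apply: integral0.
  by apply: integralM; [apply: ts | apply: integral_cst].
have Qt : vmx Q *m diag_mx t = diag_mx t *m map_mx i q.
  by rewrite -QE -mulmxA (mulmx1C (diag_inv t0)) mulmx1.
have Qdet : \det Q = 1.
  apply: (@vval_inj _ _ _ p); rewrite rmorph1 -det_map_mx -QE !det_mulmx det_map_mx qdet rmorph1.
  by rewrite mulr1 -det_mulmx diag_inv // det1.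
exists (k1 *m \adj Q), (map_mx (vcst p) q *m k2), t, l; split.
- split; [| by rewrite det_mulmx d2 mulr1 det_map_mx qdet rmorph1 | exact: t0 | exact: t1].
  rewrite det_mulmx d1 mul1r; have := congr1 determinant (mul_adj_mx Q).
  by rewrite det_mulmx Qdet mulr1 det1.
- rewrite gE !map_mxM vmx_vcst -!mulmxA; congr (_ *m _); rewrite !mulmxA; congr (_ *m _).
  rewrite -mulmxA -Qt mulmxA -map_mxM mul_adj_mx Qdet.
  by rewrite map_scalar_mx rmorph1 mul1mx.
- by split.
- exact: lint.
- by move=> m a b; rewrite map_mxM rmx_vcst -lsubst_comp; apply: qF.
Qed.

End Gradient.
End AlongPlace.

(** * Unipotent limits *)

Section BlockLU.
Variables (C K : fieldType) (i : {rmorphism C -> K}) (p : place i).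
Local Notation V := (vring p).

(** Gaussian elimination, with pivots that are units because k reduces to the
    identity; P lies in a parabolic subgroup and U in the opposite unipotent radical. *)
Lemma block_lu n (l : 'I_n -> int) (k : 'M[V]_n) :
  (forall a b : 'I_n, (a <= b)%N -> l a <= l b) -> map_mx (vres p) k = 1%:M ->
  exists P U : 'M[V]_n, [/\ k = P *m U, \det U = 1,
    forall a b, l a < l b -> P a b = 0 & forall a b, l b <= l a -> U a b = (a == b)%:R].
Proof.
elim: n l k => [|n IH] l k lm k1.
  by exists 1%:M, 1%:M; split; [rewrite mulmx1; apply/matrixP; case | rewrite det1 | case | case].
have res_k a b : vres p (k a b) = (a == b)%:R by move/matrixP/(_ a b): k1; rewrite !mxE.
pose a0 := k 0 0.
have [u a0u] : exists u, a0 * u = 1.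
  by apply: vres_unit; rewrite res_k eqxx oner_neq0.
pose b := @ursubmx _ 1 n 1 n k; pose c := @dlsubmx _ 1 n 1 n k; pose D := @drsubmx _ 1 n 1 n k.
pose D' := D - u *: (c *m b).
pose l' (j : 'I_n) := l (rshift 1 j).
have [||P' [U' [D'E U'1 P'0 U'0]]] := IH l' D'.
- by move=> x y xy; apply: lm; rewrite leq_add2l.
- apply/matrixP => x y; rewrite !mxE big_ord1 !mxE rmorphB !rmorphM /= !res_k.
  rewrite -!val_eqE /= !(mulr0, mul0r) subr0.
  by rewrite eqn_add2l.
pose be : 'rV[V]_n := \row_j (if l (rshift 1 j) <= l 0 then b 0 j else 0).
have beU j : l (rshift 1 j) <= l 0 -> (be *m U') 0 j = b 0 j.
  move=> lj; rewrite mxE (bigD1 j) //= U'0 // eqxx mulr1 big1 ?addr0 => [|x xj].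
    by rewrite mxE lj.
  rewrite U'0 ?(negPf xj) ?mulr0 // /l'; apply: le_trans lj _; exact: lm.
exists (block_mx a0%:M be c (u *: (c *m be) + P')).
exists (block_mx 1%:M (u *: (b - be *m U')) 0 U').
split.
- rewrite (@mulmx_block _ 1 n 1 n 1 n) !mulmx1 !mulmx0 !addr0 -[LHS](@submxK _ 1 n 1 n).
  congr (@block_mx _ 1 n 1 n _ _ _ _).
  + by apply/matrixP => x y; rewrite !ord1 !mxE eqxx mulr1n; congr (k _ _); apply: val_inj.
  + by rewrite mul_scalar_mx scalerA a0u scale1r subrK.
  + rewrite mulmxDl -D'E /D' -scalemxAr -scalemxAl mulmxBr scalerBr mulmxA.
    by rewrite addrA subrK addrC subrK.
- by rewrite (@det_ublock _ 1 n) det1 mul1r.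
- move=> x y; rewrite mxE; case: splitP => x' xE; rewrite mxE; case: splitP => y' yE.
  + by rewrite (_ : x = y) ?ltxx //; apply: ord_inj; rewrite xE yE !ord1.
  + have -> : x = 0 by apply: ord_inj; rewrite xE ord1.
    have -> : y = rshift 1 y' by apply: ord_inj; rewrite yE.
    by rewrite mxE => /lt_geF ->.
  + have -> : y = 0 by apply: ord_inj; rewrite yE ord1.
    by move=> h; have := lm 0 x (leq0n x); rewrite leNgt h.
  + have -> : x = rshift 1 x' by apply: ord_inj; rewrite xE.
    have -> : y = rshift 1 y' by apply: ord_inj; rewrite yE.
    move=> xy; rewrite !mxE P'0 // addr0 big_ord1 !mxE.
    rewrite (_ : l (rshift 1 y') <= l 0 = false) ?mulr0 //; apply/negbTE.
    by rewrite -ltNge; apply: le_lt_trans xy; apply: lm.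
- move=> x y; rewrite mxE; case: splitP => x' xE; rewrite mxE; case: splitP => y' yE.
  + by rewrite mxE !ord1 (_ : x = y) ?eqxx //; apply: ord_inj; rewrite xE yE !ord1.
  + have -> : x = 0 by apply: ord_inj; rewrite xE ord1.
    have -> : y = rshift 1 y' by apply: ord_inj; rewrite yE.
    move=> h; rewrite [x']ord1 mxE [X in _ * X]mxE [X in _ + X]mxE beU // subrr mulr0.
    by rewrite -val_eqE.
  + by rewrite mxE -val_eqE /= xE yE ord1.
  + have -> : x = rshift 1 x' by apply: ord_inj; rewrite xE.
    have -> : y = rshift 1 y' by apply: ord_inj; rewrite yE.
    by move=> h; rewrite U'0 // -!val_eqE /= eqn_add2l.
Qed.

End BlockLU.

Lemma eq_lsubst (R : comNzRingType) n (g h : 'M[R]_n) (r : {mpoly R[n]}) :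
  (forall m b, m \in msupp r -> m b != 0%N -> forall a, g a b = h a b) ->
  lsubst g r = lsubst h r.
Proof.
move=> gh; apply: eq_comp => m b mr mb; rewrite !tnth_mktuple.
by apply: eq_bigr => a _; rewrite (gh m b).
Qed.

Definition pure n (l : 'I_n -> int) (L : int) (m : 'X_{1..n}) : Prop :=
  forall a, m a != 0%N -> l a = L.

Section BlockTriangular.
Variables (K : fieldType) (n : nat) (l : 'I_n -> int) (q : 'M[K]_n).
Hypothesis q_tri : forall a b, l b <= l a -> q a b = (a == b)%:R.

(** Modulo the variables of weight different from L, the matrix q fixes those of
    weight at most L. *)
Lemma mcoeff_lsubst_pure (L0 L : int) (r : {mpoly K[n]}) c : L0 <= L ->
  (forall m, m \in msupp r -> pure l L0 m) -> pure l L c -> (lsubst q r)@_c = r@_c.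
Proof.
move=> L0L rL cL; pose D := diag_mx (\row_a (l a == L)%:R : 'rV[K]_n).
have proj s : (lsubst D s)@_c = s@_c.
  rewrite mcoeff_lsubst_diag big1 ?mul1r // => a _; rewrite mxE.
  by have [->|/cL ->] := eqVneq (c a) 0%N; rewrite ?expr0 // eqxx expr1n.
rewrite -proj -[RHS]proj lsubst_comp; congr (_@_c); apply: eq_lsubst => m b /rL/[apply] lb a.
rewrite mul_diag_mx !mxE; case: eqP => [la|_]; last by rewrite mul0r mul0rn.
by rewrite mul1r q_tri // lb la.
Qed.

Lemma mcoeff_lsubst_first_order (L0 L : int) (r : {mpoly K[n]}) c e : L0 <= L ->
  (forall m, m \in msupp r -> pure l L0 m) -> pure l L c -> l e < L ->
  (lsubst q r)@_(c + U_(e)) = \sum_k q e k * (r^`M(k))@_c.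
Proof.
move=> L0L rL cL eL.
have ce : c e = 0%N by apply/eqP/negPn/negP => /cL le; rewrite le ltxx in eL.
have := mcoeff_mderiv e (lsubst q r) c; rewrite ce mulr1n => <-.
rewrite mderiv_lsubst raddf_sum /=; apply: eq_bigr => k _; rewrite mcoeffZ; congr (_ * _).
apply: (mcoeff_lsubst_pure L0L) => // m; rewrite mcoeff_msupp mcoeff_mderiv => nz.
have /rL h : (m + U_(k))%MM \in msupp r.
  by rewrite mcoeff_msupp; apply: contraNneq nz => ->; rewrite mul0rn.
move=> a ma; apply: h.
by rewrite mnmDE addn_eq0 negb_and ma.
Qed.

End BlockTriangular.

(** Block diagonal matrices are those commuting with the diagonal matrix of weights. *)
Lemma block_inverse (C : numClosedFieldType) n (l : 'I_n -> int) (M : 'M[C]_n) :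
  M \in unitmx -> (forall a b, M a b != 0 -> l a = l b) ->
  forall a b, invmx M a b != 0 -> l a = l b.
Proof.
move=> Mu Ml a b; pose D : 'M[C]_n := diag_mx (\row_c (l c)%:~R).
have comm : D *m M = M *m D.
  apply/matrixP => x y; rewrite mul_diag_mx mul_mx_diag !mxE.
  by have [->|/Ml ->] := eqVneq (M x y) 0; rewrite ?mulr0 ?mul0r // mulrC.
have : invmx M *m D = D *m invmx M.
  by rewrite -[LHS]mulmx1 -(mulmxV Mu) mulmxA -[invmx M *m D *m M]mulmxA comm mulmxA mulVmx // mul1mx.
move=> /matrixP/(_ a b); rewrite mul_diag_mx mul_mx_diag !mxE mulrC => /eqP e.
apply: contraNeq => ab; move: e; rewrite -subr_eq0 -mulrBl mulf_eq0 subr_eq0 => /orP[|//].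
by move=> /eqP/intr_inj e; rewrite e eqxx in ab.
Qed.

Section UnipotentIntegral.
Variables (C : numClosedFieldType) (K : fieldType) (i : {rmorphism C -> K}) (p : place i).
Variables (n d : nat) (l : 'I_n.+1 -> int) (F : {mpoly C[n.+1]}) (q : 'M[K]_n.+1).
Hypothesis d_gt1 : (1 < d)%N.
Hypothesis F_homog : F \is d.+1.-homog.
Hypothesis F_indep : independent_partials F.
Hypothesis F_block : block_form l F.
Hypothesis q_tri : forall a b, l b <= l a -> q a b = (a == b)%:R.

Let grad_homog b : F^`M(b) \is d.-homog. Proof. exact: mderiv_homog. Qed.

Let grad_pure b m : m \in msupp F^`M(b) -> pure l (l b) m.
Proof.
rewrite mcoeff_msupp mcoeff_mderiv mulrn_eq0 negb_or -mcoeff_msupp => /andP[_ mF] a ma.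
by apply: (F_block mF); rewrite mnmDE ?mnm1E ?eqxx ?addn1 // addn_eq0 negb_and ma.
Qed.

(** A permutation contributing to a nonzero minor of the gradient assigns to each j
    a monomial of the derivative along x_j, which is in the variables of weight l j. *)
Let pivots : exists a : 'I_n.+1 -> 'X_{1..n.+1},
  [/\ forall j, mdeg (a j) = d, forall j, pure l (l j) (a j) & minor (fun b => F^`M(b)) a != 0].
Proof.
have [f f0] : exists f : 'I_n.+1 -> 'X_{1..n.+1 < d.+1},
    \det (\matrix_(b, j) (F^`M(b))@_(f j)) != 0.
  apply: (exists_minor (A := fun b (m : 'X_{1..n.+1 < d.+1}) => (F^`M(b))@_m)) => c hc.
  apply: F_indep; apply/mpolyP => m; rewrite mcoeff0 raddf_sum /=.
  under eq_bigr do rewrite mcoeffZ.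
  have [md|md] := boolP (mdeg m < d.+1)%N; first exact: (hc (BMultinom md)).
  rewrite big1 // => j _; rewrite (dhomog_nemf_coeff (grad_homog j)) ?mulr0 //=.
  by apply: contraNneq md => ->.
have /existsP[s hs] : [exists s : 'S_n.+1, \prod_b (F^`M(b))@_(f (s b)) != 0].
  rewrite -negb_forall; apply: contraNN f0 => /forallP h; apply/eqP/big1 => s _.
  by under eq_bigr do rewrite mxE; rewrite (eqP (h s)) mulr0.
move/prodf_neq0: hs => hs.
exists (fun j => f (s j)); split.
- by move=> j; apply: (dhomog_mf (grad_homog j)); rewrite mcoeff_msupp hs.
- by move=> j; apply: grad_pure; rewrite mcoeff_msupp hs.
- have -> : minor (fun b => F^`M(b)) (fun j => f (s j)) =
      \det (col_perm s (\matrix_(b, j) (F^`M(b))@_(f j))).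
    by congr (\det _); apply/matrixP => x y; rewrite !mxE.
  by rewrite col_permE det_mulmx mulf_neq0 // det_perm signr_eq0.
Qed.

(** The first order terms of the action of q on the gradient are, up to the pivots,
    among its minors; they determine the entries of q through the second derivatives
    of F. *)
Lemma unipotent_integral :
  (forall a, integral p (minor (fun b => lsubst q (map_mpoly i F^`M(b))) a)) ->
  forall a b, integral p (q a b).
Proof.
move=> qint e b.
have [lbe|leb] := leP (l b) (l e).
  by rewrite q_tri //; case: eqP => _; [apply: integral1 | apply: integral0].
have [a [ad apure a0]] := pivots.
pose V0 := \matrix_(x, y) (F^`M(x))@_(a y).
have V0u : V0 \in unitmx by rewrite unitmxE unitfE.
have mdeg_var (c : 'X_{1..n.+1}) : c != 0%MM -> exists x, c x != 0%N :> nat.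
  move=> c0; apply: contrapT => no; case/eqP: c0; apply/mnmP => x; rewrite mnm0E.
  by apply/eqP/negPn/negP => cx; apply: no; exists x.
have V0l x y : V0 x y != 0 -> l x = l y.
  rewrite mxE -mcoeff_msupp => /grad_pure h.
  have [|z az] := mdeg_var (a y).
    by rewrite -mdeg_eq0 ad -lt0n (ltn_trans _ d_gt1).
  by rewrite -(h z az) (apure y z az).
pose W0 := invmx V0.
have W0l := block_inverse V0u V0l.
have VW x z : \sum_y V0 x y * W0 y z = (x == z)%:R.
  by have /matrixP/(_ x z) := mulmxV V0u; rewrite [LHS]mxE [RHS]mxE.
pose f' x := \sum_y W0 x y *: F^`M(y).
have f'pure x m : m \in msupp (f' x) -> pure l (l x) m.
  move=> mf'; have [y yx my] : exists2 y, W0 x y != 0 & m \in msupp F^`M(y).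
    apply: contrapT => no; move: mf'; rewrite mcoeff_msupp /f' raddf_sum /= big1 ?eqxx // => y _.
    rewrite mcoeffZ; have [->|yx] := eqVneq (W0 x y) 0; first by rewrite mul0r.
    rewrite memN_msupp_eq0 ?mulr0 //; apply/negP => my; by apply: no; exists y.
  by rewrite (W0l x y yx); apply: grad_pure.
have f'a x y : (f' x)@_(a y) = (x == y)%:R.
  have /matrixP/(_ x y) := mulVmx V0u; rewrite !mxE => <-.
  by rewrite raddf_sum /=; apply: eq_bigr => z _; rewrite mcoeffZ mxE.
have f'E x : F^`M(x) = \sum_y V0 x y *: f' y.
  rewrite /f'; under eq_bigr do rewrite scaler_sumr.
  rewrite exchange_big (bigD1 x) //= [X in _ + X]big1 => [|z zx].
    rewrite addr0; under eq_bigr do rewrite scalerA.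
    by rewrite -scaler_suml VW eqxx scale1r.
  under eq_bigr do rewrite scalerA.
  by rewrite -scaler_suml VW eq_sym (negPf zx) scale0r.
have mappure (r : {mpoly C[n.+1]}) L0 : (forall m, m \in msupp r -> pure l L0 m) ->
    forall m, m \in msupp (map_mpoly i r) -> pure l L0 m.
  move=> h m; rewrite mcoeff_msupp mcoeff_map_mpoly fmorph_eq0 -mcoeff_msupp; exact: h.
(* The minor in which the column of the pivot a j is replaced by the monomial
   c + U_(e): only the identity permutation contributes to its expansion. Not being
   constant, which requires d > 1, the monomial c detects its block. *)
have first j c : l j = l b -> pure l (l b) c -> c != 0%MM ->
    integral p (\sum_k q e k * i ((f' j)^`M(k))@_c).
  move=> jb cb c0; pose a' y := if y == j then (c + U_(e))%MM else a y.
  have qf' x y : l x <= l y -> (lsubst q (map_mpoly i (f' x)))@_(a y) = (x == y)%:R.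
    move=> xy; rewrite (mcoeff_lsubst_pure q_tri xy (mappure _ _ (@f'pure x)) (apure y)).
    by rewrite mcoeff_map_mpoly /= f'a rmorph_nat.
  have qfc x : l x <= l b -> (lsubst q (map_mpoly i (f' x)))@_(c + U_(e)) =
      \sum_k q e k * i ((f' x)^`M(k))@_c.
    move=> xb; rewrite (mcoeff_lsubst_first_order q_tri xb (mappure _ _ (@f'pure x)) cb leb).
    by apply: eq_bigr => k _; rewrite !mcoeff_mderiv mcoeff_map_mpoly /= rmorphMn.
  have qfc0 x : l x < l b -> (lsubst q (map_mpoly i (f' x)))@_(c + U_(e)) = 0.
    move=> xb; rewrite qfc ?ltW // big1 // => k _.
    rewrite mcoeff_mderiv (_ : (f' x)@_(c + U_(k)) = 0) ?mul0rn ?rmorph0 ?mulr0 //.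
    apply: memN_msupp_eq0; apply/negP => /f'pure h.
    have [y cy] := mdeg_var c c0.
    have := h y; rewrite mnmDE addn_eq0 negb_and cy => /(_ isT) lyx.
    by move: xb; rewrite -lyx (cb y cy) ltxx.
  have <- : minor (fun x => lsubst q (map_mpoly i (f' x))) a' =
      \sum_k q e k * i ((f' j)^`M(k))@_c.
    rewrite /minor /determinant (bigD1 1%g) //= odd_perm1 expr0 mul1r.
    rewrite [X in _ + X]big1 ?addr0.
      rewrite (bigD1 j) //= perm1 mxE /a' eqxx qfc ?jb // [X in _ * X]big1 ?mulr1 // => x xj.
      by rewrite perm1 mxE (negPf xj) qf' // eqxx.
    move=> s s1; apply/eqP; rewrite mulf_eq0 signr_eq0 /=; apply/negPn/negP.
    move=> /prodf_neq0 nz; case/eqP: s1.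
    have ls x : l (s x) <= l x.
      rewrite leNgt; apply/negP => lt; have := nz x isT; rewrite mxE /a'.
      case: (eqVneq (s x) j) => [sx|_]; first by rewrite qfc0 ?eqxx // -jb -sx.
      rewrite qf' ?ltW //; case: (eqVneq x (s x)) => [xs|]; last by rewrite eqxx.
      by rewrite -xs ltxx in lt.
    have lE x : l (s x) = l x.
      apply/eqP; rewrite eq_sym -subr_eq0.
      have : \sum_x (l x - l (s x)) == 0.
        by rewrite sumrB subr_eq0 {1}(reindex_inj (@perm_inj _ s)).
      rewrite psumr_eq0 => [/allP/(_ x)|y _]; last by rewrite subr_ge0.
      by rewrite mem_index_enum; apply.
    have fixs x : s x != j -> s x = x.
      move=> sxj; have := nz x isT; rewrite mxE /a' (negPf sxj) qf' ?lE //.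
      by case: (eqVneq x (s x)) => [<- //|]; rewrite eqxx.
    apply/permP => x; rewrite perm1.
    have [sx|/fixs //] := eqVneq (s x) j.
    have sj : s j = j by have [//|/fixs] := eqVneq (s j) j.
    have xj : x = j by apply: (@perm_inj _ s); rewrite sx sj.
    by rewrite xj.
  have -> : minor (fun x => lsubst q (map_mpoly i (f' x))) a' =
      minor (fun x => \sum_y (map_mx i W0) x y *: lsubst q (map_mpoly i F^`M(y))) a'.
    apply: eq_minor => x; rewrite /f' (raddf_sum (map_mpoly i)) (linear_sum (lsubst q)); apply: eq_bigr => y _.
    by rewrite /= map_mpolyZ linearZ mxE.
  by rewrite minor_lincomb; apply: integralM => //; rewrite det_map_mx; apply: integral_cst.
pose y j := \sum_k q e k * i (V0 k j).
have yint j : l j = l b -> integral p (y j).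
  move=> jb; have [|x ax] := mdeg_var (a j).
    by rewrite -mdeg_eq0 ad -lt0n (ltn_trans _ d_gt1).
  have Ux : (U_(x) <= a j)%MM by rewrite lep1mP.
  pose c := (a j - U_(x))%MM.
  have cpure : pure l (l b) c.
    move=> z cz; rewrite -jb; apply: apure; apply: contraNneq cz => az.
    by rewrite mnmBE az.
  have cd : mdeg c = d.-1.
    have := congr1 (@mdeg _) (submK Ux); rewrite mdegD mdeg1 ad addn1 => <-.
    by [].
  have c0 : c != 0%MM by rewrite -mdeg_eq0 cd; case: (d) d_gt1 => [|[]].
  have xb : l x = l b by rewrite -jb; apply: apure.
  have : integral p (\sum_k q e k * i ((F^`M(x))^`M(k))@_c).
    rewrite (_ : \sum_k _ = \sum_z i (V0 x z) * \sum_k q e k * i ((f' z)^`M(k))@_c).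
      apply: integral_sum => z _; have [->|/V0l xz] := eqVneq (V0 x z) 0.
        by rewrite rmorph0 mul0r; apply: integral0.
      by apply: integralM; [apply: integral_cst | apply: first; rewrite // -xz].
    under [RHS]eq_bigr do rewrite mulr_sumr.
    rewrite exchange_big; apply: eq_bigr => k _.
    have -> : ((F^`M(x))^`M(k))@_c = \sum_z V0 x z * ((f' z)^`M(k))@_c.
      rewrite [F^`M(x)]f'E (linear_sum (mderiv k)) (raddf_sum (mcoeff c)) /=.
      by apply: eq_bigr => z _; rewrite linearZ /= mcoeffZ.
    rewrite rmorph_sum mulr_sumr; apply: eq_bigr => z _.
    by rewrite rmorphM mulrCA.
  have acx : (c x).+1 = a j x by rewrite -addn1 -[a j in RHS](submK Ux) mnmDE mnm1E eqxx.
  have -> : \sum_k q e k * i ((F^`M(x))^`M(k))@_c = i (a j x)%:R * y j.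
    rewrite mulr_sumr; apply: eq_bigr => k _; rewrite mulrCA -rmorphM; congr (_ * i _).
    by rewrite mderiv_comm mcoeff_mderiv submK // acx mulr_natl mxE.
  move=> /(integralM (integral_cst p ((a j x)%:R^-1))).
  by rewrite mulrA -rmorphM mulVf ?rmorph1 ?mul1r // pnatr_eq0.
have -> : q e b = \sum_j y j * i (W0 j b).
  rewrite /y; under eq_bigr do rewrite mulr_suml.
  rewrite exchange_big (bigD1 b) //= [X in _ + X]big1 => [|z zb].
    under eq_bigr do rewrite -mulrA -rmorphM.
    by rewrite -mulr_sumr -rmorph_sum VW eqxx rmorph1 mulr1 addr0.
  under eq_bigr do rewrite -mulrA -rmorphM.
  by rewrite -mulr_sumr -rmorph_sum VW (negPf zb) rmorph0 mulr0.
apply: integral_sum => j _; have [->|/W0l jb] := eqVneq (W0 j b) 0.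
  by rewrite rmorph0 mulr0; apply: integral0.
by apply: integralM; [apply: yint | apply: integral_cst].
Qed.

End UnipotentIntegral.

(** * Closed orbits *)

Lemma lsubst_scale (R : comNzRingType) n d (c : R) (g : 'M[R]_n) (q : {mpoly R[n]}) :
  q \is d.-homog -> lsubst (c *: g) q = c ^+ d *: lsubst g q.
Proof.
move=> hq; rewrite -mul_scalar_mx -diag_const_mx -lsubst_comp.
apply/mpolyP => m; rewrite mcoeff_lsubst_diag mcoeffZ.
under eq_bigr do rewrite mxE; rewrite prodrXr -mdegE.
have [mq|mq] := boolP (m \in msupp (lsubst g q)).
  by rewrite (dhomog_mf (lsubst_homog g hq) mq).
by rewrite (memN_msupp_eq0 mq) !mulr0.
Qed.

Section GradientResidue.
Variables (C : numClosedFieldType) (K : fieldType) (i : {rmorphism C -> K}) (p : place i).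
Variables (n d : nat).
Local Notation V := (vring p).
Local Notation vmx := (map_mx (vval p)).
Local Notation rmx := (map_mx (vres p)).
Variables (F : {mpoly C[n.+1]}) (g : 'M[K]_n.+1).
Hypothesis d_gt1 : (1 < d)%N.
Hypothesis F_homog : F \is d.+1.-homog.
Hypothesis F_indep : independent_partials F.
Hypothesis F_stable : weight_stable F.
Hypothesis F_neq0 : F != 0.
Hypothesis g1 : \det g = 1.
Hypothesis g_integral : forall a, integral p (minor (fun b => lsubst g (map_mpoly i F^`M(b))) a).

Let grad_homog b : F^`M(b) \is d.-homog. Proof. exact: mderiv_homog. Qed.

Lemma conj_integral (t : 'rV[K]_n.+1) (A : 'M[V]_n.+1) : (forall j, t 0 j != 0) ->
  (forall a b, A a b != 0 -> integral p (t 0 a / t 0 b)) ->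
  exists2 Q : 'M[V]_n.+1, diag_mx t *m vmx A = vmx Q *m diag_mx t & \det Q = \det A.
Proof.
move=> t0 hA; have tV := diag_inv t0.
have [Q QE] : exists Q, diag_mx t *m vmx A *m diag_mx (\row_j (t 0 j)^-1) = vmx Q.
  apply: integral_mx => a b; rewrite mul_mx_diag mul_diag_mx !mxE mulrAC.
  have [->|/hA ab] := eqVneq (A a b) 0; first by rewrite rmorph0 mulr0; apply: integral0.
  by apply: integralM => //; apply: integral_val.
have tVdet : \det (diag_mx t) * \det (diag_mx (\row_j (t 0 j)^-1)) = 1.
  by rewrite -det_mulmx tV det1.
exists Q; first by rewrite -QE -mulmxA (mulmx1C tV) mulmx1.
apply: (@vval_inj _ _ _ p); rewrite -!det_map_mx -QE !det_mulmx mulrAC tVdet mul1r.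
by rewrite det_map_mx.
Qed.

Lemma gradient_lsubst_minor (X : 'M[K]_n.+1) (h : 'M[C]_n.+1) a : \det h = 1 ->
  minor (fun b => lsubst (X *m map_mx i h) (map_mpoly i F^`M(b))) a =
  minor (fun b => lsubst X (map_mpoly i (lsubst h F)^`M(b))) a.
Proof.
move=> h1; rewrite -[LHS]mul1r -(rmorph1 i) -h1 -det_map_mx -minor_lincomb.
apply: eq_minor => b; rewrite mderiv_lsubst (raddf_sum (map_mpoly i)) (linear_sum (lsubst X)).
by apply: eq_bigr => c _; rewrite /= map_mpolyZ [RHS]linearZ /= map_lsubst lsubst_comp mxE.
Qed.

(** The torus s stretches the blocks of F in the given coordinates by the
    valuations of t; it only rescales the gradient of F, so that it can be removed
    from g, after which g becomes integral. *)
Lemma gradient_residue : exists2 g0 : 'M[C]_n.+1, \det g0 = 1 &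
  forall a, exists2 z : V, minor (fun b => lsubst g (map_mpoly i F^`M(b))) a = vval p z &
    vres p z = minor (fun b => lsubst g0 F^`M(b)) a.
Proof.
have [k1 [k2 [t [l [[d1 d2 t0 t1] gE [l0 lm] lint Fblock]]]]] :=
  gradient_split_place F_homog F_indep g1 F_stable F_neq0 g_integral.
pose h := rmx k2; pose F' := lsubst h F.
have h1 : \det h = 1 by rewrite det_map_mx d2 rmorph1.
have [Vh hV] := mulmx_inv_SL h1.
have k2E : k2 = k2 *m map_mx (vcst p) (invmx h) *m map_mx (vcst p) h.
  by rewrite -mulmxA -map_mxM Vh map_mx1 mulmx1.
have [|P [U [PU U1 P0 U0]]] := @block_lu _ _ _ p _ l (k2 *m map_mx (vcst p) (invmx h)) lm.
  by rewrite map_mxM rmx_vcst.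
rewrite PU in k2E.
have Pdet : \det P = 1.
  have := congr1 determinant k2E; rewrite !det_mulmx U1 mulr1 det_map_mx h1 rmorph1 mulr1.
  by rewrite d2.
have Pint a b : P a b != 0 -> integral p (t 0 a / t 0 b).
  by move=> ab; apply: lint; rewrite leNgt; apply: contraNN ab => /P0 ->.
have [Q tP Qdet] := conj_integral t0 Pint.
rewrite Pdet in Qdet.
(* s is obtained from t by making it constant on each block; t and s differ by an
   invertible integral factor B. *)
pose rep a := odflt a [pick b | l b == l a].
have lrep a : l (rep a) = l a.
  by rewrite /rep; case: pickP => [b /eqP //|/(_ a)]; rewrite eqxx.
have rep_eq a b : l a = l b -> rep a = rep b.
  by move=> ab; rewrite /rep ab; case: pickP => // /(_ b); rewrite eqxx.
pose s : 'rV[K]_n.+1 := \row_a t 0 (rep a).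
have s0 a : s 0 a != 0 by rewrite mxE.
have sint a b : l b <= l a -> integral p (s 0 a / s 0 b).
  by move=> ab; rewrite !mxE; apply: lint; rewrite !lrep.
have [B BE] : exists B : 'M[V]_n.+1, diag_mx (\row_a (t 0 a / s 0 a)) = vmx B.
  apply: integral_mx => a b; rewrite !mxE; case: eqP => _; last exact: integral0.
  by rewrite mulr1n; apply: lint; rewrite lrep.
have [B' BE'] : exists B' : 'M[V]_n.+1, diag_mx (\row_a (s 0 a / t 0 a)) = vmx B'.
  apply: integral_mx => a b; rewrite !mxE; case: eqP => _; last exact: integral0.
  by rewrite mulr1n; apply: lint; rewrite lrep.
have vmx_inj m : injective (map_mx (vval p) : 'M[V]_m -> 'M[K]_m).
  by move=> X Y XY; apply/matrixP => a b; apply: (@vval_inj _ _ _ p);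
    move/matrixP/(_ a b): XY; rewrite !mxE.
have BB' : B' *m B = 1%:M.
  apply: vmx_inj; rewrite map_mxM -BE -BE' map_mx1 mulmx_diag.
  have st1 a : s 0 a / t 0 a * (t 0 a / s 0 a) = 1.
    by rewrite mulrA divfK // divff.
  by apply/matrixP => a b; have := st1 a; rewrite !mxE => ->.
have tbs : diag_mx t = vmx B *m diag_mx s.
  rewrite -BE mulmx_diag; congr diag_mx; apply/rowP => a; rewrite [RHS]mxE [X in X * _]mxE.
  by rewrite divfK.
pose sig := \det B'.
have sigE : vval p sig = \prod_a s 0 a.
  rewrite -det_map_mx -BE' det_diag (eq_bigr (fun a => s 0 a / t 0 a)); last by move=> a _; rewrite mxE.
  by rewrite big_split /= prodfV t1 invr1 mulr1.
pose q := diag_mx s *m vmx U *m diag_mx (\row_j (s 0 j)^-1).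
have qs : diag_mx s *m vmx U = q *m diag_mx s.
  by rewrite /q -[RHS]mulmxA (mulmx1C (diag_inv s0)) mulmx1.
have q_tri a b : l b <= l a -> q a b = (a == b)%:R.
  move=> ab; rewrite /q mul_mx_diag mul_diag_mx !mxE U0 // rmorph_nat.
  by case: eqP => [->|_]; rewrite ?mulr0 ?mul0r // mulr1 divff // mxE.
have q1 : \det q = 1.
  by rewrite /q !det_mulmx mulrAC -det_mulmx diag_inv // det1 mul1r det_map_mx U1 rmorph1.
clearbody q.
have gq : g = vmx (k1 *m Q *m B) *m q *m diag_mx s *m map_mx i h.
  rewrite gE k2E !map_mxM vmx_vcst !mulmxA; congr (_ *m _).
  rewrite -[X in X *m vmx U]mulmxA tP -(mulmxA _ q) -qs -!mulmxA.
  by do 2 congr (_ *m _); rewrite !mulmxA tbs.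
have F'h : F' \is d.+1.-homog by apply: lsubst_homog.
have sF' b : lsubst (diag_mx s) (map_mpoly i F'^`M(b)) = s 0 b ^+ d *: map_mpoly i F'^`M(b).
  apply/mpolyP => m; rewrite mcoeff_lsubst_diag mcoeffZ mcoeff_map_mpoly /=.
  have [mF|mF] := boolP (m \in msupp F'^`M(b)); last first.
    by rewrite (memN_msupp_eq0 mF) rmorph0 !mulr0.
  have dm : mdeg m = d := dhomog_mf (mderiv_homog b F'h) mF.
  congr (_ * _); rewrite -dm mdegE -prodrXr.
  apply: eq_bigr => a _; have [->|ma] := eqVneq (m a) 0%N; first by rewrite !expr0.
  congr (_ ^+ _); rewrite !mxE (rep_eq a b) //.
  move: mF; rewrite mcoeff_msupp mcoeff_mderiv mulrn_eq0 negb_or -mcoeff_msupp => /andP[_ mF].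
  by apply: (Fblock _ _ _ mF); rewrite mnmDE ?mnm1E ?eqxx ?addn1 // addn_eq0 negb_and ma.
have minor_s X a : minor (fun b => lsubst (X *m diag_mx s *m map_mx i h) (map_mpoly i F^`M(b))) a =
    vval p sig ^+ d * minor (fun b => lsubst X (map_mpoly i F'^`M(b))) a.
  rewrite gradient_lsubst_minor // sigE -prodrXl -minor_scale; apply: eq_minor => b.
  by rewrite -lsubst_comp sF' linearZ.
have sigdet : sig * \det B = 1 by rewrite -det_mulmx BB' det1.
have [Qm QmE] : exists Qm : 'M[V]_n.+1, q = vmx Qm.
  apply: integral_mx; apply: (unipotent_integral d_gt1 F'h _ Fblock q_tri).
    exact: gradient_indep.
  move=> a; have : integral p (minor (fun b => lsubst (vmx (B' *m \adj Q *m \adj k1))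
      (lsubst g (map_mpoly i F^`M(b)))) a).
    apply: minor_lsubst_integral => //; [exact: integral0 | exact: integralD | exact: integralM |].
    by move=> b; apply/lsubst_homog/map_mpoly_homog.
  have gq' : vmx (B' *m \adj Q *m \adj k1) *m g = q *m diag_mx s *m map_mx i h.
    rewrite gq !mulmxA -map_mxM -!mulmxA [\adj k1 *m _]mulmxA mul_adj_mx d1 mul1mx.
    by rewrite [\adj Q *m _]mulmxA mul_adj_mx Qdet mul1mx BB' map_mx1 mul1mx.
  have gqb b : lsubst (vmx (B' *m \adj Q *m \adj k1)) (lsubst g (map_mpoly i F^`M(b))) =
      lsubst (q *m diag_mx s *m map_mx i h) (map_mpoly i F^`M(b)) by rewrite lsubst_comp gq'.
  rewrite (eq_minor a gqb) minor_s => /(integralM (integral_val ((\det B) ^+ d))).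
  by rewrite mulrA rmorphXn -exprMn -rmorphM [\det B * sig]mulrC sigdet rmorph1 expr1n mul1r.
pose R := rmx (k1 *m Q *m B *m Qm).
have Rdet : \det R * vres p sig = 1.
  have -> : \det R = vres p (\det B).
    rewrite det_map_mx !det_mulmx d1 Qdet !mul1r.
    suff -> : \det Qm = 1 by rewrite mulr1.
    by apply: (@vval_inj _ _ _ p); rewrite -det_map_mx -QmE q1 rmorph1.
  by rewrite -rmorphM mulrC sigdet rmorph1.
(* The determinant of R is the inverse of the residue of sig; scaling by rho makes
   it 1 and accounts for the factor sig ^+ d of the minors. *)
pose rho := n.+1.-root (vres p sig).
have rhoE : rho ^+ n.+1 = vres p sig by rewrite rootCK.
exists (rho *: (R *m h)).
  by rewrite detZ rhoE det_mulmx h1 mulr1 mulrC.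
move=> a; rewrite gq QmE -map_mxM minor_s.
have [z -> zr] := minor_const_lsubst (k1 *m Q *m B *m Qm) (fun b => F'^`M(b)) a.
exists (sig ^+ d * z); first by rewrite rmorphM rmorphXn.
rewrite rmorphM rmorphXn /= zr -rhoE -exprM mulnC exprM.
transitivity (minor (fun b => rho ^+ d *: lsubst R F'^`M(b)) a).
  by rewrite minor_scale prodr_const card_ord.
transitivity (minor (fun b => \sum_c h b c *: (rho ^+ d *: lsubst (R *m h) F^`M(c))) a).
  apply: eq_minor => b; rewrite mderiv_lsubst (linear_sum (lsubst R)) scaler_sumr.
  by apply: eq_bigr => c _; rewrite linearZ /= lsubst_comp scalerA mulrC -scalerA.
rewrite minor_lincomb h1 mul1r; apply: eq_minor => b.
by rewrite (lsubst_scale _ _ (grad_homog b)).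
Qed.

End GradientResidue.

(** * Direct sum decompositions *)

Section Decomposition.
Variables (C : numClosedFieldType) (n d : nat).
Local Notation form := (dhomog n.+1 C).
Implicit Types (F : form d.+1) (h : 'M[C]_n.+1) (l : 'I_n.+1 -> int).

Lemma linear_form_homog (j : 'I_n.+1) : ('X_j : {mpoly C[n.+1]}) \is 1.-homog.
Proof. by rewrite dhomogX /= mdeg1. Qed.

Definition linear_form (j : 'I_n.+1) : form 1 := DHomog (linear_form_homog j).

Lemma linear_formE (x : form 1) : x = \sum_j (val x)@_(U_(j)) *: linear_form j.
Proof.
apply: val_inj; rewrite raddf_sum /=; apply/mpolyP => m.
rewrite raddf_sum /=; have [|m1] := boolP (mdeg m == 1%N).
  move=> /mdeg1P[j /eqP ->]; rewrite (bigD1 j) //= big1 => [|k kj].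
    by rewrite addr0 mcoeffZ mcoeffX eqxx mulr1.
  by rewrite mcoeffZ mcoeffX eq_mnm1 (negPf kj) mulr0.
rewrite (dhomog_nemf_coeff (dhomog_is_dhomog x) m1) big1 // => j _.
rewrite mcoeffZ mcoeffX; case: eqP => [e|]; last by rewrite mulr0.
by rewrite -e mdeg1 in m1.
Qed.

Lemma in_Sym_comp e (U : {vspace form 1}) (r : {mpoly C[n.+1]}) (L : 'I_n.+1 -> form 1) :
  r \is e.-homog -> (forall m j, m \in msupp r -> m j != 0%N -> L j \in U) ->
  in_Sym e U (r \mPo [tuple val (L j) | j < n.+1]).
Proof.
move=> hr LU.
exists (r \mPo [tuple \sum_(k < \dim U) coord (vbasis U) k (L j) *: 'X_k | j < n.+1]).
  apply: comp_homog => // j; rewrite tnth_mktuple; apply: rpred_sum => k _.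
  by apply: rpredZ; rewrite dhomogX /= mdeg1.
rewrite comp_comp; apply: eq_comp => m j mr mj; rewrite !tnth_mktuple.
rewrite {1}(coord_vbasis (LU m j mr mj)) !raddf_sum /=; apply: eq_bigr => k _.
rewrite comp_mpolyZ comp_mpolyXU; congr (_ *: _).
by rewrite (nth_map 0) ?size_tuple.
Qed.

Lemma lsubst_tuple h q : lsubst h q = q \mPo [tuple val (form_act h (linear_form j)) | j < n.+1].
Proof.
apply: eq_comp => m j _ _; rewrite !tnth_mktuple.
exact: esym (lsubstX h j).
Qed.

Lemma span_linear0 (V : vectType C) (f : {linear V -> C^o}) (X : seq V) v :
  (forall x, x \in X -> f x = 0) -> v \in <<X>>%VS -> f v = 0.
Proof.
move=> fX vX; rewrite (coord_span (X := in_tuple X) vX) linear_sum big1 // => k _.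
rewrite linearZ /= (_ : f _ = 0) ?scaler0 //; apply/fX/mem_nth.
exact: ltn_ord.
Qed.

(** U and W are spanned by the coordinates of weight l a0 and by the other ones. *)
Lemma block_decomposition F h l : \det h = 1 -> (exists a b, l a != l b) ->
  block_form l (lsubst h (val F)) ->
  exists U W : {vspace form 1}, nontrivial_decomposition U W /\
    exists A B : {mpoly C[n.+1]}, [/\ in_Sym d.+1 U A, in_Sym d.+1 W B & val F = A + B].
Proof.
move=> h1 [a0 [b0 lab]] block.
have [Vh hV] := mulmx_inv_SL h1.
pose L j := form_act (invmx h) (linear_form j).
have LK j : form_act h (L j) = linear_form j by rewrite form_act_comp hV form_act1.
pose S := [pred j | l j == l a0].
pose U := <<[seq L j | j <- enum S]>>%VS; pose W := <<[seq L j | j <- enum [predC S]]>>%VS.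
have LU j : S j -> L j \in U by move=> Sj; apply/memv_span/map_f; rewrite mem_enum.
have LW j : ~~ S j -> L j \in W by move=> Sj; apply/memv_span/map_f; rewrite mem_enum.
pose cf k : {linear form 1 -> C^o} := [the {linear form 1 -> C^o} of
  (mcoeff U_(k) : {linear {mpoly C[n.+1]} -> C^o}) \o (@mpoly_of_dhomog n.+1 C 1 \o form_act h)].
have cfL k j : cf k (L j) = (j == k)%:R.
  rewrite -[LHS]/((val (form_act h (L j)))@_(U_(k))) LK [LHS]mcoeffX.
  by rewrite eq_mnm1.
have cfU k v : ~~ S k -> v \in U -> cf k v = 0.
  move=> Sk; apply: span_linear0 => _ /mapP[j + ->]; rewrite mem_enum => Sj.
  rewrite cfL; case: eqP => // e; case/negP: Sk; rewrite -e; exact: Sj.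
have cfW k v : S k -> v \in W -> cf k v = 0.
  move=> Sk; apply: span_linear0 => _ /mapP[j + ->]; rewrite mem_enum => Sj.
  rewrite cfL; case: eqP => // e; case/negP: Sj; rewrite e; exact: Sk.
have L0 j : L j != 0.
  by apply/eqP => e; have := cfL j j; rewrite e linear0 eqxx => /esym/eqP; rewrite oner_eq0.
exists U, W; split.
  split.
  - apply/eqP; rewrite eqEsubv subvf /=; apply/subvP => x _.
    rewrite -[x]form_act1 -Vh -form_act_comp [form_act h x]linear_formE linear_sum.
    apply: memv_suml => j _; rewrite linearZ; apply: memvZ.
    have [Sj|Sj] := boolP (S j).
      by apply: subvP (addvSl _ _) _ _; apply: LU.
    by apply: subvP (addvSr _ _) _ _; apply: LW.
  - apply/eqP; rewrite -subv0; apply/subvP => x; rewrite memv_cap memv0 => /andP[xU xW].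
    rewrite -[x]form_act1 -Vh -form_act_comp.
    suff -> : form_act h x = 0 by rewrite linear0.
    rewrite [form_act h x]linear_formE big1 // => k _.
    have -> : (val (form_act h x))@_U_(k) = cf k x by [].
    have [Sk|Sk] := boolP (S k); first by rewrite cfW ?scale0r.
    by rewrite cfU ?scale0r.
  - move=> U0; have := LU a0 (eqxx _); rewrite U0 memv0; exact/negP/L0.
  - move=> W0; have : ~~ S b0 by rewrite /= eq_sym.
    by move=> /LW; rewrite W0 memv0; apply/negP/L0.
pose F' := lsubst h (val F).
have hF' : F' \is d.+1.-homog := lsubst_homog h (dhomog_is_dhomog F).
pose inS (m : 'X_{1..n.+1}) := [exists a, S a && (m a != 0%N)].
pose part (P : pred 'X_{1..n.+1}) := \sum_(m <- msupp F' | P m) F'@_m *: 'X_[m].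
have part_homog P : part P \is d.+1.-homog.
  rewrite /part big_seq_cond; apply: rpred_sum => m /andP[mF _]; apply: rpredZ.
  by rewrite dhomogX; apply/eqP/(dhomog_mf hF').
have part_supp P m : m \in msupp (part P) -> P m /\ m \in msupp F'.
  move=> mp; have : m \in [seq m <- msupp F' | P m]; last by rewrite mem_filter => /andP.
  apply: contraLR mp => mn; rewrite -mcoeff_eq0 /part raddf_sum /= -big_filter big_seq big1 ?eqxx //.
  move=> m' m'F; rewrite mcoeffZ mcoeffX; case: eqP => [e|]; last by rewrite mulr0.
  by rewrite -e m'F in mn.
have FE : val F = lsubst (invmx h) (part inS) + lsubst (invmx h) (part (predC inS)).
  have pE : part inS + part (predC inS) = F' by rewrite [RHS]mpolyE (bigID inS).
  by rewrite -(raddfD (lsubst (invmx h))) /= pE /F' lsubst_comp Vh lsubst1.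
exists (lsubst (invmx h) (part inS)), (lsubst (invmx h) (part (predC inS))); split=> //.
- rewrite lsubst_tuple; apply: in_Sym_comp => // m j /part_supp[/existsP[a /andP[Sa ma]] mF] mj.
  by apply: LU; rewrite /= (block m j a mF mj ma).
- rewrite lsubst_tuple; apply: in_Sym_comp => // m j /part_supp[/= /existsPn h' mF] mj.
  by apply: LW; have := h' j; rewrite mj andbT.
Qed.

Lemma form_act_block F l z b : z != 0 -> block_form l (val F) ->
  form_act (torus l z) (partial b F) = (z ^ l b) ^+ d *: partial b F.
Proof.
move=> z0 block; apply: val_inj; apply/mpolyP => m.
have -> : val ((z ^ l b) ^+ d *: partial b F) = (z ^ l b) ^+ d *: val (partial b F) by [].
rewrite [LHS]mcoeff_torus // mcoeffZ.
have [mF|mF] := boolP (m \in msupp (val (partial b F))); last first.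
  by rewrite (memN_msupp_eq0 mF) !mulr0.
congr (_ * _).
have dm : mdeg m = d := dhomog_mf (dhomog_is_dhomog (partial b F)) mF.
have wm : weight l m = d%:Z * l b.
  rewrite -dm mdegE (big_morph Posz PoszD (erefl _)) mulr_suml; apply: eq_bigr => a _.
  have [->|ma] := eqVneq (m a) 0%N; first by rewrite !mul0r.
  congr (_ * _); move: mF; rewrite mcoeff_msupp /= mcoeff_mderiv mulrn_eq0 negb_or.
  rewrite -mcoeff_msupp => /andP[_ mF].
  by apply: (block _ _ _ mF); rewrite mnmDE ?mnm1E ?eqxx ?addn1 // addn_eq0 negb_and ma.
by rewrite wm mulrC -exprz_exp exprnP.
Qed.

(** A torus scaling the blocks of F scales the partial derivatives, and fixes their
    wedge product when its determinant is 1. *)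
Lemma block_infinite_stabilizer F h l : h \in unitmx -> \sum_j l j = 0 -> (exists j, l j != 0) ->
  block_form l (lsubst (invmx h) (val F)) ->
  ~ finite_stabilizer (ext_act (@form_act C n.+1 d)) (wedge_gradient F).
Proof.
move=> hu l0 lj block; pose F' := form_act (invmx h) F.
have FE : F = form_act h F' by rewrite form_act_comp mulmxV // form_act1.
apply: (infinite_stabilizer (g := h) (h := invmx h) (l := l)) => //; first by rewrite mulVmx.
move=> z z0; rewrite FE wedge_gradient_act.
rewrite ext_act_scale; congr (_ *: _).
rewrite /wedge_gradient !ext_act_wedge.
transitivity (wedge (fun i => \sum_j (diag_mx (\row_i (z ^ l i) ^+ d) : 'M[C]_n.+1) i j *:
    form_act h (partial j F'))).
  apply: eq_wedge => i; rewrite form_act_comp -!mulmxA mulVmx // mulmx1 -form_act_comp.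
  rewrite form_act_block // linearZ (bigD1 i) //= big1 ?addr0 => [|j /negPf ji].
    by rewrite !mxE eqxx mulr1n.
  by rewrite !mxE eq_sym ji mulr0n scale0r.
rewrite wedge_lincomb det_diag (eq_bigr (fun j => (z ^ l j) ^+ d)); last by move=> j _; rewrite mxE.
by rewrite prodrXl prodr_exprz // l0 expr0z expr1n scale1r.
Qed.

Lemma dim_linear_forms : \dim {:form 1} = n.+1.
Proof. by rewrite dimvf /dim /= bin1. Qed.

(** In coordinates adapted to the decomposition, the weights dim W on U and - dim U
    on W have sum 0. *)
Lemma decomposition_block F (U W : {vspace form 1}) : nontrivial_decomposition U W ->
  (exists A B : {mpoly C[n.+1]}, [/\ in_Sym d.+1 U A, in_Sym d.+1 W B & val F = A + B]) ->
  exists h l, [/\ h \in unitmx, \sum_j l j = 0, exists j, l j != 0 &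
    block_form l (lsubst (invmx h) (val F))].
Proof.
move=> [UW UW0 U0 W0] [_ [_ [[qA qAh ->] [qB qBh ->] FE]]].
pose r := \dim U; pose s := \dim W.
have rs : (r + s = n.+1)%N by rewrite -dim_linear_forms -UW dimv_disjoint_sum.
have r0 : (0 < r)%N by rewrite lt0n dimv_eq0; apply/eqP.
have s0 : (0 < s)%N by rewrite lt0n dimv_eq0; apply/eqP.
pose X := vbasis U ++ vbasis W.
have Xfree : free X.
  have : basis_of (U + W) X by apply: cat_basis; rewrite ?vbasisP //; apply/directv_addP.
  exact: basis_free.
have Xsz : size X = n.+1 by rewrite size_cat !size_tuple.
pose h : 'M[C]_n.+1 := \matrix_(a, b) (val X`_b)@_(U_(a)).
have hX (b : 'I_n.+1) : lsubst h 'X_b = val X`_b.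
  rewrite lsubstX [in RHS](linear_formE X`_b) raddf_sum; apply: eq_bigr => a _.
  by rewrite mxE.
have hu : h \in unitmx.
  rewrite -unitmx_tr -row_free_unit; apply: inj_row_free => v vh.
  have e : \sum_(b < size X) v 0 (cast_ord Xsz b) *: X`_b = 0.
    apply: val_inj; rewrite raddf_sum.
    transitivity (lsubst h (\sum_b v 0 b *: 'X_b)).
      rewrite (linear_sum (lsubst h)) (reindex (cast_ord Xsz)) /=.
        by apply: eq_bigr => b _; rewrite [RHS]linearZ [LHS]linearZ /= hX.
      by exists (cast_ord (esym Xsz)) => b _; rewrite ?cast_ordK ?cast_ordKV.
    rewrite (linear_sum (lsubst h)).
    under eq_bigr do rewrite linearZ /= lsubstX scaler_sumr.
    rewrite exchange_big big1 // => a _.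
    under eq_bigr do rewrite scalerA.
    rewrite -scaler_suml (_ : \sum_b _ = 0) ?scale0r //.
    transitivity ((v *m h^T) 0 a); last by rewrite vh mxE.
    by rewrite [RHS]mxE; apply: eq_bigr => b _; rewrite [h^T b a]mxE.
  apply/rowP => b; rewrite mxE.
  move/freeP: (Xfree : free (in_tuple X)) => /(_ _ e (cast_ord (esym Xsz) b)).
  by rewrite cast_ordKV.
pose l (a : 'I_n.+1) : int := if (a < r)%N then s%:Z else - r%:Z.
exists h, l; split=> //.
- rewrite -(big_mkord xpredT (fun a => if (a < r)%N then s%:Z else - r%:Z)) -rs.
  rewrite (big_cat_nat _ (n := r)) //=; last exact: leq_addr.
  rewrite big_nat (eq_bigr (fun _ => s%:Z)) => [|a /andP[_ ->] //].
  rewrite -big_nat [X in _ + X]big_nat (eq_bigr (F1 := fun a => if (a < r)%N then _ else _) (fun _ => - r%:Z)); last first.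
    by move=> a /andP[ra _]; rewrite ltnNge ra.
  rewrite -big_nat !sumr_const_nat subn0 addKn.
  by rewrite -[X in X + _]mulr_natr -[X in _ + X]mulr_natr !natz mulNr mulrC subrr.
- exists ord0; rewrite /l /= r0 eqz_nat -lt0n //.
pose F1 : {mpoly C[n.+1]} := qA \mPo [tuple 'X_(inord j : 'I_n.+1) | j < r].
pose F2 : {mpoly C[n.+1]} := qB \mPo [tuple 'X_(inord (r + j) : 'I_n.+1) | j < s].
have F12 : lsubst (invmx h) (val F) = F1 + F2.
  have : val F = lsubst h (F1 + F2); last first.
    by move/(congr1 (lsubst (invmx h))); rewrite lsubst_comp (mulVmx hu) lsubst1.
  rewrite FE raddfD /=; congr (_ + _).
    rewrite /F1 /lsubst comp_comp; apply: eq_comp => m j _ _; rewrite !tnth_mktuple.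
    rewrite -[RHS]/(lsubst h 'X_(inord j)) hX inordK; last first.
      by rewrite -rs (leq_trans (ltn_ord j)) ?leq_addr.
    by rewrite tnth_map (tnth_nth 0) /X nth_cat size_tuple ltn_ord.
  rewrite /F2 /lsubst comp_comp; apply: eq_comp => m j _ _; rewrite !tnth_mktuple.
  rewrite -[RHS]/(lsubst h 'X_(inord (r + j))) hX inordK; last first.
    by rewrite -rs ltn_add2l.
  by rewrite tnth_map (tnth_nth 0) /X nth_cat size_tuple ltnNge leq_addr /= addKn.
have supp_proj (P : pred 'I_n.+1) (q : {mpoly C[n.+1]}) :
    lsubst (diag_mx (\row_a (P a)%:R)) q = q ->
    forall m a, m \in msupp q -> m a != 0%N -> P a.
  move=> qE m a; rewrite mcoeff_msupp -{1}qE mcoeff_lsubst_diag mulf_eq0 negb_or.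
  move=> /andP[/prodf_neq0/(_ a isT) + _] ma; rewrite mxE.
  by case: (P a); rewrite // expr0n (negPf ma) eqxx.
have proj_var (P : pred 'I_n.+1) a : P a ->
    lsubst (diag_mx (\row_a (P a)%:R)) 'X_a = 'X_a :> {mpoly C[n.+1]}.
  move=> Pa; rewrite lsubstX (bigD1 a) //= big1 ?addr0 => [|b /negPf ba].
    by rewrite !mxE eqxx Pa scale1r.
  by rewrite !mxE ba scale0r.
have F1s := @supp_proj (fun a => (a < r)%N) F1.
have F2s := @supp_proj (fun a => ~~ (a < r)%N) F2.
have {}F1s m a : m \in msupp F1 -> m a != 0%N -> (a < r)%N.
  apply: F1s; rewrite /F1 /lsubst comp_comp; apply: eq_comp => m' j _ _.
  rewrite !tnth_mktuple; apply: proj_var; rewrite inordK // -rs.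
  by rewrite (leq_trans (ltn_ord j)) ?leq_addr.
have {}F2s m a : m \in msupp F2 -> m a != 0%N -> ~~ (a < r)%N.
  apply: F2s; rewrite /F2 /lsubst comp_comp; apply: eq_comp => m' j _ _.
  rewrite !tnth_mktuple; apply: (@proj_var (fun a => ~~ (a < r)%N)).
  by rewrite inordK -?leqNgt ?leq_addr // -rs ltn_add2l.
move=> m a b; rewrite F12 => /msuppD_le; rewrite mem_cat => /orP[] mF ma mb; rewrite /l.
  by rewrite (F1s m a) ?(F1s m b).
by rewrite (negPf (F2s m a mF ma)) (negPf (F2s m b mF mb)).
Qed.

End Decomposition.

(** * Stability of a form and of its gradient *)

Section ScalingOrbits.
Variables (C : numClosedFieldType) (n : nat) (W : vectType C) (act : 'M[C]_n -> W -> W).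
Hypothesis act_scale : forall g c x, act g (c *: x) = c *: act g x.

Lemma semistable_scale c w : semistable act (c *: w) -> semistable act w.
Proof.
move=> ss cl; apply: ss; rewrite -(scaler0 _ c).
apply: (zariski_closure_image (psi := fun x => c *: x)) cl => [j|_ [g g1 ->]]; last first.
  by exists g; rewrite ?act_scale.
have [P hP] := polyfunM (polyfun_const W c) (polyfun_linear (coord (vbasis {:W}) j)).
by exists P => x; rewrite -hP linearZ.
Qed.

Lemma finite_stabilizer_scale c w :
  finite_stabilizer act (c *: w) -> finite_stabilizer act w.
Proof. by move=> [s hs]; exists s => g g1 gw; apply: hs; rewrite // act_scale gw. Qed.

Lemma closure_fixed_point w y : (forall g, \det g = 1 -> act g w = w) ->
  zariski_closure (SL_orbit act w) y -> y = w.
Proof.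
move=> fixw cl; rewrite (coord_vbasis (memvf y)) (coord_vbasis (memvf w)).
apply: eq_bigr => j _; congr (_ *: _); apply/eqP; rewrite -subr_eq0; apply/eqP.
have := cl ('X_j - (coord (vbasis {:W}) j w)%:MP); rewrite mevalB mevalXU mevalC; apply.
by move=> _ [g g1 ->]; rewrite mevalB mevalXU mevalC fixw // subrr.
Qed.

End ScalingOrbits.

Section Gradient.
Variables (C : numClosedFieldType) (n d : nat).
Local Notation form := (dhomog n.+1 C).
Local Notation act := (ext_act (k := n.+1) (@form_act C n.+1 d)).
Implicit Types (F : form d.+1).

(** If a derivative of F in some direction vanishes, F involves at most n variables
    after a change of coordinates, and the torus contracting these destabilizes it. *)
Lemma semistable_indep F : semistable (@form_act C n.+1 d.+1) F ->
  independent_partials (val F).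
Proof.
move=> ssF c c0 j; apply/eqP/negPn/negP => cj.
case: (@arg_maxnP _ j (fun a => c a != 0) (@nat_of_ord n.+1) cj) => i ci imax.
pose p : 'M[C]_n.+1 := \matrix_(a, b) if a == i then c b / c i else (a == b)%:R.
have p1 : \det p = 1.
  apply: det_lower_unipotent => [a b ab|a]; rewrite mxE; case: eqP => [ai|_].
  - have -> : c b = 0; last by rewrite mul0r.
    by apply/eqP/negPn/negP => /imax /=; rewrite -ai leqNgt ab.
  - by rewrite (_ : a == b = false) //; apply/negbTE; move: ab; apply: contraTneq => ->; rewrite ltnn.
  - by rewrite ai divff.
  - by rewrite eqxx.
have dF : (lsubst p (val F))^`M(i) = 0.
  rewrite mderiv_lsubst; transitivity (lsubst p ((c i)^-1 *: \sum_j c j *: (val F)^`M(j))).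
    rewrite scaler_sumr (linear_sum (lsubst p)); apply: eq_bigr => b _.
    by rewrite scalerA linearZ mxE eqxx mulrC.
  by rewrite c0 scaler0 linear0.
have mi m : m \in msupp (lsubst p (val F)) -> m i = 0%N.
  move=> mF; apply/eqP/negPn/negP => m0.
  have := congr1 (mcoeff (m - U_(i))%MM) dF; rewrite mcoeff0 mcoeff_mderiv submK ?lep1mP //.
  by move/eqP; rewrite mulrn_eq0 /= mcoeff_eq0 mF.
pose k (a : 'I_n.+1) : int := (a == i)%:R.
have k1 : \sum_a k a = 1.
  by rewrite (bigD1 i) //= big1 ?addr0 /k ?eqxx // => a /negPf ->.
apply: (semistable_weights ssF p1 (@sum_corrected_weight n.+1 d (fun=> 0) k _)).
  by rewrite big1.
move=> m mF.
apply: lt_le_trans (corrected_weight_ge (lsubst_homog p (dhomog_is_dhomog F)) _ mF).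
  by rewrite k1 mulr1.
move=> m' a m'F m'a; rewrite /weight big1 => [|b _]; last by rewrite mulr0.
rewrite addr0 /k; case: eqP => // ai; by rewrite ai mi ?eqxx in m'a.
Qed.

Lemma gradient_free F : semistable (@form_act C n.+1 d.+1) F ->
  free [seq partial i F | i : 'I_n.+1].
Proof.
move=> /semistable_indep indep.
suff : free [tuple partial i F | i < n.+1] by [].
apply/freeP => c c0.
have {}c0 : \sum_i c i *: partial i F = 0.
  by rewrite -[RHS]c0; apply: eq_bigr => i _; rewrite -tnth_nth tnth_mktuple.
by apply: indep; have := congr1 val c0; rewrite raddf_sum.
Qed.

Lemma dim_nabla F : semistable (@form_act C n.+1 d.+1) F -> \dim (nabla F) == n.+1.
Proof. by move/gradient_free/eqP ->; rewrite size_map size_enum_ord. Qed.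

Lemma plucker_line_gradient F (P : Grass n.+1 (form d)) : val P = nabla F ->
  [/\ wedge_gradient F \in plucker_line P, wedge_gradient F <> 0 &
    forall w, w \in plucker_line P -> exists k, w = k *: wedge_gradient F].
Proof.
move=> PF.
have szX : size (vbasis (val P)) == n.+1 by rewrite size_tuple; exact: (svalP P).
pose X := Tuple szX; pose Y := [tuple partial i F | i < n.+1].
have freeX : free X := basis_free (vbasisP (val P)).
have XY : (<<X>> = <<Y>>)%VS by rewrite (span_basis (vbasisP (val P))) PF.
have [c c0 wE] := wedge_basis freeX XY.
have YE : wedge (fun a : 'I_n.+1 => Y`_a) = wedge_gradient F.
  by apply: eq_wedge => a; rewrite -tnth_nth tnth_mktuple.
rewrite YE in wE.
have lineE w : (w \in plucker_line P) = (w \in <[wedge (fun a : 'I_n.+1 => X`_a)]>%VS) by [].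
split=> [|w0|w].
- by rewrite lineE; apply/vlineP; exists c^-1; rewrite wE scalerA mulVf // scale1r.
- by have := wedge_free freeX; rewrite wE w0 scaler0 eqxx.
- by rewrite lineE => /vlineP[k ->]; exists (k * c); rewrite wE scalerA.
Qed.

Lemma gradient_semistable F : semistable (@form_act C n.+1 d.+1) F ->
  semistable act (wedge_gradient F).
Proof.
move=> ssF /closure_generic_point[K [i [p [g [g1 gy]]]]].
have [|h [l [h1 l0 pos]]] :=
    gradient_unstable_place (dhomog_is_dhomog F) (semistable_indep ssF) g1 (p := p).
  move=> a; have [z -> zy] := gy a; exists z => //; rewrite zy.
  exact: (linear0 (@ext_minor_linear C n d n.+1 a)).
exact: semistable_weights ssF h1 l0 pos.
Qed.

End Gradient.

Section ClosedOrbits.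
Variables (C : numClosedFieldType) (n : nat).
Local Notation form := (dhomog n.+1 C).

(** The wedge product of n + 1 linear forms is multiplied by the determinant. *)
Lemma ext_act_linear_forms (g : 'M[C]_n.+1) (v : 'I_n.+1 -> form 1) : \det g = 1 ->
  ext_act (@form_act C n.+1 1) g (wedge v) = wedge v.
Proof.
move=> g1; pose S : 'M[C]_n.+1 := \matrix_(a, b) (val (v a))@_(U_(b)).
have vE a : v a = \sum_b S a b *: linear_form C b.
  by rewrite [LHS]linear_formE; apply: eq_bigr => b _; rewrite mxE.
rewrite ext_act_wedge (eq_wedge vE) wedge_lincomb.
transitivity (wedge (fun a => \sum_b (S *m g^T) a b *: linear_form C b)); last first.
  by rewrite wedge_lincomb det_mulmx det_tr g1 mulr1.
apply: eq_wedge => a; rewrite vE linear_sum.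
transitivity (\sum_c \sum_b (S a c * g b c) *: linear_form C b).
  apply: eq_bigr => c _; rewrite linearZ /=.
  have -> : form_act g (linear_form C c) = \sum_b g b c *: linear_form C b.
    by apply: val_inj; rewrite raddf_sum; apply: (lsubstX g c).
  by rewrite scaler_sumr; apply: eq_bigr => b _; rewrite scalerA.
rewrite exchange_big; apply: eq_bigr => b _; rewrite -scaler_suml.
by rewrite [(S *m _) a b]mxE; congr (_ *: _); apply: eq_bigr => c _; rewrite [g^T _ _]mxE.
Qed.

(** A point y of the closure is the residue of a point g w, and such residues lie in
    the orbit by the integrality results above; for d = 1, w is a fixed point. *)
Lemma gradient_closed_orbit d (F : form d.+1) : (0 < d)%N ->
  stable (@form_act C n.+1 d.+1) F ->
  closed_orbit (ext_act (@form_act C n.+1 d)) (wedge_gradient F).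
Proof.
case: d F => // [[|d]] F _ stF y cly.
  have fixw g : \det g = 1 -> ext_act (@form_act C n.+1 1) g (wedge_gradient F) = wedge_gradient F.
    exact: ext_act_linear_forms.
  by exists 1%:M; rewrite ?det1 // fixw ?det1 //; apply: closure_fixed_point cly.
have [K [i [p [g [g1 gy]]]]] := closure_generic_point cly.
have indep := semistable_indep (stable_semistable stF).
have F0 : val F != 0.
  by apply/eqP => F0; case: stF => [[+ _] _]; apply; apply: val_inj.
have stab := stable_weights stF.
have [a|g0 g01 res] := gradient_residue (d := d.+2) isT (dhomog_is_dhomog F) indep stab F0 g1 (p := p).
  by have [z -> _] := gy a; exists z.
exists g0 => //; rewrite ext_act_wedge; apply: ext_minor_inj cly _ => [x [h _ ->]|a].
  by rewrite ext_act_wedge; eexists.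
rewrite ext_minor_wedge; have [z gz <-] := gy a; have [z' gz' <-] := res a.
by congr (vres p _); apply: (@vval_inj _ _ _ p); rewrite -gz -gz'.
Qed.

(** A generic element g = k1 t k2 of an infinite stabilizer is not integral, so that
    the weights of t are not all equal and split F. *)
Lemma gradient_infinite_stabilizer d (F : form d.+1) :
  stable (@form_act C n.+1 d.+1) F ->
  ~ finite_stabilizer (ext_act (@form_act C n.+1 d)) (wedge_gradient F) ->
  exists U W : {vspace form 1}, nontrivial_decomposition U W /\
    exists A B : {mpoly C[n.+1]}, [/\ in_Sym d.+1 U A, in_Sym d.+1 W B & val F = A + B].
Proof.
move=> stF /stabilizer_generic_point[K [i [p [g [g1 gE [a [b gab]]]]]]].
have indep := semistable_indep (stable_semistable stF).
have F0 : val F != 0.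
  by apply/eqP => F0; case: stF => [[+ _] _]; apply; apply: val_inj.
have stab := stable_weights stF.
have [c|k1 [k2 [t [l [[d1 d2 t0 t1] gk [l0 lm] lint Fblock]]]]] :=
    gradient_split_place (dhomog_is_dhomog F) indep g1 stab F0 (p := p).
  by rewrite [X in integral p X]gE; apply: integral_cst.
apply: (@block_decomposition _ _ _ F (map_mx (vres p) k2) l).
- by rewrite det_map_mx d2 rmorph1.
- have [/existsP[a0 /existsP[b0 lab]]|/existsPn lconst] := boolP [exists a, exists b, l a != l b].
    by exists a0, b0.
  have {}lconst a0 b0 : l a0 = l b0.
    by apply/eqP; have /existsPn/(_ b0) := lconst a0; rewrite negbK.
  have tint c : integral p (t 0 c).
    apply: (@integral_root _ _ _ _ _ n.+1) => //.
    have -> : t 0 c ^+ n.+1 = \prod_e (t 0 c / t 0 e).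
      by rewrite big_split /= prodfV t1 invr1 mulr1 prodr_const card_ord.
    by apply: integral_prod => e _; apply: lint; rewrite (lconst c e).
  case: gab; rewrite gk mxE; apply: integral_sum => c _; apply: integralM.
    rewrite mul_mx_diag !mxE; apply: integralM => //; exact: integral_val.
  by rewrite mxE; apply: integral_val.
- by move=> m a0 b0; apply: Fblock.
Qed.

End ClosedOrbits.

Theorem gradient_stability (C : numClosedFieldType) (n d : nat) (d_gt0 : (0 < d)%N)
    (F : dhomog n.+1 C d.+1) :
  (semistable (@form_act C n.+1 d.+1) F <->
     exists P : Grass n.+1 (dhomog n.+1 C d),
       val P = nabla F /\ Grass_semistable (@form_act C n.+1 d) P) /\
  (stable (@form_act C n.+1 d.+1) F ->
     exists P : Grass n.+1 (dhomog n.+1 C d),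
       [/\ val P = nabla F,
           Grass_polystable (@form_act C n.+1 d) P &
           Grass_stable (@form_act C n.+1 d) P <->
             forall U W : {vspace dhomog n.+1 C 1},
               nontrivial_decomposition U W ->
               ~ exists A B : {mpoly C[n.+1]},
                   [/\ in_Sym d.+1 U A, in_Sym d.+1 W B & val F = A + B]]).
Proof.
split.
  split=> [ssF|[P [PF [w [wP w0 ssw]]]]].
    exists (exist _ (nabla F) (dim_nabla ssF)); split=> //.
    have [wP w0 _] := plucker_line_gradient (erefl : val (exist _ (nabla F) (dim_nabla ssF)) = nabla F).
    by exists (wedge_gradient F); split; [exact: wP | exact: w0 | exact: gradient_semistable].
  have [_ _ /(_ w wP)[k wE]] := plucker_line_gradient PF.
  apply: semistable_of_gradient; rewrite wE in ssw.
  by apply: semistable_scale ssw => g c x; apply: ext_act_scale.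
move=> stF; have ssF := stable_semistable stF.
pose P : Grass n.+1 (dhomog n.+1 C d) := exist _ (nabla F) (dim_nabla ssF).
have PF : val P = nabla F by [].
have [wP w0 lineP] := plucker_line_gradient PF.
have psw : polystable (ext_act (@form_act C n.+1 d)) (wedge_gradient F).
  by split=> //; apply: gradient_closed_orbit.
exists P; split; [exact: PF | by exists (wedge_gradient F); split; [exact: wP | exact: w0 | exact: psw] |].
split=> [[w [/lineP[k ->] _ [_ finw]]] U W UW AB|noUW].
  have [h [l [hu l0 lj block]]] := decomposition_block UW AB.
  apply: (block_infinite_stabilizer hu l0 lj block).
  by apply: finite_stabilizer_scale finw => g c x; apply: ext_act_scale.
exists (wedge_gradient F); split; [exact: wP | exact: w0 | split; first exact: psw].
apply: contrapT => /(gradient_infinite_stabilizer stF)[U [W [UW AB]]].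
exact: noUW UW AB.
Qed.

Theorem theorem1p0p1 (R : realType) (n d : nat) (d_gt0 : (0 < d)%N)
    (F : dhomog n.+1 R[i] d.+1) :
  (semistable (@form_act R[i] n.+1 d.+1) F <->
     exists P : Grass n.+1 (dhomog n.+1 R[i] d),
       val P = nabla F /\ Grass_semistable (@form_act R[i] n.+1 d) P) /\
  (stable (@form_act R[i] n.+1 d.+1) F ->
     exists P : Grass n.+1 (dhomog n.+1 R[i] d),
       [/\ val P = nabla F,
           Grass_polystable (@form_act R[i] n.+1 d) P &
           Grass_stable (@form_act R[i] n.+1 d) P <->
             forall U W : {vspace dhomog n.+1 R[i] 1},
               nontrivial_decomposition U W ->
               ~ exists A B : {mpoly R[i][n.+1]},
                   [/\ in_Sym d.+1 U A, in_Sym d.+1 W B & val F = A + B]]).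
Proof. exact: (@gradient_stability R[i] n d d_gt0 F). Qed.
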